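(* Let $L$ be a finite relational language all of whose symbols are unary or binary, and let $\mathcal F$ be a finite family of finite enumerated irreducible $L$-structures. Then every $\mathcal K^{\mathcal F}$-universal $L$-structure $\mathbf K$ has finite big Ramsey degrees: for every finite substructure $\mathbf A$ of $\mathbf K$ there exists $n\in\omega$ such that for every colouring $\chi$ of $\mathrm{Emb}(\mathbf A,\mathbf K)$ with finitely many colours there exists $F\in\mathrm{Emb}(\mathbf K,\mathbf K)$ such that $\chi$ takes at most $n$ colours on $\{F\circ f: f\in\mathrm{Emb}(\mathbf A,\mathbf K)\}$.
   Context: All structures are finite or countably infinite, and substructures are induced. An $L$-structure $\mathbf A$ is enumerated if its vertex set is the cardinal $|A|$ (so a finite enumerated structure has vertex set $\{0,\dots,|A|-1\}$ and an infinite one has vertex set $\omega$). An embedding $f\colon\mathbf A\to\mathbf B$ between enumerated structures is ordered if $i<j$ implies $f(i)<f(j)$. $\mathrm{Emb}(\mathbf A,\mathbf B)$ is the set of all embeddings $\mathbf A\to\mathbf B$. An $L$-structure $\mathbf A$ is irreducible if for all $u,v\in A$ there is a relation symbol $R\in L$ and a tuple in $R^{\mathbf A}$ containing both $u$ and $v$. $\mathcal K^{\mathcal F}$ is the class of all finite enumerated $L$-structures $\mathbf A$ such that no $\mathbf F\in\mathcal F$ has an ordered embedding into $\mathbf A$. For an enumerated structure $\mathbf K$, $\mathrm{OAge}(\mathbf K)$ is the class of finite enumerated $L$-structures having an ordered embedding into $\mathbf K$. A countable enumerated $L$-structure $\mathbf K$ is $\mathcal K^{\mathcal F}$-universal if $\mathrm{OAge}(\mathbf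 K)=\mathcal K^{\mathcal F}$ and every countable enumerated $L$-structure $\mathbf K'$ with $\mathrm{OAge}(\mathbf K')\subseteq\mathcal K^{\mathcal F}$ has an ordered embedding into $\mathbf K$. *)

(* Defs.v *)
From mathcomp Require Import all_boot.
Set Implicit Arguments. Unset Strict Implicit. Unset Printing Implicit Defensive.

(* Vertex set of an enumerated structure: [Some n] means {0,..,n-1}, [None] means omega. *)
Definition in_card (c : option nat) (x : nat) : bool :=
  if c is Some n then x < n else true.

Record structure (Sym : finType) (ar : Sym -> nat) := Structure {
  card : option nat;
  rel : Sym -> seq nat -> Prop;
  rel_wf : forall s t, rel s t -> size t = ar s /\ all (in_card card) t
}.

(* list membership in Prop (structures have no decidable equality) *)
Fixpoint InL (T : Type) (x : T) (l : seq T) : Prop :=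
  if l is y :: l' then y = x \/ InL x l' else False.

Section Defs.
Variables (Sym : finType) (ar : Sym -> nat).
Implicit Types A B K : structure ar.

Definition in_dom A (x : nat) : bool := in_card (card A) x.

Definition finite_str A : Prop := exists n, card A = Some n.

(* f : A -> B is an embedding (only its values on the vertex set of A matter) *)
Definition is_emb A B (f : nat -> nat) : Prop :=
  (forall x, in_dom A x -> in_dom B (f x)) /\
  (forall x y, in_dom A x -> in_dom A y -> f x = f y -> x = y) /\
  (forall s t, size t = ar s -> all (in_dom A) t ->
     (rel A s t <-> rel B s (map f t))).

Definition is_ord_emb A B (f : nat -> nat) : Prop :=
  is_emb A B f /\ (forall i j, in_dom A i -> in_dom A j -> i < j -> f i < f j).

Definition ord_embeds A B : Prop := exists f, is_ord_emb A B f.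

Definition irreducible A : Prop :=
  forall u v, in_dom A u -> in_dom A v ->
    exists s t, rel A s t /\ u \in t /\ v \in t.

Definition in_KF (Fam : seq (structure ar)) A : Prop :=
  finite_str A /\ forall F, InL F Fam -> ~ ord_embeds F A.

Definition in_OAge K A : Prop := finite_str A /\ ord_embeds A K.

Definition KF_universal (Fam : seq (structure ar)) K : Prop :=
  (forall A, in_OAge K A <-> in_KF Fam A) /\
  (forall K', (forall A, in_OAge K' A -> in_KF Fam A) -> ord_embeds K' K).

(* Embeddings of the finite induced substructure of K on the vertex list X
   (uniq, in the domain of K) into K, encoded by the list of images [e]
   (the image of the i-th vertex of X is the i-th entry of e). *)
Definition sub_emb K (X : seq nat) (e : seq nat) : Prop :=
  size e = size X /\ uniq e /\ all (in_dom K) e /\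
  forall s t, size t = ar s -> all (fun x => x \in X) t ->
    (rel K s t <-> rel K s (map (fun x => nth 0 e (index x X)) t)).

End Defs.

(* Main.v *)
Require Import Defs.
From HB Require Import structures.
From mathcomp Require Import all_boot.
From mathcomp Require Import zify.
From mathcomp Require Import boolp.
Set Implicit Arguments. Unset Strict Implicit. Unset Printing Implicit Defensive.

(* The proof is elementary.  Code the vertices of K by words: the word of a vertex lists its
   2-types over earlier vertices, which are themselves named by words.  A map of words that
   respects levels, names and 2-types, and creates no new realisation of a member of the
   family, induces a self-map of the structure A of all coded vertices; since the members
   of the family are irreducible, A omits them, so it embeds into K by universality.

   Words behave like variable words: the Hales-Jewett theorem yields a pigeonhole principle
   for the ways of prolonging all words of a given length, and fusion turns it into a Ramsey
   theorem for the maps defined on the words of length below k.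

   Place the vertices of K in A so that before the level of each vertex its possible partners
   split, and every configuration of at most m of the vertices so far gets a block of levels
   of its own.  Then every copy of a finite X in K is the image, under some map, of a tuple of
   vertices below a level k that depends on the size of X only (its envelope).  As there are
   finitely many such tuples, the colour of a copy, after a Ramsey map, takes finitely many
   values. *)

(** * The Hales-Jewett theorem *)

(** Blocks answer the following obstacle. An envelope keeps boundedly many levels and must create no
    realisation of a member of the family, so each realisation visible on its lines needs a witness
    on kept levels. If the witnesses were vertices [y] of [K] themselves, the envelope would have to
    keep the line of each [y], then witnesses for the realisations seen there, and so on without
    bound. A block consists of copies of vertices whose words name only earlier members of the same
    block, so such a witness costs at most as many levels as the block has members. Realisations are
    tracked by patterns: some vertices are already found, the others are still words of one common
    length. Adding a letter can complete a pattern only through its last found vertex; turning that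
    vertex back into a word reduces the question to shorter words. Hence the closure of patterns
    under [down]. In the pigeonhole principle, Hales-Jewett controls a line once its variable is
    filled, but not its constant beginning. The iteration is therefore run twice, the second time
    with steps made from the limit of the first. *)

Definition fillw (w : seq (option nat)) (x : nat) : seq nat :=
  [seq odflt x o | o <- w].
Definition lineok (k : nat) (w : seq (option nat)) : bool :=
  (None \in w) && all (fun o => if o is Some a then a < k else true) w.
Definition monoline k (Cl : Type) (c : seq nat -> Cl) n :=
  exists w, [/\ size w = n, lineok k w &
    forall x y, x < k -> y < k -> c (fillw w x) = c (fillw w y)].

(** The colour-focused families of the classical proof; as the colours of the lines differ, [j]
    cannot exceed the number of colours. *)
Definition focused k (Cl : finType) (c : seq nat -> Cl) n j :=
  exists (f : seq nat) (ls : seq (seq (option nat) * Cl)),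
    [/\ size f = n, all (fun a => a < k.+1) f, size ls = j, uniq (unzip2 ls) &
     forall l, l \in ls -> [/\ size l.1 = n, lineok k.+1 l.1, fillw l.1 k = f &
        forall x, x < k -> c (fillw l.1 x) = l.2]].

Lemma fillw_cat w v x : fillw (w ++ v) x = fillw w x ++ fillw v x.
Proof. exact: map_cat. Qed.

Lemma fillw_some s x : fillw (map Some s) x = s.
Proof. by rewrite /fillw -map_comp map_id. Qed.

Lemma all_fillw k w x : lineok k w -> x < k -> all (fun a => a < k) (fillw w x).
Proof.
case/andP=> _ /allP h hx; apply/allP=> a /mapP[[b|] hb ->] //=.
exact: (h _ hb).
Qed.

Lemma lineok_widen k w : lineok k w -> lineok k.+1 w.
Proof.
case/andP=> h1 /allP h2; rewrite /lineok h1 /=; apply/allP=> -[a|] ha //.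
exact: leqW (h2 _ ha).
Qed.

(** Induction on the alphabet, and inside it on the number of focused lines. One more line costs one
    application of the smaller alphabet, and with more lines than colours only the monochromatic
    alternative survives. *)
Theorem hales_jewett k (Cl : finType) :
  exists n, forall c : seq nat -> Cl, monoline k c n.
Proof.
elim: k Cl => [|k IH] Cl.
  by exists 1 => c; exists [:: None]; split.
suff Foc j : exists n, forall c : seq nat -> Cl,
    monoline k.+1 c n \/ focused k c n j.
  have [n hn] := Foc #|Cl|.+1; exists n => c.
  case: (hn c) => // -[f [ls [_ _ hls hu _]]].
  have := max_card [in unzip2 ls]; move/card_uniqP: hu => ->.
  by rewrite size_map hls ltnn.
elim: j => [|j [n hn]].
  by exists 0 => c; right; exists [::], [::].
(* The colours record the whole colouring of the last [n] coordinates, so these look alike for all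
   letters below [k] put into [L]. *)
have [N hN] := IH {ffun n.-tuple 'I_k.+1 -> Cl}.
exists (N + n) => c.
pose c0 (a : seq nat) := [ffun b : n.-tuple 'I_k.+1 => c (a ++ map val b)].
have [L [sL okL cL]] := hN c0.
pose c' b := c (fillw L 0 ++ b).
have cc' b x : size b = n -> all (fun a => a < k.+1) b -> x < k ->
    c (fillw L x ++ b) = c' b.
  move=> sb /allP hb hx.
  have sb' : size (map (@inord k) b) == n by rewrite size_map sb.
  have := cL x 0 hx (leq_ltn_trans (leq0n _) hx).
  move/ffunP/(_ (Tuple sb')); rewrite !ffunE /= -map_comp.
  suff -> : map (val \o @inord k) b = b by [].
  by rewrite -[RHS]map_id; apply/eq_in_map => a /hb /= ha; rewrite inordK.
have ok0 : all (fun a => a < k.+1) (fillw L 0).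
  by apply: all_fillw => //; exact: lineok_widen.
have mono' w : size w = n -> lineok k.+1 w ->
    (forall x y, x < k.+1 -> y < k.+1 -> c' (fillw w x) = c' (fillw w y)) ->
    monoline k.+1 c (N + n).
  move=> sw okw hw; exists (map Some (fillw L 0) ++ w); split.
  - by rewrite size_cat !size_map sL sw.
  - case/andP: okw => h1 h2; rewrite /lineok mem_cat h1 orbT all_cat h2 andbT.
    by rewrite all_map.
  - by move=> x y hx hy; rewrite !fillw_cat !fillw_some; exact: hw.
case: (hn c') => [[w [sw okw hw]]|[f [ls [sf okf sls uls hls]]]].
  by left; exact: (mono' w).
(* If a focused line already has the colour of the focus, it is monochromatic for the last letter
   too; otherwise the focus supplies a new colour. *)
have [hf|hf] := boolP (c' f \in unzip2 ls).
  case/mapP: hf => -[w col] /= hin ecol; left.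
  have [/= sw okw fw hw] := hls _ hin.
  apply: (mono' w) => //.
  have E x : x < k.+1 -> c' (fillw w x) = col.
    rewrite ltnS leq_eqVlt => /orP[/eqP->|]; [by rewrite fw|exact: hw].
  by move=> x y hx hy; rewrite !E.
(* Old lines now vary together with [L], while the new line varies in [L] only and keeps [f] fixed;
   all still end in one word. *)
right; exists (fillw L k ++ f).
exists ((L ++ map Some f, c' f) :: [seq (L ++ l.1, l.2) | l <- ls]).
split.
- by rewrite size_cat size_map sL sf.
- by rewrite all_cat okf andbT; apply: all_fillw => //; exact: lineok_widen.
- by rewrite /= size_map sls.
- by rewrite /= /unzip2 -map_comp /= -/(unzip2 ls) hf.
- have [hN1 hN2] := andP (lineok_widen okL).
  move=> l; rewrite inE => /orP[/eqP-> /=|/mapP[l' hl' -> /=]].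
    split.
    + by rewrite size_cat size_map sL sf.
    + by rewrite /lineok mem_cat hN1 all_cat hN2 /= all_map.
    + by rewrite fillw_cat fillw_some.
    + by move=> x hx; rewrite fillw_cat fillw_some cc'.
  have [s1 ok1 f1 h1] := hls _ hl'.
  split.
  + by rewrite size_cat sL s1.
  + by case/andP: ok1 => _ a1; rewrite /lineok mem_cat hN1 all_cat hN2.
  + by rewrite fillw_cat f1.
  + move=> x hx; rewrite fillw_cat cc' ?h1 ?size_map //.
    by apply: all_fillw => //; rewrite ltnW.
Qed.

(** * Words *)

(* A word of length [n] describes what a vertex, of 1-type in [U], sees on the levels below
   [n]: the letter [inr (s, c)] on level [M] says that it has 2-type [c] over the vertex
   [(s, M)], and the other letters are mere marks. *)
Inductive word (U C : Type) : Type :=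
| W0 of U
| Ws of word U C & (option (option C) + (word U C * C)).

HB.instance Definition _ (U C : Type) := gen_eqMixin (word U C).

(* A structure on [plow + pup] vertices, of which the first [plow] still have to be found
   below the remaining ones. *)
Record pattern (U C : Type) := Pattern {
  plow : nat;
  pup : nat;
  pone : nat -> U;
  ptwo : nat -> nat -> C }.

Section Words.
Variables (U C : finType).
Notation word := (word U C).
Notation letter := (option (option C) + (word * C))%type.
Implicit Types (t s w x y z : word) (l : letter).

Lemma word_ind' (P : word -> Prop) :
  (forall u, P (W0 C u)) ->
  (forall t l, P t -> (forall s c, l = inr (s, c) -> P s) -> P (Ws t l)) ->
  forall w, P w.
Proof.
move=> H0 H1; fix IH 1 => -[u|t l]; first exact: H0.
apply: H1; first exact: IH.
by case: l => [m|[s' c']] s c; [move=> h; discriminate h|case=> <- _; exact: IH].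
Qed.

Fixpoint len w := if w is Ws t _ then (len t).+1 else 0.
Fixpoint root w := match w with W0 u => u | Ws t _ => root t end.
(** A name may be shorter than the level on which it is used, so a vertex is a pair of a word and a
    level, and the word alone does not determine it. *)
Fixpoint wf w := match w with
  | W0 _ => true
  | Ws t l => wf t && (if l is inr (s, _) then wf s && (len s <= len t) else true)
  end.
Fixpoint res n w := match w with
  | W0 u => w
  | Ws t l => if len t < n then w else res n t
  end.
Fixpoint lkp w i : option letter := match w with
  | W0 _ => None
  | Ws t l => if i == len t then Some l else lkp t i
  end.
Definition par w := if w is Ws t _ then t else w.
Definition lst w : letter := if w is Ws _ l then l else inl None.
Definition lmap (g : word -> word) l : letter :=
  match l with inl m => inl m | inr (s, c) => inr (g s, c) end.
(* A map of words moves the vertex [(s, M)] to [(plus f s, lv f M)]. *)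
Fixpoint plus (f : word -> word) w := match w with
  | W0 u => W0 C u
  | Ws t l => Ws (f t) (lmap (plus f) l)
  end.
Definition lev n w := wf w && (len w == n).
Definition pref x y := res (len x) y == x.
Definition pad n w := iter (n - len w) (fun t => Ws t (inl None)) w.

Lemma res_id n w : len w <= n -> res n w = w.
Proof. by case: w => [//|t l] /= ->. Qed.

Lemma len_res n w : len (res n w) = minn n (len w).
Proof. elim/word_ind': w => [u|t l IH _] /=; first by rewrite minn0.
case: ltnP => h /=; first by rewrite (minn_idPr _).
by rewrite IH !(minn_idPl _) // ltnW.
Qed.

Lemma root_res n w : root (res n w) = root w.
Proof. by elim/word_ind': w => [//|t l IH _] /=; case: ifP. Qed.

Lemma wf_res n w : wf w -> wf (res n w).
Proof. elim/word_ind': w => [//|t l IH _] /=; case: ifP => //= _ /andP[h _]; exact: IH. Qed.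

Lemma res_res m n w : res m (res n w) = res (minn m n) w.
Proof.
elim/word_ind': w => [//|t l IH _] /=.
case: (ltnP (len t) n) => h /=.
  by rewrite leq_min h andbT; case: ltnP => // h'; congr res; rewrite (minn_idPl _) //; lia.
by rewrite leq_min [_ < n]ltnNge h andbF IH.
Qed.

Lemma lkp_len w i l : lkp w i = Some l -> i < len w.
Proof.
elim/word_ind': w => [//|t l' IH _] /=; case: eqP => [-> _|_ /IH]; lia.
Qed.

Lemma lkp_res n w i : lkp (res n w) i = if i < n then lkp w i else None.
Proof.
elim/word_ind': w => [u|t l IH _] /=; first by case: ifP.
case: (ltnP (len t) n) => h /=.
  case: eqP => [->|/eqP ne]; first by rewrite h.
  case: ltnP => // h'; case E: (lkp t i) => //; move/lkp_len: E; lia.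
by rewrite IH; case: ltnP => // h'; case: eqP => // e; lia.
Qed.

Lemma pref_len x y : pref x y -> len x <= len y.
Proof. by move/eqP => <-; rewrite len_res; lia. Qed.

Lemma pref_refl x : pref x x.
Proof. by rewrite /pref res_id. Qed.
Hint Resolve pref_refl : core.

Lemma pref_trans : transitive pref.
Proof.
move=> y x z h1 h2; have := pref_len h1; move/eqP: h1 => h1; move/eqP: h2 => h2 h3.
by rewrite /pref; have := res_res (len x) (len y) z; rewrite h2 h1 (minn_idPl h3) => <-.
Qed.

Lemma pref_res n x : pref (res n x) x.
Proof. by rewrite /pref len_res; have := res_res n (len x) x; rewrite [res (len x) x]res_id // => <-. Qed.

Lemma pref_eq x y : pref x y -> len x = len y -> x = y.
Proof. by move=> /eqP h1 h2; rewrite -h1 h2 res_id. Qed.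

Lemma pref_par x y : pref x y -> len x < len y -> pref x (par y).
Proof.
case: y => [//|t l] /= h1 h2; move: h1; rewrite /pref /=.
by rewrite ltnNge -ltnS h2.
Qed.

Lemma pref_Ws t l y : pref (Ws t l) y -> pref t y.
Proof. by apply: pref_trans; rewrite /pref /= ltnn res_id. Qed.

Lemma pref_par1 w : pref (par w) w.
Proof. by case: w => [u|t l] //=; rewrite /pref /= ltnn res_id. Qed.

Lemma pref_root x y : pref x y -> root y = root x.
Proof. by move/eqP <-; rewrite root_res. Qed.

Lemma pref_lkp x y i l : pref x y -> lkp x i = Some l -> lkp y i = Some l.
Proof. by move/eqP <-; rewrite lkp_res; case: ifP. Qed.

Lemma pref_lkp_eq x y i : pref x y -> i < len x -> lkp y i = lkp x i.
Proof. by move/eqP <-; rewrite lkp_res len_res leq_min => /andP[-> _]. Qed.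

Lemma pref_total x y z : pref x z -> pref y z -> len x <= len y -> pref x y.
Proof. by move=> /eqP h1 /eqP h2 h; rewrite /pref -h2 res_res (minn_idPl h) h1. Qed.

Lemma wf_lkp w i s c : wf w -> lkp w i = Some (inr (s, c)) -> wf s && (len s <= i).
Proof.
elim/word_ind': w => [//|t l IH _] /= /andP[h1 h2].
case: eqP => [->[e]|_]; last exact: IH.
by rewrite e in h2.
Qed.

Lemma pad_len n w : len w <= n -> len (pad n w) = n.
Proof.
rewrite /pad => h; rewrite -{2}(subnK h); elim: (n - len w) => //= k ->; lia.
Qed.

Lemma pad_wf n w : wf w -> wf (pad n w).
Proof. by rewrite /pad => h; elim: (n - len w) => //= k ->. Qed.

Lemma pad_pref n w : pref w (pad n w).
Proof.
rewrite /pad; elim: (n - len w) => //= k IH; apply: pref_trans IH _.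
by rewrite /pref /= ltnn res_id.
Qed.

Lemma pad_lkp n w i s c : lkp (pad n w) i = Some (inr (s, c)) -> lkp w i = Some (inr (s, c)).
Proof. by rewrite /pad; elim: (n - len w) => //= k IH; case: eqP. Qed.

Lemma pad_lev n w : wf w -> len w <= n -> lev n (pad n w).
Proof. by move=> h1 h2; rewrite /lev pad_wf //= pad_len. Qed.

Lemma levP n w : reflect (wf w /\ len w = n) (lev n w).
Proof. by apply: (iffP andP) => -[h /eqP]. Qed.

Lemma lev_len n w : lev n w -> len w = n. Proof. by case/levP. Qed.
Lemma lev_wf n w : lev n w -> wf w. Proof. by case/levP. Qed.

Lemma lev_par n w : lev n.+1 w -> lev n (par w).
Proof. by case: w => [//|t l] /levP[/= /andP[h _] [e]]; apply/levP. Qed.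

Lemma lev_parlst n w : lev n.+1 w -> w = Ws (par w) (lst w).
Proof. by case: w => // u /levP[]. Qed.

Definition letters (ws : seq word) : seq letter :=
  map inl (enum {: option (option C)}) ++ [seq inr (s, c) | s <- ws, c <- enum C].
Fixpoint words_upto n : seq word * seq word :=
  if n is n'.+1 then
    let: (e, ws) := words_upto n' in
    let e' := [seq Ws t l | t <- e, l <- letters ws] in (e', ws ++ e')
  else let e := map (W0 C) (enum U) in (e, e).

Lemma wlP n : (forall w, lev n w -> w \in (words_upto n).1) /\
  (forall w, wf w -> len w <= n -> w \in (words_upto n).2).
Proof.
elim: n => [|n] /=.
  suff H w : len w = 0 -> w \in map (W0 C) (enum U).
    by split=> w; [move/lev_len => h; exact: H|move=> _ h; apply: H; lia].
  by case: w => // u _; apply/map_f; rewrite mem_enum.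
case: (words_upto n) => e ws /= [IH1 IH2].
have H w : lev n.+1 w -> w \in [seq Ws t l | t <- e, l <- letters ws].
  move=> hw; rewrite (lev_parlst hw); apply: allpairs_f; first exact: IH1 (lev_par hw).
  case: w hw => [u|t [m|[s c]]] /levP //= [] => [_ _|/andP[_ /andP[h1 h2]] [e1]].
    by rewrite mem_cat map_f ?mem_enum.
  rewrite mem_cat; apply/orP; right; apply: (allpairs_f (fun s c => inr (s, c))).
    by apply: IH2 => //; lia.
  by rewrite mem_enum.
split=> // w hw; rewrite leq_eqVlt mem_cat => /orP[/eqP h|h].
  by rewrite H ?orbT //; apply/levP.
by rewrite IH2.
Qed.

Definition levs n := [seq w <- (words_upto n).1 | lev n w].
Lemma mem_levs n w : (w \in levs n) = lev n w.
Proof. by rewrite mem_filter andbC; case h: (lev n w); rewrite ?andbF ?andbT // (wlP n).1. Qed.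
Definition lews n := [seq w <- (words_upto n).2 | wf w && (len w <= n)].
Lemma mem_lews n w : (w \in lews n) = wf w && (len w <= n).
Proof.
rewrite mem_filter andbC; case h: (_ && (_ <= _)); rewrite ?andbF ?andbT //.
by case/andP: h => h1 h2; rewrite (wlP n).2.
Qed.

(** Serves as finiteness of function spaces: later arguments treat all maps between two finite sets
    of words one after another. *)
Lemma fin_maps (A B : seq word) :
  exists F : seq (word -> word), forall p, (forall t, t \in A -> p t \in B) ->
    exists i, i < size F /\ forall t, t \in A -> nth id F i t = p t.
Proof.
elim: A => [|a A [F IH]].
  by exists [:: id] => p _; exists 0; split.
exists [seq (fun t => if t == a then b else f t) | b <- B, f <- F] => p hp.
have [t ht|i [hi hF]] := IH p; first by apply: hp; rewrite inE ht orbT.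
have hb : p a \in B by apply: hp; rewrite mem_head.
pose j := index (p a) B.
have hj : j < size B by rewrite index_mem.
have sz : forall n k, n < size B -> k < size F ->
  n * size F + k < size [seq (fun t => if t == a then b else f t) | b <- B, f <- F] /\
  nth id [seq (fun t => if t == a then b else f t) | b <- B, f <- F] (n * size F + k) =
    fun t => if t == a then nth a B n else nth id F k t.
  elim: (B) => [//|b B' IHB] [|n] k /= hn hk.
    by rewrite size_cat size_map nth_cat size_map add0n hk (nth_map id) //; split => //; lia.
  have [h1 h2] := IHB n k hn hk.
  rewrite size_cat size_map nth_cat size_map; split; first by lia.
  by rewrite ifN ?mulSn; [rewrite -addnA addKn h2|lia].
have [h1 h2] := sz j i hj hi.
exists (j * size F + i); split => // t; rewrite h2 inE.
case: eqP => [-> _|_ /= ht]; first by rewrite nth_index.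
exact: hF.
Qed.

End Words.

(** * Morphisms *)

Section Morphisms.
Variables (U C : finType) (u0 : U).
Notation word := (word U C).
Notation letter := (option (option C) + (word * C))%type.
Implicit Types (t w x y z : word) (l : letter) (pi : pattern U C).
Local Hint Resolve pref_refl : core.

(** Nothing is asked between the upper nodes [ts]: their own levels are not chosen yet, so they
    cannot name one another. *)
Definition real pi (ts s : nat -> word) (M : nat -> nat) :=
  [/\ forall i, i < plow pi -> root (s i) = pone pi i,
      forall i j, i < j -> j < plow pi ->
        lkp (s j) (M i) = Some (inr (s i, ptwo pi i j)),
      forall r, r < pup pi -> root (ts r) = pone pi (plow pi + r) &
      forall i r, i < plow pi -> r < pup pi ->
        lkp (ts r) (M i) = Some (inr (s i, ptwo pi i (plow pi + r)))].
Definition bad pi ts := exists s M, real pi ts s M.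
(** The last lower vertex becomes the first upper node; the numbering of the vertices is unchanged,
    so the types stay as they are. *)
Definition down pi := Pattern (plow pi).-1 (pup pi).+1 (pone pi) (ptwo pi).

Variable okp : pattern U C -> Prop.
Hypothesis okp_pos : forall pi, okp pi -> 0 < pup pi.
Hypothesis okp_down : forall pi, okp pi -> 0 < plow pi -> okp (down pi).

Definition aged n (p : word -> word) := forall pi ts, okp pi ->
  (forall r, r < pup pi -> lev n (ts r)) -> bad pi (p \o ts) -> bad pi ts.

Lemma bad_mono pi ts ts' : (forall r, r < pup pi -> pref (ts r) (ts' r)) ->
  bad pi ts -> bad pi ts'.
Proof.
move=> h [s [M [h1 h2 h3 h4]]]; exists s, M; split=> // [r hr|i r hi hr].
  by rewrite (pref_root (h r hr)) h3.
exact: pref_lkp (h r hr) (h4 i r hi hr).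
Qed.

Lemma eq_bad pi ts ts' : (forall r, r < pup pi -> ts r = ts' r) ->
  bad pi ts -> bad pi ts'.
Proof. by move=> h; apply: bad_mono => r /h ->. Qed.

Lemma eq_aged n p q : (forall t, lev n t -> p t = q t) -> aged n p -> aged n q.
Proof.
move=> h hp pi ts ok hl hb; apply: hp => //; apply: eq_bad hb => r hr /=.
by rewrite h // hl.
Qed.

Lemma aged_comp n m p q : (forall t, lev n t -> lev m (p t)) ->
  aged n p -> aged m q -> aged n (q \o p).
Proof. by move=> h hp hq pi ts ok hl hb; apply: hp => //; apply: hq => // r hr; apply/h/hl. Qed.

Lemma real_names pi ts s M : 0 < pup pi -> wf (ts 0) -> real pi ts s M ->
  (forall i, i < plow pi -> wf (s i) && (len (s i) <= M i)) /\
  (forall i j, i < j -> j < plow pi -> M i < len (s j)).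
Proof.
move=> h0 hw [_ h2 _ h4]; split=> [i hi|i j hij hj]; last exact: lkp_len (h2 i j hij hj).
exact: wf_lkp hw (h4 i 0 hi h0).
Qed.

Lemma real_lt pi ts s M i r : real pi ts s M -> i < plow pi -> r < pup pi ->
  M i < len (ts r).
Proof. by case=> _ _ _ h hi hr; exact: lkp_len (h i r hi hr). Qed.

Lemma real_cut pi ts ts' s M : (forall r, r < pup pi -> pref (ts' r) (ts r)) ->
  (forall i r, i < plow pi -> r < pup pi -> M i < len (ts' r)) ->
  real pi ts s M -> real pi ts' s M.
Proof.
move=> hp hM [h1 h2 h3 h4]; split=> // [r hr|i r hi hr].
  by rewrite -(pref_root (hp r hr)) h3.
by rewrite -(pref_lkp_eq (hp r hr)) ?h4 // hM.
Qed.

(** The levels increase: the name of a later vertex mentions the earlier levels and is itself no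
    longer than its own level. *)
Lemma real_below pi ts s M N : 0 < pup pi -> wf (ts 0) -> real pi ts s M ->
  (0 < plow pi -> M (plow pi).-1 < N) -> forall i, i < plow pi -> M i < N.
Proof.
move=> h0 hw hr hN i hi; have [n1 n2] := real_names h0 hw hr.
have ha : 0 < plow pi by lia.
case: (eqVneq i (plow pi).-1) => [->|ne]; first exact: hN.
have h' : (plow pi).-1 < plow pi by lia.
have hi' : i < (plow pi).-1 by lia.
have := n2 _ _ hi' h'; have /andP[_] := n1 _ h'; have := hN ha; lia.
Qed.

(* The only new vertex that can take part in a pattern is the last one, because
   all lower vertices of a pattern are named by its word. *)
Lemma ext_aged K N (q : word -> word) (y : word -> letter) :
  aged K q -> (forall t, lev K t -> lev N.+1 (Ws (q t) (y t))) ->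
  (forall pi ts s M, okp pi -> (forall r, r < pup pi -> lev K (ts r)) ->
     real pi (fun r => Ws (q (ts r)) (y (ts r))) s M ->
     0 < plow pi -> M (plow pi).-1 = N -> bad pi ts) ->
  aged K (fun t => Ws (q t) (y t)).
Proof.
move=> hq hl htop pi ts ok hts [s [M hr]].
have h0 := okp_pos ok.
have hw : wf (Ws (q (ts 0)) (y (ts 0))) by apply: lev_wf (hl _ (hts _ h0)).
have ln r : r < pup pi -> len (q (ts r)) = N by move=> /hts /hl /lev_len [].
case: (boolP ((0 < plow pi) && (M (plow pi).-1 == N))) => [/andP[h1 /eqP h2]|hn].
  exact: htop hr h1 h2.
apply: hq => //; exists s, M; apply: real_cut (hr) => [r _|i r hi hr'] /=.
  by rewrite (@pref_par1 _ _ (Ws _ _)).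
rewrite ln //; apply: (real_below h0 hw hr) hi => ha.
have := real_lt hr (i := (plow pi).-1) (r := 0); rewrite /= ln // => H.
by move: hn; rewrite ha /= => /eqP; move: (H ltac:(lia) h0); lia.
Qed.

Lemma plus_ext n (f g : word -> word) : (forall t, wf t -> len t < n -> f t = g t) ->
  forall t, wf t -> len t <= n -> plus f t = plus g t.
Proof.
move=> h; elim/word_ind' => [//|t l IH IHl] /= /andP[h1 h2] h3; rewrite h //.
case: l IHl h2 => [//|[s c]] IHl /andP[h4 h5] /=.
by rewrite (IHl s c) // (leq_trans h5) // ltnW.
Qed.

Lemma plus_idE n (f : word -> word) : (forall t, wf t -> len t < n -> f t = t) ->
  forall t, wf t -> len t <= n -> plus f t = t.
Proof.
move=> h; elim/word_ind' => [//|t l IH IHl] /= /andP[h1 h2] h3; rewrite h //.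
case: l IHl h2 => [//|[s c]] IHl /andP[h4 h5] /=.
by rewrite (IHl s c) // (leq_trans h5) // ltnW.
Qed.

(** A sample word of each length, from which the level [lv f i] is read off. *)
Definition zw i : word := pad i (W0 C u0).
Lemma zw_lev i : lev i (zw i). Proof. by apply: pad_lev. Qed.
Hint Resolve zw_lev : core.
Lemma zwS i : zw i.+1 = Ws (zw i) (inl None).
Proof. by rewrite /zw /pad !subn0. Qed.

Definition lv (f : word -> word) i := len (f (zw i)).
Lemma lvE f i : lv f i = len (f (zw i)). Proof. by []. Qed.
(* the length of [plus f t] for [t] of length [i] *)
Definition pl f i := if i is i'.+1 then (lv f i').+1 else 0.

(** A morphism on the words of length below [n]: [plus f t] is forced by the earlier levels, and
    between it and [f t] letters may be inserted. *)
Definition pmor n f := forall i, i < n ->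
  (forall t, lev i t -> lev (lv f i) (f t) /\ pref (plus f t) (f t)) /\ aged i f.

Lemma pmor_le n m f : m <= n -> pmor n f -> pmor m f.
Proof. by move=> h H i hi; apply: H; exact: leq_trans h. Qed.

Lemma pmor_lev n f t : pmor n f -> wf t -> len t < n -> lev (lv f (len t)) (f t).
Proof. by move=> h hw /h [H _]; case: (H t) => //; apply/levP. Qed.
Lemma pmor_pref n f t : pmor n f -> wf t -> len t < n -> pref (plus f t) (f t).
Proof. by move=> h hw /h [H _]; case: (H t) => //; apply/levP. Qed.

Lemma pmor_root n f t : pmor n f -> wf t -> len t < n -> root (f t) = root t.
Proof.
move=> h; elim/word_ind': t => [u|t l IH _] hw hl;
  rewrite (pref_root (pmor_pref h hw hl)) //=.
by apply: IH; [case/andP: hw|apply: ltnW].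
Qed.

Lemma root_plus n f t : pmor n f -> wf t -> len t <= n -> root (plus f t) = root t.
Proof. by case: t => [//|t l] h /= /andP[hw _] hl; exact: pmor_root h hw hl. Qed.

Lemma pl_lv n f i : pmor n f -> i < n -> pl f i <= lv f i.
Proof.
case: i => [//|i] h hi; have hz := lev_len (zw_lev i.+1).
have /pref_len : pref (plus f (zw i.+1)) (f (zw i.+1)).
  by apply: (pmor_pref h (lev_wf (zw_lev i.+1))); rewrite hz.
by rewrite /lv {1}zwS.
Qed.

Lemma lv_lt n f i j : pmor n f -> i < j -> j < n -> lv f i < lv f j.
Proof.
move=> h; elim: j => [//|j IH]; rewrite ltnS leq_eqVlt => /orP[/eqP->|hij] hj.
  exact: pl_lv h hj.
by apply: ltn_trans (IH hij (ltnW hj)) _; exact: pl_lv h hj.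
Qed.

Lemma lv_le n f i j : pmor n f -> i <= j -> j < n -> lv f i <= lv f j.
Proof. by move=> h; rewrite leq_eqVlt => /orP[/eqP->//|h1 h2]; rewrite ltnW // (lv_lt h). Qed.

Lemma lv_ge n f i : pmor n f -> i < n -> i <= lv f i.
Proof.
move=> h; elim: i => [//|i IH] hi; apply: leq_ltn_trans (IH (ltnW hi)) _.
exact: lv_lt h (ltnSn i) hi.
Qed.

Lemma pl_ge n f i : pmor n f -> i <= n -> i <= pl f i.
Proof. case: i => [//|i] h hi; exact: lv_ge h hi. Qed.

Lemma pl_le_lv n f i j : pmor n f -> i <= j -> j < n -> pl f i <= lv f j.
Proof. by move=> h h1 h2; apply: leq_trans (lv_le h h1 h2); apply: (pl_lv h); lia. Qed.

Lemma plus_lev n f t : pmor n f -> wf t -> len t <= n -> lev (pl f (len t)) (plus f t).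
Proof.
move=> h; elim/word_ind': t => [u|t l IH IHl] //= /andP[hw hl] hn.
have /levP[w1 e1] := pmor_lev h hw hn.
apply/levP; rewrite /= e1 w1 /=; split=> //.
case: l IHl hl => [//|[s c]] IHl /andP[h1 h2] /=.
have /levP[-> ->] := IHl s c erefl h1 (leq_trans h2 (ltnW hn)).
exact: pl_le_lv h h2 hn.
Qed.

Lemma plus_len n f t : pmor n f -> wf t -> len t <= n -> len (plus f t) = pl f (len t).
Proof. by move=> h1 h2 h3; rewrite (lev_len (plus_lev h1 h2 h3)). Qed.
Lemma pmor_len n f t : pmor n f -> wf t -> len t < n -> len (f t) = lv f (len t).
Proof. by move=> h1 h2 h3; rewrite (lev_len (pmor_lev h1 h2 h3)). Qed.

Lemma wf_pref x y : pref x y -> wf y -> wf x.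
Proof. by move/eqP <-; exact: wf_res. Qed.

Lemma pmor_mono n f x y : pmor n f -> wf y -> len y < n -> pref x y -> pref (f x) (f y).
Proof.
move=> h; elim/word_ind': y => [u|t l IH _] hw hl hp.
  by rewrite (pref_eq hp) //; move/pref_len: hp => /=; lia.
case: (leqP (len (Ws t l)) (len x)) => hx.
  by rewrite (pref_eq hp) //; move/pref_len: hp; lia.
apply: (pref_trans (y := f t)).
  apply: IH; [by case/andP: hw|exact: ltnW|exact: pref_par hp hx].
exact: pref_Ws (pmor_pref h hw hl).
Qed.

Lemma plus_pref n f x y : pmor n f -> wf y -> len y < n -> pref x y -> pref (plus f x) (f y).
Proof.
move=> h hw hl hp; apply: pref_trans (pmor_mono h hw hl hp).
by apply: (pmor_pref h (wf_pref hp hw)); apply: leq_ltn_trans (pref_len hp) hl.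
Qed.

Lemma pl_inj n f i j : pmor n f -> i <= n -> j <= n -> pl f i = pl f j -> i = j.
Proof.
move=> h; wlog hij : i j / i <= j => [H h1 h2 e|h1 h2].
  by case: (leqP i j) => hh; [|symmetry]; apply: H => //; lia.
case: i j hij h1 h2 => [|i] [|j] //= hij h1 h2 [e]; congr S; apply/eqP.
rewrite eqn_leq (_ : i <= j) //=; case: leqP => // h3.
have := lv_lt h h3 h2; lia.
Qed.

(** The length of the image determines the length of the word, the levels being strictly increasing.
    The images of the two parents are then prefixes of equal length of one word. *)
Lemma plus_inj n f s s' : pmor n f -> wf s -> wf s' -> len s <= n -> len s' <= n ->
  plus f s = plus f s' -> s = s'.
Proof.
move=> h; elim/word_ind': s s' => [u|t l IH IHl] [u'|t' l'] //=.
move=> /andP[w1 w2] /andP[w3 w4] h1 h2 [e1 e2].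
have el : len t = len t'.
  have := pmor_len h w1 h1; rewrite e1 (pmor_len h w3 h2) => e.
  by have := @pl_inj _ f (len t).+1 (len t').+1 h h1 h2; rewrite /= e => /(_ erefl) [].
have e3 : plus f t = plus f t'.
  have p1 := pmor_pref h w1 h1; have p2 := pmor_pref h w3 h2; rewrite e1 in p1.
  have e : len (plus f t) = len (plus f t') by rewrite !(plus_len h) ?el // ltnW // -el.
  by apply: pref_eq => //; apply: pref_total p1 p2 _; rewrite e.
rewrite (IH t') // ?(ltnW h1) ?(ltnW h2) //; congr Ws.
case: l l' IHl w2 w4 e2 => [m|[s c]] [m'|[s' c']] //= IHl.
move=> /andP[w5 w6] /andP[w7 w8] [e5 ->].
rewrite (IHl s c erefl s') //.
  exact: leq_trans w6 (ltnW h1).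
exact: leq_trans w8 (ltnW h2).
Qed.

Lemma pmor_inj n f t t' : pmor n f -> wf t -> wf t' -> len t < n -> len t' < n ->
  f t = f t' -> t = t'.
Proof.
(* A dummy last letter turns values of [f] into values of [plus f]. *)
move=> h w1 w2 h1 h2 e; have := @plus_inj n f (Ws t (inl None)) (Ws t' (inl None)) h.
by rewrite /= w1 w2 e => /(_ erefl erefl h1 h2 erefl) [].
Qed.

Lemma lkp_plus n f t i : pmor n f -> wf t -> len t <= n -> i < len t ->
  lkp (plus f t) (lv f i) = omap (lmap (plus f)) (lkp t i).
Proof.
move=> h; elim/word_ind': t => [//|t l IH _] /= /andP[hw _] hn hi.
rewrite (pmor_len h hw hn).
case: (eqVneq i (len t)) => [->|ne]; first by rewrite eqxx.
have hi' : i < len t by lia.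
have hlt := lv_lt h hi' hn.
rewrite ifN ?neq_ltn ?hlt // -IH ?(ltnW hn) //.
apply: pref_lkp_eq (pmor_pref h hw hn) _.
rewrite (plus_len h hw (ltnW hn)); case E : (len t) hi' => [//|k] hk /=.
by rewrite ltnS; apply: (lv_le h) => //; lia.
Qed.

(** By [lkp_plus], moving each vertex [(s, M)] to [(plus f s, lv f M)] preserves names and types. *)
Lemma bad_push n f pi ts : pmor n f -> okp pi ->
  (forall r, r < pup pi -> wf (ts r) /\ len (ts r) <= n) ->
  bad pi ts -> bad pi (plus f \o ts).
Proof.
move=> h ok hts [s [M hr]]; have h0 := okp_pos ok.
have [w0 l0] := hts 0 h0.
have [n1 n2] := real_names h0 w0 hr.
have hM i : i < plow pi -> M i < n.
  by move=> hi; apply: leq_trans l0; exact: real_lt hr hi h0.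
have hs i : i < plow pi -> wf (s i) /\ len (s i) <= n.
  by move=> hi; have /andP[-> h1] := n1 i hi; split=> //; have := hM i hi; lia.
case: (hr) => h1 h2 h3 h4.
exists (plus f \o s), (lv f \o M); split=> /= [i hi|i j hij hj|r hr'|i r hi hr'].
- by have [? ?] := hs i hi; rewrite (root_plus h) // h1.
- have [? ?] := hs j hj; rewrite (lkp_plus h) //; first by rewrite h2.
  exact: n2.
- by have [? ?] := hts r hr'; rewrite (root_plus h) // h3.
- have [? ?] := hts r hr'; rewrite (lkp_plus h) //; first by rewrite h4.
  exact: real_lt hr hi hr'.
Qed.

(** A realisation using the new level [lv f n] has its last lower vertex there, named [plus f s']
    with [s'] of length at most [n]. Padded to length [n], [s'] joins the upper nodes and gives a
    realisation of [down pi] under the images of words of length [n]. It is brought back by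
    [aged n f], and [(s', n)] is then the missing vertex. *)
Lemma plus_aged n f : pmor n f -> aged n (plus f).
Proof.
case: n => [|n] h.
  by apply: (@eq_aged _ id) => // -[u|t l] /levP[_ /=].
have hf : aged n f by case: (h n).
have L t : lev n.+1 t -> lev (lv f n).+1 (Ws (f (par t)) (lmap (plus f) (lst t))).
  case: t => [u|t l] ht; first by case/levP: ht.
  by have [w e] := levP _ _ ht; have := plus_lev h w; rewrite e leqnn => /(_ erefl).
apply: (@eq_aged _ (fun t => Ws (f (par t)) (lmap (plus f) (lst t)))).
  by move=> t /lev_parlst e; rewrite [in RHS]e.
apply: (@ext_aged _ (lv f n) (fun t => f (par t)) (fun t => lmap (plus f) (lst t))) => //.
  move=> pi ts ok hts hb.
  apply: (bad_mono (ts := fun r => par (ts r))) => [r _|]; first exact: pref_par1.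
  by apply: hf => // r /hts /lev_par.
move=> pi ts s M ok hts hr ha eM.
have h0 := okp_pos ok.
pose a := (plow pi).-1.
have aP : a < plow pi by rewrite /a; lia.
have Ea : a.+1 = plow pi by rewrite /a; lia.
have wts r : r < pup pi -> wf (par (ts r)) /\ len (par (ts r)) = n.
  by move=> /hts /lev_par /levP.
have top r : r < pup pi -> exists s', [/\ lst (ts r) = inr (s', ptwo pi a (plow pi + r)),
    plus f s' = s a, wf s' & len s' <= n].
  move=> hr'; case: (hr) => _ _ _ /(_ a r aP hr') /=.
  have [w1 e1] := wts r hr'.
  rewrite eM (pmor_len h w1) e1 ?ltnSn // eqxx.
  have := lev_parlst (hts r hr'); case E: (lst (ts r)) => [m|[s' c]] //= ets [e2 e3].
  exists s'; rewrite e2 e3; split=> //.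
    by have := lev_wf (hts r hr'); rewrite ets /= => /andP[_ /andP[]].
  have := lev_wf (hts r hr'); rewrite ets /= => /andP[_ /andP[_]].
  by rewrite e1.
have [s' [l1 l2 l3 l4]] := top 0 h0.
(* Injectivity of [plus f] makes the upper nodes agree on the name itself, not only on its image. *)
have tops r : r < pup pi -> lst (ts r) = inr (s', ptwo pi a (plow pi + r)).
  move=> hr'; have [s'' [k1 k2 k3 k4]] := top r hr'; rewrite k1.
  by rewrite (@plus_inj n.+1 f s'' s') // ?k2 // ltnW.
(* Padding names nothing, so a vertex found in [pad n s'] is already named in [s']. *)
pose ts' r := if r is r'.+1 then par (ts r') else pad n s'.
have hts' r : r < pup (down pi) -> lev n (ts' r).
  by case: r => [|r] /= hr'; [apply: pad_lev|have := hts r hr'; exact: lev_par].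
have [s1 [M1 [r1 r2 r3 r4]]] : bad (down pi) ts'.
  apply: hf => //; first exact: okp_down.
  exists s, M; case: (hr) => k1 k2 k3 k4; split=> /=.
  - by move=> i hi; apply: k1; lia.
  - by move=> i j hij hj; apply: k2 => //; lia.
  - case=> [|r] hr' /=.
      rewrite addn0 -/a -(k1 a aP) -l2 (root_plus h l3 (leqW l4)).
      rewrite (pmor_root h (pad_wf _ l3)) ?pad_len //.
      by rewrite (pref_root (pad_pref n s')).
    by rewrite -/a addnS -addSn Ea -k3.
  - move=> i [|r] hi hr' /=.
      rewrite addn0; have := k2 i a hi aP; rewrite -l2.
      apply: pref_lkp; apply: (plus_pref h) (pad_pref n s').
        exact: pad_wf.
      by rewrite pad_len.
    rewrite -/a addnS -addSn Ea -k4 //; last by lia.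
    have [w1 e1] := wts r hr'; rewrite /= (pmor_len h w1) e1 ?ltnSn //.
    rewrite ifN // neq_ltn -eM.
    have wr0 : wf (Ws (f (par (ts 0))) (lmap (plus f) (lst (ts 0)))).
      by apply: lev_wf (L _ (hts 0 h0)).
    have [n1 n2] := real_names h0 wr0 hr.
    have := n2 i a hi aP; have /andP[_] := n1 a aP; rewrite -/a; lia.
exists (fun i => if i == a then s' else s1 i), (fun i => if i == a then n else M1 i).
have sz : forall i, i < plow pi -> i != a -> i < a by lia.
case: (hr) => k1 k2 k3 k4; rewrite /= -/a in r1 r2 r3 r4; split.
- move=> i hi; case: eqP => [->|/eqP ne]; last by apply: r1; apply: sz.
  by rewrite -(k1 a aP) -l2 (root_plus h l3 (leqW l4)).
- move=> i j hij hj; rewrite (_ : (i == a) = false); last by lia.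
  case: eqP => [ej|/eqP ne]; last by apply: r2 => //; apply: sz.
  rewrite ej in hij *; have := r4 i 0 hij isT; rewrite /= addn0; exact: pad_lkp.
- move=> r hr'; have := r3 r.+1; rewrite /= addnS -addSn Ea ltnS => /(_ hr') <-.
  by rewrite (pref_root (pref_par1 (ts r))).
- move=> i r hi hr'; case: eqP => [->|/eqP ne].
    rewrite (lev_parlst (hts r hr')) /= (wts r hr').2 eqxx tops //.
  have := r4 i r.+1 (sz _ hi ne); rewrite ltnS /= => /(_ hr').
  rewrite addnS -addSn Ea; apply: pref_lkp; exact: pref_par1.
Qed.

End Morphisms.

(** * Tails *)

Section Tails.
Variables (U C : finType) (u0 : U).
Notation word := (word U C).
Notation letter := (option (option C) + (word * C))%type.
Implicit Types (t w z a b : word) (l : letter) (pi : pattern U C).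
Local Hint Resolve pref_refl : core.

Variable okp : pattern U C -> Prop.
Hypothesis okp_pos : forall pi, okp pi -> 0 < pup pi.
Hypothesis okp_down : forall pi, okp pi -> 0 < plow pi -> okp (down pi).
Notation pmor := (pmor u0 okp).
Notation aged := (aged okp).
Notation lv := (lv u0).
Notation pl := (pl u0).
Notation zw := (zw C u0).

Lemma plus_comp (f g : word -> word) t : plus (fun t => f (g t)) t = plus f (plus g t).
Proof.
elim/word_ind': t => [//|t l _ IHl] /=; congr Ws.
by case: l IHl => [//|[s c]] IHl /=; rewrite (IHl s c).
Qed.

Definition mor f := forall n, pmor n f.
Definition based L (g : word -> word) := forall t, wf t -> len t < L -> g t = t.

Lemma zw_wf i : wf (zw i). Proof. exact: lev_wf (zw_lev C u0 i). Qed.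
Lemma zw_len i : len (zw i) = i. Proof. exact: lev_len (zw_lev C u0 i). Qed.
Hint Resolve zw_wf : core.

Lemma lv_comp n m f g i : pmor n g -> i < n -> lv g i < m -> pmor m f ->
  lv (fun t => f (g t)) i = lv f (lv g i).
Proof.
move=> hg hi hm hf; have /levP[h1 h2] : lev (lv g i) (g (zw i)).
  by have := pmor_lev hg (zw_wf i); rewrite zw_len; apply.
by rewrite {1}lvE (pmor_len hf) ?h2.
Qed.

Lemma pmor_comp n m f g : pmor n g -> (forall i, i < n -> lv g i < m) -> pmor m f ->
  pmor n (fun t => f (g t)).
Proof.
move=> hg hl hf i hi; have hli := hl i hi; split=> [t /levP[ht et]|].
  have hi' : len t < n by rewrite et.
  have := pmor_lev hg ht hi'; rewrite et => hgt.
  split.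
    rewrite (lv_comp hg hi hli hf).
    have := pmor_lev hf (lev_wf hgt); rewrite (lev_len hgt); exact.
  rewrite plus_comp; apply: (plus_pref hf); rewrite ?(lev_len hgt) ?(lev_wf hgt) //.
  exact: pmor_pref hg ht hi'.
apply: (@aged_comp _ _ _ i (lv g i) g f); last by case: (hf _ hli).
  by case: (hg i hi) => h _ t /h [].
by case: (hg i hi).
Qed.

Lemma mor_comp f g : mor f -> mor g -> mor (fun t => f (g t)).
Proof.
move=> hf hg n; case: n => [|n]; first by move=> i.
apply: (@pmor_comp n.+1 (lv g n).+1) => // i; rewrite ltnS => hi.
by rewrite ltnS; apply: (lv_le (hg n.+1)) => //.
Qed.

Lemma pmor_eq n f g : (forall t, wf t -> len t < n -> f t = g t) -> pmor n f -> pmor n g.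
Proof.
move=> h hf i hi; have [h1 h2] := hf i hi; split.
  move=> t ht; have [k1 k2] := h1 t ht; have [w e] := levP _ _ ht.
  rewrite lvE -!h ?zw_len ?e //; split=> //.
  rewrite -(@plus_ext _ _ i f g) ?e // => z wz lz; apply: h => //; lia.
by apply: eq_aged h2 => t /levP[w e]; apply: h; rewrite ?e.
Qed.

Lemma mor_id : mor id.
Proof.
move=> n i hi; split=> [t ht|//]; split; first by rewrite lvE zw_len.
have [w e] := levP _ _ ht.
by rewrite (@plus_idE _ _ (len t)).
Qed.

Lemma based_plus L g t : based L g -> wf t -> len t <= L -> plus g t = t.
Proof. by move=> h; apply: plus_idE. Qed.

Lemma based_le L L' g : L <= L' -> based L' g -> based L g.
Proof. by move=> h hg t w l; apply: hg => //; exact: leq_trans h. Qed.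

Lemma based_comp L f g : based L f -> based L g -> based L (fun t => f (g t)).
Proof. by move=> hf hg t w l; rewrite hg // hf. Qed.

(** A way of prolonging all words of length [L] at once; these are the objects that the pigeonhole
    principle colours. *)
Definition tail L N (p : word -> word) :=
  (forall t, lev L t -> lev N (p t) /\ pref t (p t)) /\ aged L p.

Lemma tail_le L N p : tail L N p -> L <= N.
Proof.
case=> h _; have [h1 h2] := h _ (zw_lev C u0 L).
by have := pref_len h2; rewrite (lev_len h1) zw_len.
Qed.

Lemma tail_id L : tail L L id.
Proof. by split. Qed.

Lemma tail_eq L N p q : (forall t, lev L t -> p t = q t) -> tail L N p -> tail L N q.
Proof.
move=> h [h1 h2]; split; last exact: eq_aged h2.
by move=> t ht; rewrite -h //; exact: h1.
Qed.

Lemma tail_comp L m N p q : tail L m p -> tail m N q -> tail L N (fun t => q (p t)).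
Proof.
move=> [p1 p2] [q1 q2]; split.
  move=> t ht; have [h1 h2] := p1 t ht; have [h3 h4] := q1 _ h1; split=> //.
  exact: pref_trans h2 h4.
by apply: (@aged_comp _ _ _ L m p q) p2 q2 => t /p1 [].
Qed.

(** A map based at [L] has [plus g t = t] for words of length [L], so [g (p t)] still extends
    [t]. *)
Lemma pmor_tail n L N g p : pmor n g -> N < n -> based L g -> tail L N p ->
  tail L (lv g N) (fun t => g (p t)).
Proof.
move=> hg hN hb hp; have [p1 p2] := hp; split.
  move=> t ht; have [h1 h2] := p1 t ht; have [w e] := levP _ _ ht.
  have hl : len (p t) < n by rewrite (lev_len h1).
  have := pmor_lev hg (lev_wf h1) hl; rewrite (lev_len h1) => ->; split=> //.
  have := plus_pref hg (lev_wf h1) hl h2; rewrite (based_plus hb) // e //.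
apply: (@aged_comp _ _ _ L N p g) p2 _; last by case: (hg N hN).
by move=> t /p1 [].
Qed.

Lemma mor_tail L N g p : mor g -> based L g -> tail L N p ->
  tail L (lv g N) (fun t => g (p t)).
Proof. by move=> hg; apply: (@pmor_tail N.+1). Qed.

(* Extending a family of nodes leaves the remaining nodes free: a pattern using a
   new vertex has all its upper nodes in the family. *)
Lemma patch L N (S : word -> Prop) phi : L <= N ->
  (forall z, lev L z -> S z -> lev N (phi z) /\ pref z (phi z)) ->
  (forall pi zs, okp pi -> (forall r, r < pup pi -> lev L (zs r) /\ S (zs r)) ->
     bad pi (fun r => phi (zs r)) -> bad pi zs) ->
  tail L N (fun z => if `[< S z >] then phi z else pad N z).
Proof.
move=> hLN h1 h2; have hp z : lev L z ->
    lev N (if `[< S z >] then phi z else pad N z) /\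
    pref z (if `[< S z >] then phi z else pad N z).
  move=> hz; case: asboolP => [/(h1 _ hz)//|_]; split; last exact: pad_pref.
  by apply: pad_lev; rewrite ?(lev_wf hz) ?(lev_len hz).
split=> // pi zs ok hzs [s [M hr]].
case: (boolP [forall i : 'I_(plow pi), M i < L]) => [/forallP hM|].
  exists s, M; apply: real_cut hr => [r /hzs /hp []//|i r hi hr].
  by rewrite (lev_len (hzs r hr)); exact: (hM (Ordinal hi)).
rewrite negb_forall => /existsP[[i hi]] /=; rewrite -leqNgt => hM.
have hS r : r < pup pi -> S (zs r).
  move=> hr'; case: (hr) => _ _ _ /(_ i r hi hr') /=.
  case: asboolP => // _ /pad_lkp /lkp_len; rewrite (lev_len (hzs r hr')); lia.
apply: h2 => // [r hr'|]; first by split; [exact: hzs|exact: hS].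
apply: eq_bad (_ : bad pi ((fun z => if `[< S z >] then phi z else pad N z) \o zs)).
  by move=> r hr' /=; rewrite asboolT //; exact: hS.
by exists s, M.
Qed.

Lemma tail1 L x z : tail L L.+1 x -> lev L z -> x z = Ws z (lst (x z)).
Proof.
case=> h _ hz; have [h1 h2] := h z hz.
rewrite {1}(lev_parlst h1); congr Ws; symmetry; apply: pref_eq.
  by apply: pref_par h2 _; rewrite (lev_len hz) (lev_len h1).
by rewrite (lev_len hz) (lev_len (lev_par h1)).
Qed.

Lemma tail1_lst L x z s c : tail L L.+1 x -> lev L z -> lst (x z) = inr (s, c) ->
  wf s && (len s <= L).
Proof.
move=> hx hz e; have [h1 _] := hx.1 z hz; have := lev_wf h1.
by rewrite (tail1 hx hz) e /= (lev_len hz) => /andP[].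
Qed.

Lemma wf_Ws L N t l : lev N t -> L <= N ->
  (forall s c, l = inr (s, c) -> wf s && (len s <= L)) -> lev N.+1 (Ws t l).
Proof.
move=> /levP[h1 h2] hLN hl; apply/levP; rewrite /= h1 h2; split=> //=.
case: l hl => // -[s c] /(_ s c erefl) /andP[-> /= h3]; exact: leq_trans h3 hLN.
Qed.

Lemma res_lev L m t : L <= m -> lev m t -> lev L (res L t).
Proof. by move=> h /levP[h1 h2]; apply/levP; rewrite wf_res // len_res h2 (minn_idPl h). Qed.

(* The words named by a one-letter move of level [L] have length at most [L], so repeating
   the move verbatim at a later level involves no newer vertex. *)
Lemma letter_tail L m x : L <= m -> tail L L.+1 x ->
  tail m m.+1 (fun t => Ws t (lst (x (res L t)))).
Proof.
move=> hLm hx.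
have hl t : lev m t -> lev m.+1 (Ws t (lst (x (res L t)))).
  by move=> ht; apply: (wf_Ws ht hLm) => s c; apply: tail1_lst hx (res_lev hLm ht).
split.
  by move=> t ht; split; [exact: hl|rewrite /pref /= ltnn res_id].
apply: (@ext_aged _ _ _ okp_pos m m id (fun t => lst (x (res L t)))) => //.
move=> pi ts s M ok hts hr ha hM.
have h0 := okp_pos ok.
have [n1 n2] := real_names h0 (lev_wf (hl _ (hts 0 h0))) hr.
have aP : (plow pi).-1 < plow pi by lia.
case: (hr) => r1 r2 r3 r4.
have hL : len (s (plow pi).-1) <= L.
  have := r4 _ 0 aP h0; rewrite hM /= (lev_len (hts 0 h0)) eqxx => -[e].
  by have /andP[] := tail1_lst hx (res_lev hLm (hts 0 h0)) e.
apply: (bad_mono (ts := fun r => res L (ts r))) => [r _|]; first exact: pref_res.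
apply: hx.2 => // [r hr'|]; first exact: res_lev (hts r hr').
exists s, (fun i => if i == (plow pi).-1 then L else M i); split=> //.
- move=> i j hij hj; rewrite ifN ?r2 //; lia.
- move=> r hr' /=; rewrite -r3 //= (tail1 hx) ?root_res //=; first by rewrite root_res.
  exact: res_lev (hts r hr').
- move=> i r hi hr' /=; rewrite (tail1 hx (res_lev hLm (hts r hr'))) /=.
  rewrite (lev_len (res_lev hLm (hts r hr'))).
  case: (eqVneq i (plow pi).-1) => [->|ne].
    by have := r4 _ r aP hr'; rewrite hM /= (lev_len (hts r hr')) !eqxx.
  have hi' : i < (plow pi).-1 by lia.
  have hMi := n2 _ _ hi' aP.
  rewrite ifN; last by lia.
  have := r4 _ r hi hr'; rewrite /= (lev_len (hts r hr')) ifN; last by lia.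
  by rewrite lkp_res ifT //; lia.
Qed.

(** The prolongation is inserted before the last letter, which moves to a higher level with its name
    unchanged. *)
Definition app (p : word -> word) w := Ws (p (par w)) (lst w).

Lemma lev_lst L w s c : lev L.+1 w -> lst w = inr (s, c) -> wf s && (len s <= L).
Proof.
by case: w => [//|t l] /levP[/= /andP[_ h] [e]] el; rewrite el e in h.
Qed.

Lemma app_lev L N p w : tail L N p -> lev L.+1 w -> lev N.+1 (app p w).
Proof.
move=> hp hw; apply: (wf_Ws _ (tail_le hp)) => [|s c]; last exact: lev_lst hw.
by case: (hp.1 _ (lev_par hw)).
Qed.

(** The name in the added letter has length at most [L]. A realisation through the new level [N]
    therefore has its other levels below [L], and its last vertex can be put back on level [L]: in
    [t] itself for a copied letter, in [x (par t)] for the letter of a tail. *)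
Lemma aged_step L N q (y : word -> letter) :
  L <= N -> aged L.+1 q ->
  (forall t, lev L.+1 t -> lev N (q t) /\ pref (par t) (q t)) ->
  (y = @lst U C) \/ (exists2 x, tail L L.+1 x & y = fun t => lst (x (par t))) ->
  (forall t, lev L.+1 t -> lev N.+1 (Ws (q t) (y t))) /\
  aged L.+1 (fun t => Ws (q t) (y t)).
Proof.
move=> hLN hq hl hy.
have ny t s c : lev L.+1 t -> y t = inr (s, c) -> wf s && (len s <= L).
  move=> ht; case: hy => [->|[x hx ->]]; first exact: lev_lst.
  exact: tail1_lst hx (lev_par ht).
have hyl t : lev L.+1 t -> lev N.+1 (Ws (q t) (y t)).
  by move=> ht; case: (hl t ht) => h _; apply: (wf_Ws h hLN) => s c; exact: ny.
split=> //; apply: (ext_aged okp_pos hq hyl) => pi ts s M ok hts hr ha hM.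
have h0 := okp_pos ok.
have [n1 n2] := real_names h0 (lev_wf (hyl _ (hts 0 h0))) hr.
have aP : (plow pi).-1 < plow pi by lia.
case: (hr) => r1 r2 r3 r4.
have lq r : r < pup pi -> len (q (ts r)) = N by move=> /hts /hl [/lev_len].
have top r : r < pup pi -> y (ts r) = inr (s (plow pi).-1, ptwo pi (plow pi).-1 (plow pi + r)).
  by move=> hr'; have := r4 _ r aP hr'; rewrite hM /= lq // eqxx => -[].
have hL : len (s (plow pi).-1) <= L by have /andP[] := ny _ _ _ (hts 0 h0) (top 0 h0).
have low i r : i < plow pi -> i != (plow pi).-1 -> r < pup pi ->
    M i < L /\ lkp (par (ts r)) (M i) = Some (inr (s i, ptwo pi i (plow pi + r))).
  move=> hi ne hr'; have hi' : i < (plow pi).-1 by lia.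
  have hMi := n2 _ _ hi' aP; split; first by lia.
  have := r4 _ r hi hr'; rewrite /= lq // ifN; last by lia.
  rewrite (pref_lkp_eq (hl _ (hts r hr')).2) //.
  by rewrite (lev_len (lev_par (hts r hr'))); lia.
have rt r : r < pup pi -> root (par (ts r)) = pone pi (plow pi + r).
  by move=> hr'; rewrite -r3 //= (pref_root (hl _ (hts r hr')).2).
case: hy => [ey|[x hx ey]].
  exists s, (fun i => if i == (plow pi).-1 then L else M i); split=> //.
  - by move=> i j hij hj; rewrite ifN ?r2 //; lia.
  - by move=> r hr'; rewrite -rt // (lev_parlst (hts r hr')).
  - move=> i r hi hr'; rewrite (lev_parlst (hts r hr')) /= (lev_len (lev_par (hts r hr'))).
    case: (eqVneq i (plow pi).-1) => [->|ne]; first by rewrite eqxx -top // ey.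
    by have [h1 h2] := low i r hi ne hr'; rewrite ifN // neq_ltn h1.
apply: (bad_mono (ts := fun r => par (ts r))) => [r _|]; first exact: pref_par1.
apply: hx.2 => // [r /hts /lev_par//|].
exists s, (fun i => if i == (plow pi).-1 then L else M i); split=> //.
- by move=> i j hij hj; rewrite ifN ?r2 //; lia.
- by move=> r hr' /=; rewrite (tail1 hx (lev_par (hts r hr'))) /= rt.
- move=> i r hi hr' /=; rewrite (tail1 hx (lev_par (hts r hr'))) /= (lev_len (lev_par (hts r hr'))).
  case: (eqVneq i (plow pi).-1) => [->|ne]; first by rewrite eqxx -top // ey.
  by have [h1 h2] := low i r hi ne hr'; rewrite ifN // neq_ltn h1.
Qed.

Lemma par_aged L N p : tail L N p -> aged L.+1 (fun t => p (par t)).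
Proof.
move=> hp pi ts ok hts hb.
apply: (bad_mono (ts := fun r => par (ts r))) => [r _|]; first exact: pref_par1.
by apply: hp.2 => // r /hts /lev_par.
Qed.

Lemma app_aged L N p : tail L N p -> aged L.+1 (app p).
Proof.
move=> hp; have := @aged_step L N (fun t => p (par t)) (@lst U C) (tail_le hp) (par_aged hp).
by case=> // [t /lev_par /hp.1 //|]; left.
Qed.

(** The words of the Hales-Jewett theorem: the alphabet consists of one-letter tails of level [L],
    each acting by the letter it adds to the restriction. *)
Definition moves L (xs : seq (word -> word)) t :=
  foldl (fun acc x => Ws acc (lst (x (res L t)))) t xs.

Lemma moves_tail L m xs : L <= m -> {in xs, forall x, tail L L.+1 x} ->
  tail m (m + size xs) (moves L xs).
Proof.
move=> hLm; elim/last_ind: xs => [|xs x IH] hxs; first by rewrite addn0; exact: tail_id.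
have hx : tail L L.+1 x by apply: hxs; rewrite mem_rcons mem_head.
have hp : tail m (m + size xs) (moves L xs).
  by apply: IH => y hy; apply: hxs; rewrite mem_rcons inE hy orbT.
rewrite size_rcons addnS.
have hm : L <= m + size xs by lia.
apply: tail_eq (tail_comp hp (letter_tail hm hx)) => t ht.
rewrite /moves foldl_rcons -/(moves L xs t).
have [h1 h2] := hp.1 t ht; have := res_res L (len t) (moves L xs t).
by rewrite (eqP h2) (lev_len ht) (minn_idPl hLm) => ->.
Qed.

(** The variable words: [None] is the variable, filled with the last letter of [t], while the
    constants look at its parent only. *)
Definition lineq (u : word -> word) (w : seq (option (word -> word))) t :=
  foldl (fun acc o => Ws acc (if o is Some x then lst (x (par t)) else lst t)) (u (par t)) w.

Lemma lineqP L m u (w : seq (option (word -> word))) : tail L m u -> (forall x, Some x \in w -> tail L L.+1 x) ->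
  (forall t, lev L.+1 t -> lev (m + size w) (lineq u w t) /\ pref (par t) (lineq u w t)) /\
  aged L.+1 (lineq u w).
Proof.
move=> hu; elim/last_ind: w => [|w o IH] hw.
  rewrite addn0; split=> [t /lev_par /hu.1 //|]; exact: par_aged hu.
have [|IH1 IH2] := IH; first by move=> x hx; apply: hw; rewrite mem_rcons inE hx orbT.
rewrite size_rcons addnS.
have hm : L <= m + size w by rewrite (leq_trans (tail_le hu)) ?leq_addr.
pose y := if o is Some x then fun t => lst (x (par t)) else @lst U C.
have E t : lineq u (rcons w o) t = Ws (lineq u w t) (y t).
  by rewrite /lineq foldl_rcons; case: (o) @y.
have [|h1 h2] := @aged_step L _ (lineq u w) y hm IH2 IH1.
  rewrite /y; case: o hw @y E => [x|] hw y _; [right|by left].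
  by exists x => //; apply: hw; rewrite mem_rcons mem_head.
split; last by apply: eq_aged h2 => t _; rewrite E.
move=> t ht; rewrite E; split; first exact: h1.
apply: pref_trans (IH1 t ht).2 _; exact: pref_par1 (Ws _ _).
Qed.

Definition subst_line (x : word -> word) (w : seq (option (word -> word))) := [seq odflt x o | o <- w].

(** The last letter of [x a] is the one that [x] adds to [a], so evaluating the line at [x a] is
    substituting [x] for the variable. *)
Lemma lineq_sub L m u (w : seq (option (word -> word))) x a : tail L m u -> tail L L.+1 x -> lev L a ->
  lineq u w (x a) = moves L (subst_line x w) (u a).
Proof.
move=> hu hx ha; have ex := tail1 hx ha.
have eu : res L (u a) = a.
  by have /eqP := (hu.1 a ha).2; rewrite (lev_len ha).
rewrite /lineq /moves eu ex /=; elim: w (u a) => [//|o w IH] acc /=.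
by rewrite -IH; congr foldl; congr Ws; case: o.
Qed.

Lemma lineq_pref u (w1 w2 : seq (option (word -> word))) t :
  pref (foldl (fun acc o => Ws acc (if o is Some x then lst (x (par t)) else lst t))
    (u (par t)) w1) (lineq u (w1 ++ w2) t).
Proof.
rewrite /lineq foldl_cat; elim/last_ind: w2 => [|w2 o IH] //.
rewrite foldl_rcons; apply: pref_trans IH _; exact: pref_par1 (Ws _ _).
Qed.

(* Up to its first variable position a line is a constant move. *)
Lemma line_start L m u (w : seq (option (word -> word))) : tail L m u -> None \in w ->
  (forall x, Some x \in w -> tail L L.+1 x) ->
  exists v N1, tail L N1 v /\ forall t, lev L.+1 t -> pref (app v t) (lineq u w t).
Proof.
move=> hu hN hw; pose w1 := take (index None w) w.
have ew : w = w1 ++ None :: drop (index None w).+1 w.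
  rewrite -{1}(cat_take_drop (index None w) w) (drop_nth None) ?index_mem //.
  by rewrite nth_index.
have hw1 : None \notin w1 by rewrite in_take // ltnn.
have e1 : w1 = map Some (pmap id w1).
  elim: (w1) hw1 => [//|[x|] s IH] //=; rewrite inE => // h; congr (_ :: _); exact: IH.
have hx : {in pmap id w1, forall x, tail L L.+1 x}.
  move=> x hx; apply: hw; rewrite ew mem_cat e1 map_f //.
exists (fun t => moves L (pmap id w1) (u t)), (m + size (pmap id w1)); split.
  exact: tail_comp hu (moves_tail (tail_le hu) hx).
move=> t ht; rewrite ew -cat_rcons; apply: pref_trans (lineq_pref u _ _ t).
rewrite foldl_rcons /app; set A := moves _ _ _; set B := foldl _ _ _.
suff -> : A = B by [].
have eu : res L (u (par t)) = par t.
  by have /eqP := (hu.1 _ (lev_par ht)).2; rewrite (lev_len (lev_par ht)).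
rewrite /A /B /moves eu {2}e1; elim: (pmap id w1) (u (par t)) => //= x s IH acc.
Qed.

Lemma fin_tails L m : exists F : seq (word -> word),
  (forall i, i < size F -> tail L m (nth id F i)) /\
  forall p, tail L m p -> exists i, i < size F /\ forall t, lev L t -> nth id F i t = p t.
Proof.
have [F hF] := fin_maps (levs U C L) (levs U C m).
pose I := [seq i <- iota 0 (size F) | `[< tail L m (nth id F i) >]].
have hI i : i < size I -> nth id [seq nth id F j | j <- I] i = nth id F (nth 0 I i).
  by move=> hi; rewrite (nth_map 0).
exists [seq nth id F j | j <- I]; rewrite size_map; split=> [i hi|p hp].
  by rewrite hI //; move: (mem_nth 0 hi); rewrite mem_filter => /andP[/asboolP].
have [|i [h1 h2]] := hF p.
  by move=> t; rewrite !mem_levs => /hp.1 [].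
have h t : lev L t -> nth id F i t = p t by move=> ht; apply: h2; rewrite mem_levs.
have iI : i \in I.
  rewrite mem_filter mem_iota add0n h1 leq0n !andbT; apply/asboolP.
  by apply: tail_eq hp => t /h.
exists (index i I); rewrite index_mem iI hI ?index_mem // nth_index //.
Qed.

End Tails.

(** * The pigeonhole principle for tails *)

Section Pigeonhole.
Variables (U C : finType) (u0 : U).
Notation word := (word U C).
Implicit Types (t w z a : word) (pi : pattern U C) (D : (word -> word) -> Prop).
Local Hint Resolve pref_refl : core.

Variable okp : pattern U C -> Prop.
Hypothesis okp_pos : forall pi, okp pi -> 0 < pup pi.
Hypothesis okp_down : forall pi, okp pi -> 0 < plow pi -> okp (down pi).
Notation pmor := (pmor u0 okp).
Notation mor := (mor u0 okp).
Notation tail := (tail okp).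
Notation aged := (aged okp).
Notation lv := (lv u0).
Notation pl := (pl u0).
Notation zw := (zw C u0).

Lemma pmor_step n f N : pmor n f ->
  (forall t, lev n t -> lev N (f t) /\ pref (plus f t) (f t)) -> aged n f -> pmor n.+1 f.
Proof.
move=> h h1 h2 i; rewrite ltnS leq_eqVlt => /orP[/eqP->|]; last exact: h.
split=> // t ht; have [h3 h4] := h1 t ht; split=> //.
by rewrite lvE (lev_len (h1 _ (zw_lev C u0 n)).1).
Qed.

Lemma plus_mono n f x y : pmor n f -> wf y -> len y <= n -> pref x y -> pref (plus f x) (plus f y).
Proof.
move=> h hw hl hp; case: (leqP (len y) (len x)) => hx.
  by rewrite (pref_eq hp) //; move: (pref_len hp); lia.
case: y hw hl hp hx => [//|t l] hw hl hp hx.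
apply: (pref_trans (y := f t)).
  apply: (plus_pref h) (pref_par hp hx) => //; by case/andP: hw.
exact: (@pref_par1 _ _ (Ws _ _)).
Qed.

Lemma plus_tail n L f p : pmor n f -> based L f -> tail L n p ->
  tail L (pl f n) (fun t => plus f (p t)).
Proof.
move=> h hb hp; have [p1 p2] := hp; split.
  move=> t ht; have [h1 h2] := p1 t ht; have [w1 e1] := levP _ _ h1; have [w e] := levP _ _ ht.
  have := plus_lev h w1; rewrite e1 => -> //; split=> //.
  have := plus_mono h w1 _ h2; rewrite (based_plus hb) ?e // e1; exact.
apply: (@aged_comp _ _ _ L n p (plus f)) p2 _; first by move=> t /p1 [].
exact: (plus_aged okp_pos okp_down h).
Qed.

(* [build] turns maps [Psi i] of the words [plus f t] with [len t = i] into one map [f]. *)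
Fixpoint build_plus (Psi : nat -> word -> word) w := match w with
  | W0 u => W0 C u
  | Ws t l => Ws (Psi (len t) (build_plus Psi t)) (lmap (build_plus Psi) l)
  end.
Definition build Psi w := Psi (len w) (build_plus Psi w).

Lemma plus_build Psi w : plus (build Psi) w = build_plus Psi w.
Proof.
elim/word_ind': w => [//|t l _ IHl] /=; congr Ws.
by case: l IHl => [//|[s c]] IHl /=; rewrite (IHl s c).
Qed.

Definition local_prop L D := forall p q, (forall t, lev L t -> p t = q t) -> D p -> D q.
(** The notion of positivity here: no based morphism avoids [D]. It passes to one part of a finite
    cover by [large_part]. *)
Definition large L D := forall g, mor g -> based L g ->
  exists N p, tail L N p /\ D (fun t => g (p t)).

Lemma large_mono L D D' : (forall p, D p -> D' p) -> large L D -> large L D'.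
Proof. by move=> h hD g h1 h2; have [N [p [h3 h4]]] := hD g h1 h2; exists N, p; split; [|exact: h]. Qed.

(* Otherwise every level [m] has a tail all of whose composites avoid [D], and these
   tails can be glued into a morphism avoiding [D]. *)
Lemma large_level L D : local_prop L D -> large L D ->
  exists m, L <= m /\ forall N psi, tail m N psi ->
    exists u, tail L m u /\ D (fun t => psi (u t)).
Proof.
move=> hD hl; apply: contrapT => H.
have {}H m : exists q : nat * (word -> word), L <= m ->
    tail m q.1 q.2 /\ forall u, tail L m u -> ~ D (fun t => q.2 (u t)).
  case: (leqP L m) => hm; last by exists (0, id).
  apply: contrapT => H1; apply: H; exists m; split=> // N psi hpsi.
  apply: contrapT => H2; apply: H1; exists (N, psi) => _; split=> // u hu hDu.
  by apply: H2; exists u.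
have [q hq] := choice H.
pose Psi i x := if i < L then x else (q (len x)).2 x.
pose g := build Psi.
have plusg t : plus g t = build_plus Psi t by exact: plus_build.
have gE t : g t = Psi (len t) (plus g t) by rewrite plusg.
have hg n : pmor n g.
  elim: n => [|n IH]; first by move=> i.
  have hm := pl_ge IH (leqnn n).
  have [N hN] : exists N, tail (pl g n) N (Psi n).
    rewrite /Psi; case: ltnP => hn; first by exists (pl g n); exact: tail_id.
    have [h1 _] := hq (pl g n) (leq_trans hn hm); exists (q (pl g n)).1.
    by apply: tail_eq h1 => t /lev_len ->.
  apply: (pmor_step (N := N)) => // [t ht|].
    have [w e] := levP _ _ ht; rewrite gE e; apply: hN.1.
    by have := plus_lev IH w; rewrite e leqnn => ->.
  apply: (@eq_aged _ _ _ n (fun t => Psi n (plus g t))).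
    by move=> t /lev_len <-; rewrite -gE.
  apply: (@aged_comp _ _ _ n (pl g n) (plus g) (Psi n)); last exact: hN.2.
    by move=> t /levP[w e]; have := plus_lev IH w; rewrite e leqnn => ->.
  exact: (plus_aged okp_pos okp_down IH).
have bg : based L g.
  move=> t; elim/word_ind': t => [u|t l IH IHl] hw ht; rewrite gE /Psi ht //=.
  case/andP: hw => hw1 hw2; rewrite IH //; last exact: ltnW.
  case: l IHl hw2 {ht} (ltnW ht) => [//|[s c]] IHl /andP[h1 h2] h3 /=.
  have hs : len s < L by apply: leq_ltn_trans h2 h3.
  by have := IHl s c erefl h1 hs; rewrite gE /Psi hs => ->.
have [N [p [hp Dp]]] := hl g hg bg.
have hN := tail_le u0 hp.
have hu := plus_tail (hg N) bg hp.
have [|_] := hq (pl g N); first by apply: leq_trans hN _; exact: pl_ge (hg N) _.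
move/(_ _ hu); apply; apply: hD Dp => t ht.
have [h1 _] := hp.1 t ht; have [w e] := levP _ _ h1.
rewrite gE /Psi e ltnNge hN /= (plus_len (hg N)) ?e //.
Qed.

(** Otherwise the finitely many classes could be avoided one after another by composing morphisms,
    against the covering. *)
Lemma large_part L (I : finType) (Ds : I -> (word -> word) -> Prop) :
  (forall N p, tail L N p -> exists i, Ds i p) ->
  exists i g, [/\ mor g, based L g & large L (fun p => Ds i (fun t => g (p t)))].
Proof.
move=> cover; apply: contrapT => H.
suff K (s : seq I) : exists g, [/\ mor g, based L g &
    forall i N p, i \in s -> tail L N p -> ~ Ds i (fun t => g (p t))].
  have [g [h1 h2 h3]] := K (enum I).
  have [i hi] := cover _ _ (mor_tail h1 h2 (tail_id okp L)).
  by apply: (h3 i _ id) hi; [rewrite mem_enum|exact: tail_id].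
elim: s => [|i s [g [h1 h2 h3]]].
  by exists id; split=> //; exact: mor_id.
have : ~ large L (fun p => Ds i (fun t => g (p t))) by move=> hl; apply: H; exists i, g.
move=> hn; apply: contrapT => H2; apply: hn => g' m' b'.
apply: contrapT => H3; apply: H2; exists (fun t => g (g' t)); split.
- exact: mor_comp.
- exact: based_comp.
- move=> j N p; rewrite inE => /orP[/eqP->|hj] hp hd.
    by apply: H3; exists N, p.
  exact: h3 hj (mor_tail m' b' hp) hd.
Qed.

Definition line_map L v N Q :=
  (forall t, lev L.+1 t -> lev N (Q t) /\ pref (app v t) (Q t)) /\ aged L.+1 Q.
Definition derived_prop L (g Q : word -> word) D := fun psi : word -> word =>
  forall x, tail L L.+1 x -> D (fun t => g (psi (Q (x t)))).
(* One level of a morphism all of whose composites with tails lie in [D]: words of length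
   [L.+1] are moved by [Q], and [b] asks that the constant part [v] of [Q] lie in [D] too. *)
Definition step_to (b : bool) L D := exists g v N1 Q N2,
  [/\ mor g, based L g, tail L N1 v, line_map L v N2 Q &
      large N2 (derived_prop L g Q D) /\ (b -> D (fun t => g (v t)))].

(** For each tail [psi] from level [m + H], a word of one-letter tails followed by [psi] is a tail
    from level [m], so some [u] in front of it gives a member of [D]; this [u] is the colour of the
    word. A monochromatic line is one pair of [u] and a line that works for every one-letter tail
    [x]. There are finitely many pairs, so [large_part] fixes one. *)
Lemma stp_line L D : local_prop L D -> large L D -> step_to false L D.
Proof.
move=> hD hl.
have [m [hm hpsi]] := large_level hD hl.
have [As [As1 As2]] := fin_tails okp L L.+1.
have [Us [Us1 Us2]] := fin_tails okp L m.
(* The successor makes the set of colours nonempty, so words of the wrong shape have a default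
   colour. *)
have [H hH] := hales_jewett (size As) 'I_(size Us).+1.
pose wd (tau : H.-tuple (option 'I_(size As))) : seq (option (word -> word)) :=
  [seq omap (fun j : 'I_(size As) => nth id As j) o | o <- tau].
pose Ds (i : 'I_(size Us) * H.-tuple (option 'I_(size As))) psi :=
  None \in i.2 /\ forall x, tail L L.+1 x ->
    D (fun t => psi (lineq (nth id Us i.1) (wd i.2) (x t))).
have wdT tau x : Some x \in wd tau -> tail L L.+1 x.
  by case/mapP => -[j|] //= _ [->]; apply: As1.
have [i [g [mg bg]]] : exists i g, [/\ mor g, based (m + H) g &
    large (m + H) (fun p => Ds i (fun t => g (p t)))].
  apply: large_part => N psi hN.
  have psiT v : size v = H -> all (fun j => j < size As) v ->
      tail m (m + H) (moves L [seq nth id As j | j <- v]).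
    move=> <- /allP hv; rewrite -(size_map (nth id As) v).
    by apply: moves_tail => // x /mapP[j /hv hj ->]; exact: As1.
  have hc v : exists c : 'I_(size Us).+1, size v = H -> all (fun j => j < size As) v ->
      c < size Us /\ D (fun t => psi (moves L [seq nth id As j | j <- v] (nth id Us c t))).
    case: (eqVneq (size v) H) => [hv|/eqP hv]; last by exists ord0.
    case: (boolP (all (fun j => j < size As) v)) => hv'; last by exists ord0.
    have [u [hu hDu]] := hpsi _ _ (tail_comp (psiT v hv hv') hN).
    have [j [hj hju]] := Us2 u hu.
    exists (inord j) => _ _; rewrite inordK ?(leqW hj) //; split=> //.
    by apply: hD hDu => t ht; rewrite hju.
  have [c hc'] := choice hc.
  have [w [sw okw hw]] := hH c.
  (* Adding a blank is a one-letter tail, so the alphabet is not empty and the colour of the line is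
     the index of an actual [u]. *)
  have [x0 [hx0 _]] : exists i, i < size As /\ forall t, lev L t -> nth id As i t = Ws t (inl None).
    apply: As2; apply: tail_eq (@letter_tail _ _ _ okp_pos L L (fun t => Ws t (inl None)) (leqnn L) _).
      by [].
    split; last first.
      apply: (@ext_aged _ _ _ okp_pos L L id (fun=> inl None)) => // [t ht|pi ts s M ok hts hr ha hM].
        by apply: wf_Ws ht (leqnn L) _.
      case: hr => _ _ _ /(_ (plow pi).-1 0); rewrite hM /= (lev_len (hts 0 (okp_pos ok))) eqxx.
      by move=> /(_ ltac:(lia) (okp_pos ok)).
    move=> t ht; split; first by apply: wf_Ws ht (leqnn L) _.
    exact: (@pref_par1 _ _ (Ws _ _)).
  have fl x : x < size As -> size (fillw w x) = H /\ all (fun j => j < size As) (fillw w x).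
    by move=> hx; rewrite size_map sw; split=> //; exact: all_fillw.
  have [h1 _] := hc' _ (fl x0 hx0).1 (fl x0 hx0).2.
  pose tau0 := [seq obind (@insub nat (fun j => j < size As) 'I_(size As)) o | o <- w].
  have st : size tau0 == H by rewrite size_map sw.
  pose tau := Tuple st.
  have wE x : [seq nth id As j | j <- fillw w x] = subst_line (nth id As x) (wd tau).
    rewrite /fillw /subst_line /wd /= /tau0 -!map_comp; apply/eq_in_map => -[a|] //= ha.
    have : a < size As by case/andP: okw => _ /allP /(_ _ ha).
    by move=> ha'; rewrite insubT.
  exists (Ordinal h1, tau); split=> /=.
    case/andP: okw => hN' _; apply/mapP; exists None => //.
  move=> x hx; have [j [hj hjx]] := As2 x hx.
  have [h3 h4] := hc' _ (fl j hj).1 (fl j hj).2.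
  have ec : c (fillw w j) = c (fillw w x0) by apply: hw.
  rewrite ec in h4; apply: hD h4 => t ht /=.
  rewrite wE -hjx // (@lineq_sub _ _ okp L m) //; [exact: Us1|exact: As1].
case: i => i tau hlg.
have hi : tail L m (nth id Us i) by apply: Us1.
have hNone : None \in wd tau.
  have [N [p [_ [/= h _]]]] := hlg id (mor_id _ _) (fun t _ _ => erefl).
  by apply/mapP; exists None.
have [v [N1 [hv hpv]]] := line_start u0 okp_pos hi hNone (fun x => @wdT tau x).
have [h1 h2] := lineqP u0 okp_pos hi (fun x => @wdT tau x).
have sz : size (wd tau) = H by rewrite size_map size_tuple.
rewrite sz in h1.
exists g, v, N1, (lineq (nth id Us i) (wd tau)), (m + H); split=> //.
- by apply: based_le bg; lia.
- by split=> // t ht; split; [case: (h1 t ht)|exact: hpv].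
- split=> //; apply: large_mono hlg => p [_ h] x hx; exact: h.
Qed.

Lemma par_tail L n p : L <= n -> tail L n.+1 p -> tail L n (fun t => par (p t)).
Proof.
move=> hLn [h1 h2]; split=> [t ht|pi ts ok hts hb].
  have [h3 h4] := h1 t ht; split; first exact: lev_par.
  by apply: pref_par h4 _; rewrite (lev_len ht) (lev_len h3).
apply: h2 => //; apply: bad_mono hb => r _; exact: pref_par1.
Qed.

(** The word [f (par (p a))] determines [a], because [f] is injective and [par (p a)] extends [a];
    so the last letter of [plus f (p a)] is the effect of a move, continued by a blank elsewhere. It
    creates nothing: a realisation is pulled back through [plus f] and [p], then pushed forward
    again by [f]. *)
Lemma lift_tail L n f p : pmor n.+1 f -> L <= n -> tail L n.+1 p ->
  exists x, tail (lv f n) (lv f n).+1 x /\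
    forall a, lev L a -> x (f (par (p a))) = plus f (p a).
Proof.
move=> hf hLn hp; have hpp := par_tail hLn hp.
pose S z := exists a, lev L a /\ f (par (p a)) = z.
have hsel z : exists a, S z -> lev L a /\ f (par (p a)) = z.
  by case: (EM (S z)) => [[a ha]|hn]; [exists a|exists z].
have [sel hs] := choice hsel.
exists (fun z => if `[< S z >] then plus f (p (sel z)) else pad (lv f n).+1 z); split.
  apply: (@patch _ _ okp _ _ S (fun z => plus f (p (sel z)))) => // [z hz Sz|pi zs ok hzs hb].
    have [h1 h2] := hs z Sz.
    have [h3 h4] := hp.1 _ h1; have [w e] := levP _ _ h3.
    have := plus_lev hf w; rewrite e => /(_ (leqnn _)) h5; split=> //.
    by rewrite -{1}h2; case: (p (sel z)) h3 => [u /levP[]//|t l] _; exact: (@pref_par1 _ _ (Ws _ _)).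
  have hz r : r < pup pi -> lev L (sel (zs r)) /\ f (par (p (sel (zs r)))) = zs r.
    by move=> /hzs [_ /hs].
  have b1 : bad pi (fun r => p (sel (zs r))).
    apply: (plus_aged okp_pos okp_down hf) hb => // r /hz [/hp.1 [] //].
  have b2 : bad pi (fun r => sel (zs r)) by apply: hp.2 b1 => // r /hz [].
  have b3 : bad pi (fun r => par (p (sel (zs r)))).
    by apply: bad_mono b2 => r /hz [/hpp.1 []].
  have words_upto r : r < pup pi -> wf (par (p (sel (zs r)))) /\ len (par (p (sel (zs r)))) = n.
    by move=> /hz [/hpp.1 [/levP]].
  apply: bad_mono (bad_push okp_pos hf ok _ b3) => [r hr|r hr] /=.
    have [w e] := words_upto r hr; rewrite -[X in pref _ X](hz r hr).2.
    by apply: (pmor_pref hf w); rewrite e.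
  by have [w ->] := words_upto r hr.
move=> a ha; rewrite asboolT; last by exists a.
have [h1 h2] := hs _ (ex_intro _ a (conj ha erefl) : S (f (par (p a)))).
congr (plus f (p _)).
have [k1 k2] := hpp.1 _ h1; have [k3 k4] := hpp.1 _ ha.
have [w1 e1] := levP _ _ k1; have [w2 e2] := levP _ _ k3.
have e := pmor_inj hf w1 w2 _ _ h2; rewrite e in k2; last by rewrite e2.
  apply: pref_eq; last by rewrite (lev_len h1) (lev_len ha).
  by apply: pref_total k2 k4 _; rewrite (lev_len h1) (lev_len ha).
by rewrite e1.
Qed.

(** In a stage [(G, f)], the part [f] is built up to level [n] and [G] is applied after it. What
    remains large is a property of the continuation [psi]: that it puts all tails up to level [n]
    into [D] simultaneously. *)
Definition iter_inv L D n (s : (word -> word) * (word -> word)) :=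
  [/\ mor s.1, based L s.1, pmor n.+1 s.2, based L s.2 &
    large (lv s.2 n) (fun psi => forall p, tail L n p -> D (fun t => s.1 (psi (s.2 (p t)))))].

Definition iter_next (b : bool) L D n (s s' : (word -> word) * (word -> word)) :=
  (forall t, wf t -> len t < n -> s'.1 (s'.2 t) = s.1 (s.2 t)) /\
  (b -> forall p, tail L n p -> D (fun t => s'.1 (s'.2 (p t)))).

Lemma iter_step b L D n s :
  (forall L D, local_prop L D -> large L D -> step_to b L D) -> local_prop L D -> L <= n ->
  iter_inv L D n s -> exists s', iter_inv L D n.+1 s' /\ iter_next b L D n s s'.
Proof.
case: s => G f hstp hD hLn [/= mG bG hf bf hl].
set N := lv f n in hl.
set E := fun psi : word -> word => _ in hl.
have hE : local_prop N E.
  move=> p q epq hEp p' hp'; apply: hD (hEp p' hp') => t ht.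
  have [h1 _] := hp'.1 t ht; have [w e] := levP _ _ h1.
  have hlt : len (p' t) < n.+1 by rewrite e.
  have := pmor_lev hf w hlt; rewrite e => h2; by rewrite epq.
have [g [v [N1 [Q [N2 [mg bg hv [hQ1 hQ2] [hl2 hb]]]]]]] := hstp N E hE hl.
(* Level [n] is closed off with the constant part [v], and the line [Q] produces the new level
   [n.+1]; the two fit since [Q t] extends [app v t]. *)
pose f' t := if len t < n then f t else if len t == n then v (f t) else Q (plus f t).
have f'lt t : len t < n -> f' t = f t by rewrite /f' => ->.
have f'n t : len t = n -> f' t = v (f t) by rewrite /f' => ->; rewrite ltnn eqxx.
have f'S t : len t = n.+1 -> f' t = Q (plus f t).
  by rewrite /f' => ->; rewrite ltnNge leqnSn /= ifN // neq_ltn ltnSn orbT.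
have plf' t : wf t -> len t <= n -> plus f' t = plus f t.
  by apply: plus_ext => z _; exact: f'lt.
have levf t : lev n t -> lev N (f t) /\ pref (plus f t) (f t) by case: (hf n (ltnSn n)) => h _ /h.
have hf'n : pmor n f'.
  by apply: pmor_eq (pmor_le (leqnSn n) hf) => t _ /f'lt.
have hf'S : pmor n.+1 f'.
  apply: (pmor_step (N := N1)) => // [t ht|].
    have [w e] := levP _ _ ht; have [h1 h2] := levf t ht; have [h3 h4] := hv.1 _ h1.
    by rewrite f'n // plf' ?e //; split=> //; exact: pref_trans h2 h4.
  apply: (@eq_aged _ _ _ n (fun t => v (f t))); first by move=> t /lev_len /f'n ->.
  apply: (@aged_comp _ _ _ n N f v); last exact: hv.2.
    by move=> t /levf [].
  by case: (hf n (ltnSn n)).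
have hpl t : lev n.+1 t -> lev N.+1 (plus f t).
  by move=> /levP[w e]; have := plus_lev hf w; rewrite e => -> //.
have hf'SS : pmor n.+2 f'.
  apply: (pmor_step (N := N2)) => // [t ht|].
    have [w e] := levP _ _ ht; rewrite f'S //; have [h1 h2] := hQ1 _ (hpl t ht); split=> //.
    suff -> : plus f' t = app v (plus f t) by [].
    case: t w e {ht h1 h2} => [//|t l] /= /andP[w1 w2] [e]; rewrite /app /= f'n //; congr Ws.
    by case: l w2 => [//|[s c]] /andP[w3 w4] /=; rewrite plf' // -e.
  apply: (@eq_aged _ _ _ n.+1 (fun t => Q (plus f t))); first by move=> t /lev_len /f'S ->.
  apply: (@aged_comp _ _ _ n.+1 N.+1 (plus f) Q) => //; exact: (plus_aged okp_pos okp_down hf).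
have lvf' : lv f' n.+1 = N2.
  rewrite lvE f'S ?zw_len //; exact: lev_len (hQ1 _ (hpl _ (zw_lev C u0 _))).1.
exists (fun t => G (g t), f'); split.
  split=> //=; first exact: mor_comp.
  - apply: based_comp => //; apply: based_le bg; apply: leq_trans hLn _.
    exact: lv_ge hf _.
  - by move=> t w ht; rewrite f'lt ?bf //; exact: leq_trans ht hLn.
  rewrite lvf'; apply: large_mono hl2 => psi hpsi p hp.
  have [x [hx hxp]] := lift_tail hf hLn hp.
  have hpp := par_tail hLn hp.
  apply: hD (hpsi x hx _ hpp) => t ht /=; rewrite hxp // f'S //.
  exact: lev_len (hp.1 t ht).1.
split=> /= [t w ht|hb' p hp].
  rewrite f'lt // bg //; first exact: lev_wf (pmor_lev hf w (ltnW ht)).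
  by rewrite (pmor_len hf w (ltnW ht)); apply: (lv_lt hf).
apply: hD (hb hb' p hp) => t ht /=; rewrite f'n //; exact: lev_len (hp.1 t ht).1.
Qed.

Lemma dep_choice (T : Type) (I : nat -> T -> Prop) (R : nat -> T -> T -> Prop) x0 :
  I 0 x0 -> (forall n x, I n x -> exists y, I n.+1 y /\ R n x y) ->
  exists s : nat -> T, s 0 = x0 /\ forall n, I n (s n) /\ R n (s n) (s n.+1).
Proof.
move=> h0 hS; have h q : exists y, I q.1 q.2 -> I q.1.+1 y /\ R q.1 q.2 y.
  by case: q => n x; case: (EM (I n x)) => [/hS [y hy]|hn]; [exists y|exists x].
have [F hF] := choice h.
pose s := fix s n := if n is n'.+1 then F (n', s n') else x0.
have hs n : I n (s n) by elim: n => [//|n IH] /=; case: (hF (n, s n) IH).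
exists s; split=> // n; split=> //; exact: (hF (n, s n) (hs n)).2.
Qed.

(** From stage [k] on the values on words of length below [L + k] are final, so the stages converge
    to a morphism [h]. *)
Lemma iter_stp b L D : (forall L D, local_prop L D -> large L D -> step_to b L D) ->
  local_prop L D -> large L D -> exists h st,
  [/\ mor h, based L h, forall k, iter_inv L D (L + k) (st k),
      forall k t, wf t -> len t < L + k -> h t = (st k).1 ((st k).2 t) &
      b -> forall k p, tail L (L + k) p -> D (fun t => h (p t))].
Proof.
move=> hstp hD hl.
have [|n s|st [_ hst]] := @dep_choice _ (fun k => iter_inv L D (L + k))
    (fun k => iter_next b L D (L + k)) (id, id).
- rewrite addn0; split=> //=; [exact: mor_id|exact: mor_id|].
  have -> : lv (id : word -> word) L = L by exact: zw_len.
  apply: large_mono hl => psi hpsi p hp; apply: hD hpsi => t ht /=.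
  by have [h1 h2] := hp.1 t ht; rewrite -(pref_eq h2) // (lev_len ht) (lev_len h1).
- by rewrite addnS; apply: iter_step => //; lia.
pose h t := (st (len t - L).+1).1 ((st (len t - L).+1).2 t).
have hE k t : wf t -> len t < L + k -> h t = (st k).1 ((st k).2 t).
  move=> w; case: (ltnP (len t) L) => ht.
    move=> _; have bs j : (st j).1 ((st j).2 t) = t.
      by case: (hst j) => -[_ b1 _ b2 _] _; rewrite b2 // b1.
    by rewrite /h !bs.
  elim: k => [|k IH]; first by lia.
  rewrite addnS ltnS leq_eqVlt => /orP[/eqP e|hk].
    by rewrite /h e addKn.
  by rewrite IH //; case: (hst k) => _ [-> //].
exists h, st; split=> //; last 1 first.
- move=> hb k p hp; case: (hst k) => _ [_ /(_ hb p hp)].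
  apply: hD => t ht; have [h1 h2] := hp.1 t ht; have [w e] := levP _ _ h1.
  by rewrite (hE k.+1) // e addnS.
- move=> n; apply: (@pmor_le _ _ _ _ (L + n)); first by lia.
  case: (hst n) => -[m1 b1 m2 b2 _] _.
  apply: (@pmor_eq _ _ _ _ _ (fun t => (st n).1 ((st n).2 t))) => [t w ht|].
    by rewrite (hE n).
  apply: (@pmor_comp _ _ _ _ _ (lv (st n).2 (L + n)).+1); last exact: m1.
    exact: pmor_le m2.
  by move=> i hi; rewrite ltnS ltnW // (lv_lt m2).
- by move=> t w ht; rewrite (hE 0) ?addn0 //; case: (hst 0) => -[_ b1 _ b2 _] _; rewrite b2 // b1.
- by move=> k; case: (hst k).
Qed.

(* Nothing in [stp_line] puts the constant part [v] of the line into [D].  If this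
   could never be achieved, the iterated lines would give a morphism avoiding [D]. *)
Lemma stp_good L D : local_prop L D -> large L D -> step_to true L D.
Proof.
move=> hD hl; have [h [st [mh bh hst hE _]]] := iter_stp stp_line hD hl.
have [N [p [hp Dp]]] := hl h mh bh.
have hN := tail_le u0 hp.
pose k := N - L; have eN : N = L + k by lia.
have hE' t : wf t -> len t = N -> h t = (st k.+1).1 ((st k.+1).2 t).
  by move=> w e; apply: hE => //; lia.
have := hst k.+1; rewrite addnS -eN.
case: (st k.+1) hE' => G f /= hE' [/= mG bG hf bf hlN].
(* The tail [p] found for the limit of the first iteration becomes the constant part, and the
   variable letter follows it through [app p]. *)
exists G, (fun t => f (p t)), (lv f N), (fun t => f (app p t)), (lv f N.+1); split=> //.
- by apply: pmor_tail hp => //.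
- split=> [t ht|].
    have h1 := app_lev u0 hp ht; have [w e] := levP _ _ h1.
    have hlt : len (app p t) < N.+2 by rewrite e.
    have := pmor_lev hf w hlt; rewrite e => ->; split=> //.
    suff -> : app (fun t0 => f (p t0)) t = plus f (app p t) by exact: pmor_pref hf w hlt.
    rewrite /app /=; congr Ws; case el: (lst t) => [//|[s c]] /=.
    by have /andP[h2 h3] := lev_lst ht el; rewrite (based_plus bf).
  apply: (@aged_comp _ _ _ L.+1 N.+1 (app p) f).
  - by move=> t ht; exact: (app_lev u0 hp ht).
  - exact: (app_aged u0 okp_pos hp).
  - by case: (hf N.+1).
- split.
    apply: large_mono hlN => psi hpsi x hx.
    have hax : tail L N.+1 (fun t => app p (x t)).
      split=> [t ht|].
        have [h1 h2] := hx.1 t ht; split; first exact: (app_lev u0 hp h1).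
        rewrite /app (tail1 hx ht) /=; apply: pref_trans (hp.1 _ ht).2 _.
        exact: (@pref_par1 _ _ (Ws _ _)).
      apply: (@aged_comp _ _ _ L L.+1 x (app p)); last exact: (app_aged u0 okp_pos hp).
        by move=> t /hx.1 [].
      exact: hx.2.
    exact: hpsi _ hax.
  move=> _; apply: hD Dp => t ht /=; have [h1 _] := hp.1 t ht; have [w e] := levP _ _ h1.
  by rewrite hE'.
Qed.

Theorem large_mono_morphism L D : local_prop L D -> large L D ->
  exists g, [/\ mor g, based L g & forall N p, tail L N p -> D (fun t => g (p t))].
Proof.
move=> hD hl; have [h [st [mh bh _ _ hb]]] := iter_stp stp_good hD hl.
exists h; split=> // N p hp; have hN := tail_le u0 hp.
by apply: (hb isT (N - L)); rewrite subnKC.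
Qed.

(** One colour class is large below some morphism, and [large_mono_morphism] then finds a further
    one below which it is everything. *)
Theorem pigeonhole L (Cl : finType) (chi : (word -> word) -> Cl) :
  (forall p q, (forall t, lev L t -> p t = q t) -> chi p = chi q) ->
  exists g, [/\ mor g, based L g & forall N p N' p', tail L N p -> tail L N' p' ->
    chi (fun t => g (p t)) = chi (fun t => g (p' t))].
Proof.
move=> hchi.
have [|c [g [mg bg hl]]] := @large_part L Cl (fun c p => chi p = c).
  by move=> N p _; exists (chi p).
have [|g' [mg' bg' hg']] := large_mono_morphism _ hl.
  move=> p q epq <-; apply: hchi => t ht; by rewrite epq.
exists (fun t => g (g' t)); split; [exact: mor_comp|exact: based_comp|].
by move=> N p N' p' hp hp'; rewrite (hg' _ _ hp) (hg' _ _ hp').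
Qed.

End Pigeonhole.

(** * Fusion and the Ramsey theorem for morphisms *)

Section Ramsey.
Variables (U C : finType) (u0 : U).
Notation word := (word U C).
Implicit Types (t w z : word) (pi : pattern U C).
Local Hint Resolve pref_refl : core.

Variable okp : pattern U C -> Prop.
Hypothesis okp_pos : forall pi, okp pi -> 0 < pup pi.
Hypothesis okp_down : forall pi, okp pi -> 0 < plow pi -> okp (down pi).
Notation pmor := (pmor u0 okp).
Notation mor := (mor u0 okp).
Notation tail := (tail okp).
Notation aged := (aged okp).
Notation lv := (lv u0).
Notation pl := (pl u0).
Notation zw := (zw C u0).

(** Extending a morphism by one level amounts to choosing a tail, which makes the pigeonhole
    principle applicable to the last level. *)
Lemma ext_tail n f : pmor n.+1 f -> exists p, tail (pl f n) (lv f n) p /\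
  forall t, lev n t -> p (plus f t) = f t.
Proof.
move=> hf; have hf' := pmor_le (leqnSn n) hf.
pose S z := exists t, lev n t /\ plus f t = z.
have hsel z : exists t, S z -> lev n t /\ plus f t = z.
  by case: (EM (S z)) => [[t ht]|hn]; [exists t|exists z].
have [sel hs] := choice hsel.
exists (fun z => if `[< S z >] then f (sel z) else pad (lv f n) z); split.
  apply: (@patch _ _ okp _ _ S (fun z => f (sel z))) => [|z hz Sz|pi zs ok hzs hb].
  - exact: pl_lv hf _.
  - have [h1 h2] := hs z Sz; rewrite -[z in pref z]h2.
    by case: (hf n (ltnSn n)) => h _; exact: h.
  - have hz r : r < pup pi -> lev n (sel (zs r)) /\ plus f (sel (zs r)) = zs r.
      by move=> /hzs [_ /hs].
    have b1 : bad pi (fun r => sel (zs r)).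
      by case: (hf n (ltnSn n)) => _; apply=> // r /hz [].
    apply: eq_bad (bad_push okp_pos hf' ok _ b1) => [r /hz []//|r /hz [/levP[? ->]]].
    by split.
move=> t ht; rewrite asboolT; last by exists t.
have [h1 h2] := hs _ (ex_intro _ t (conj ht erefl) : S (plus f t)).
have [w1 e1] := levP _ _ h1; have [w e] := levP _ _ ht.
by rewrite (plus_inj hf' w1 w _ _ h2) ?e1 ?e.
Qed.

Lemma lv_pl n f i : pmor n f -> i < n -> lv f i < pl f n.
Proof. by case: n => // n hf hi; rewrite /= ltnS (lv_le hf). Qed.

Definition glue k (f q : word -> word) t := if len t < k then f t else q (plus f t).

Lemma pigeonhole_seq L (Cl : finType) (I : Type) (chi : I -> (word -> word) -> Cl) (s : seq I) :
  (forall i p q, (forall t, lev L t -> p t = q t) -> chi i p = chi i q) ->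
  exists g, [/\ mor g, based L g & forall d j N p N' p', j < size s ->
    tail L N p -> tail L N' p' ->
    chi (nth d s j) (fun t => g (p t)) = chi (nth d s j) (fun t => g (p' t))].
Proof.
move=> hchi; elim: s => [|i s [g [mg bg hg]]].
  by exists id; split=> //; exact: mor_id.
have [|g' [mg' bg' hg']] := @pigeonhole _ _ u0 okp okp_pos okp_down L Cl
    (fun p => chi i (fun t => g (p t))).
  by move=> p q e; apply: hchi => t ht; rewrite e.
exists (fun t => g (g' t)); split; [exact: mor_comp|exact: based_comp|].
move=> d [|j] N p N' p' /= hj hp hp'; first exact: hg' hp hp'.
exact: hg hj (mor_tail mg' bg' hp) (mor_tail mg' bg' hp').
Qed.

(** Up to agreement on words of length below [k] only finitely many [f] have [pl f k = L], so the
    pigeonhole principle is applied to each in turn. *)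
Lemma fusion_step k L (Cl : finType) (chi : (word -> word) -> Cl) H :
  (forall f f', (forall t, wf t -> len t < k.+1 -> f t = f' t) -> chi f = chi f') ->
  exists g, [/\ mor g, based L g & forall f N p N' p', pmor k f -> pl f k = L ->
    tail L N p -> tail L N' p' ->
    chi (fun t => H (glue k f (fun z => g (p z)) t)) =
    chi (fun t => H (glue k f (fun z => g (p' z)) t))].
Proof.
move=> hchi.
(* Words of length [k] are left fixed in these lists, hence the bound [maxn L k]. *)
have [F hF] := fin_maps (lews U C k) (lews U C (maxn L k)).
have [|g [mg bg hg]] := @pigeonhole_seq L Cl _ (fun f p => chi (fun t =>
    H (glue k f (fun z => if lev L z then p z else z) t))) F.
  move=> f p q epq; congr chi; apply/funext => t; rewrite /glue; case: ifP => // _.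
  by case: ifP => // h; rewrite epq.
exists g; split=> // f N p N' p' hf hL hp hp'.
have [|i [hi hif]] := hF (fun t => if len t < k then f t else t).
  move=> t; rewrite !mem_lews => /andP[w ht]; case: ifP => ht'; last by rewrite w leq_max ht orbT.
  have /levP[-> ->] := pmor_lev hf w ht'; rewrite leq_max -hL.
  by rewrite ltnW // (lv_pl hf).
have hif' t : wf t -> len t < k -> nth id F i t = f t.
  by move=> w ht; rewrite hif ?ht // mem_lews w ltnW.
have E q : chi (fun t => H (glue k (nth id F i) (fun z => if lev L z then q z else z) t)) =
    chi (fun t => H (glue k f q t)).
  apply: hchi => t w ht; rewrite /glue; case: ltnP => hk; first by rewrite hif'.
  have et : len t = k by lia.
  rewrite (plus_ext hif' w) ?et //; have := plus_lev hf w; rewrite et leqnn hL.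
  by move=> /(_ erefl) ->.
rewrite -(E (fun z => g (p z))) -(E (fun z => g (p' z))); exact: (hg id i N p N' p' hi hp hp').
Qed.

(** The maps of [fusion_step] for [L = 0, 1, ...] are composed; the one for [L] fixes all shorter
    words, so the infinite composite makes sense. It removes the dependence of the colour on the
    last level of [f]. *)
Lemma fusion k (Cl : finType) (chi : (word -> word) -> Cl) :
  (forall f f', (forall t, wf t -> len t < k.+1 -> f t = f' t) -> chi f = chi f') ->
  exists h, mor h /\ forall f f', pmor k.+1 f -> pmor k.+1 f' ->
    (forall t, wf t -> len t < k -> f t = f' t) ->
    chi (fun t => h (f t)) = chi (fun t => h (f' t)).
Proof.
move=> hchi.
have [G hG] := choice (fun q : (word -> word) * nat => fusion_step q.2 q.1 hchi).
pose Hs := fix Hs n := if n is n'.+1 then fun t => Hs n' (G (Hs n', n') t) else id.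
have HsE L M : L <= M -> exists g, [/\ mor g, based L g & forall t, Hs M t = Hs L (g t)].
  elim: M => [|M IH].
    by rewrite leqn0 => /eqP ->; exists id; split=> //; exact: mor_id.
  rewrite leq_eqVlt => /orP[/eqP <-|]; first by exists id; split=> //; exact: mor_id.
  rewrite ltnS => hLM; have [g [mg bg hg]] := IH hLM.
  have [m1 b1 _] := hG (Hs M, M).
  exists (fun t => g (G (Hs M, M) t)); split; first exact: mor_comp.
    by apply: based_comp => //; exact: based_le b1.
  by move=> t /=; rewrite hg.
have HsM L : mor (Hs L).
  have [g [mg _ hg]] := HsE 0 L (leq0n L).
  by have -> : Hs L = g by apply/funext => t; rewrite hg.
pose h t := Hs (len t).+1 t.
have hE M t : wf t -> len t < M -> h t = Hs M t.
  move=> w hM; have [g [_ bg ->]] := HsE _ _ hM.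
  by rewrite bg.
exists h; split.
  move=> n; apply: (pmor_eq (f := Hs n)); last exact: HsM.
  by move=> t w ht; rewrite -hE.
move=> f f' hf hf' eff'.
pose L := pl f k; have hL : pl f' k = L.
  by rewrite /L -(zw_len C u0 k) -!(@plus_len _ _ _ okp k) ?zw_wf ?zw_len ?(plus_ext eff') ?zw_wf ?zw_len //; exact: pmor_le (leqnSn k) _.
have key f1 : pmor k.+1 f1 -> pl f1 k = L -> exists N p, tail L N p /\
    chi (fun t => h (f1 t)) = chi (fun t => Hs L (glue k f1 (fun z => G (Hs L, L) (p z)) t)).
  move=> hf1 hL1; have [p [hp ep]] := ext_tail hf1; rewrite hL1 in hp.
  have hk1 := pmor_le (leqnSn k) hf1.
  pose M := (maxn L (lv f1 k)).+1.
  have hLM : L < M by rewrite ltnS leq_maxl.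
  have [g [mg bg hg]] := HsE _ _ hLM.
  have bg' : based L g by exact: based_le bg.
  exists (lv g (lv f1 k)), (fun z => g (p z)); split; first exact: mor_tail.
  apply: hchi => t w ht; have hft := pmor_lev hf1 w ht.
  have hlv : len (f1 t) < M.
    by rewrite (lev_len hft) ltnS leq_max (lv_le hf1) ?orbT.
  rewrite (hE M) ?(lev_wf hft) // hg /= /glue; case: ltnP => hk.
    have hl : len (f1 t) < L.
      by rewrite (lev_len hft) -hL1 (lv_pl hk1).
    have [m1 b1 _] := hG (Hs L, L).
    by rewrite bg' ?(lev_wf hft) // b1 // (lev_wf hft).
  by rewrite ep //; apply/levP; split=> //; lia.
have [N [p [hp ->]]] := key f hf erefl.
have [N' [p' [hp' ->]]] := key f' hf' hL.
have [_ _ hc] := hG (Hs L, L).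
rewrite (hc f _ _ _ _ (pmor_le (leqnSn k) hf) erefl hp hp').
apply: hchi => t w ht; rewrite /glue; case: ifP => hk; first by rewrite eff'.
by rewrite (plus_ext eff').
Qed.

(** Induction on [k]: after fusion, [f] has the colour of [z f], which inserts nothing on the last
    level and so depends on the lower levels only. *)
Theorem ramsey k (Cl : finType) (chi : (word -> word) -> Cl) :
  (forall f f', (forall t, wf t -> len t < k -> f t = f' t) -> chi f = chi f') ->
  exists h, mor h /\ forall f f', pmor k f -> pmor k f' ->
    chi (fun t => h (f t)) = chi (fun t => h (f' t)).
Proof.
elim: k chi => [|k IH] chi hchi.
  by exists id; split; [exact: mor_id|move=> f f' _ _; exact: hchi].
have [h [mh hh]] := fusion hchi.
pose z f := glue k f (fun y : word => y).
have zE f t : len t < k -> z f t = f t by rewrite /z /glue => ->.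
have [|h' [mh' hh']] := IH (fun f => chi (fun t => h (z f t))).
  move=> f f' e; apply: hchi => t w ht; rewrite /z /glue; case: ifP => hk; first by rewrite e.
  by rewrite (plus_ext e).
exists (fun t => h (h' t)); split; first exact: mor_comp.
have zp f : pmor k f -> pmor k.+1 (z f).
  move=> hf; have ez t : lev k t -> z f t = plus f t.
    by move=> /lev_len e; rewrite /z /glue e ltnn.
  have pz t : lev k t -> plus (z f) t = plus f t.
    by move=> /levP[w e]; apply: (@plus_ext _ _ k) => // [y _|]; [exact: zE|rewrite e].
  apply: (pmor_step (N := pl f k)).
  - by apply: pmor_eq hf => t _ /zE.
  - move=> t ht; rewrite ez // pz //; split=> //; have [w e] := levP _ _ ht.
    by have := plus_lev hf w; rewrite e => ->.
  - by apply: eq_aged (plus_aged okp_pos okp_down hf) => t /ez.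
have key f : pmor k.+1 f ->
    chi (fun t => h (h' (f t))) = chi (fun t => h (z (fun y => h' (f y)) t)).
  move=> hf; have hc : pmor k.+1 (fun t => h' (f t)).
    apply: (@pmor_comp _ _ _ _ k.+1 (lv f k).+1) => // i.
    by rewrite !ltnS => hi; apply: (lv_le hf).
  apply: (hh _ _ hc (zp _ (pmor_le (leqnSn k) hc))) => t _ ht; by rewrite zE.
move=> f f' hf hf'; rewrite !key //.
by apply: hh'; exact: pmor_le (leqnSn k) _.
Qed.

Theorem ramsey_seq k (Cl : finType) (I : Type) (chi : I -> (word -> word) -> Cl) (s : seq I) :
  (forall i f f', (forall t, wf t -> len t < k -> f t = f' t) -> chi i f = chi i f') ->
  exists h, mor h /\ forall d j f f', j < size s -> pmor k f -> pmor k f' ->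
    chi (nth d s j) (fun t => h (f t)) = chi (nth d s j) (fun t => h (f' t)).
Proof.
move=> hchi; elim: s => [|i s [h [mh hh]]].
  by exists id; split=> //; exact: mor_id.
have [|h' [mh' hh']] := @ramsey k Cl (fun f => chi i (fun t => h (f t))).
  by move=> f f' e; apply: hchi => t w ht; rewrite e.
exists (fun t => h (h' t)); split; first exact: mor_comp.
have hc f : pmor k f -> pmor k (fun t => h' (f t)).
  case: k {hchi hh hh'} => [|k] hf; first by move=> j.
  apply: (@pmor_comp _ _ _ _ k.+1 (lv f k).+1) => // j.
  by rewrite !ltnS => hi; apply: (lv_le hf).
by move=> d [|j] f f' /= hj hf hf'; [exact: hh'|apply: hh => //; exact: hc].
Qed.

End Ramsey.

(** * Coding a structure by lines *)

Fixpoint tup (T : Type) (X : seq T) p : seq (seq T) :=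
  if p is p'.+1 then [seq x :: s | x <- X, s <- tup X p'] else [:: [::]].

Lemma size_tup (T : Type) (X : seq T) p : size (tup X p) = size X ^ p.
Proof. by elim: p => [//|p IH]; rewrite /= size_allpairs IH expnS. Qed.

Lemma mem_tup (T : eqType) (X : seq T) p s :
  size s = p -> {subset s <= X} -> s \in tup X p.
Proof.
elim: p s => [|p IH] [|x s] //= [hs] hX; apply: allpairs_f.
  by apply: hX; rewrite mem_head.
by apply: IH => // y hy; apply: hX; rewrite inE hy orbT.
Qed.

Inductive kind := KM of nat | KB of seq nat & nat | KR of nat.

Section Lines.
Variables (U C : finType) (u0 : U) (u : nat -> U) (c : nat -> nat -> C) (m : nat).
Notation word := (word U C).
Notation letter := (option (option C) + (word * C))%type.
Implicit Types (t w z : word) (pi : pattern U C) (Q : seq nat).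
Local Hint Resolve pref_refl : core.

Definition codes i : seq (seq nat) := flatten [seq tup (iota 0 i) p | p <- iota 0 m.+1].
(** Each listed sequence gets [m.+1] levels, more than a block needs, so that division recovers the
    block and the position in it; the sequences that are not increasing merely waste levels. The
    summand 2 is for the splitting level and the level of the vertex. *)
Fixpoint base i := if i is i'.+1 then base i' + (m.+1 * size (codes i)).+2 else 0.

(* Stage [i] consists of a level where lines split according to their 2-type over [i],
   of the levels of the blocks [Q] with greatest element [i], and of the level of [i]. *)
Definition klev k := match k with
  | KM i => base i
  | KB Q j => base (last 0 Q) + 1 + m.+1 * index Q (codes (last 0 Q).+1) + j
  | KR i => base i + 1 + m.+1 * size (codes i.+1)
  end.
Definition stage k := match k with KM i => i | KB Q _ => last 0 Q | KR i => i end.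
Definition kap k := match k with KM i => i | KB Q j => nth 0 Q j | KR i => i end.
Definition valid k :=
  if k is KB Q j then [&& sorted ltn Q, size Q <= m & j < size Q] else true.
Definition named k := if k is KM _ then false else valid k.

Lemma base_lt i j : i < j -> base i < base j.
Proof.
elim: j => [//|j IH]; rewrite ltnS leq_eqVlt => /orP[/eqP->|/IH] /=; lia.
Qed.

Lemma base_le i j : i <= j -> base i <= base j.
Proof. by rewrite leq_eqVlt => /orP[/eqP->//|/base_lt/ltnW]. Qed.

Lemma sorted_nth_lt Q i j : sorted ltn Q -> i < j -> j < size Q -> nth 0 Q i < nth 0 Q j.
Proof.
move=> h hij hj; apply: (sorted_ltn_nth ltn_trans) => //; rewrite inE //.
exact: ltn_trans hij hj.
Qed.

Lemma sorted_nth_last Q i : sorted ltn Q -> i < size Q -> nth 0 Q i <= last 0 Q.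
Proof.
move=> h hi; rewrite -nth_last; case: (eqVneq i (size Q).-1) => [->//|ne].
by apply/ltnW/sorted_nth_lt => //; lia.
Qed.

Lemma codesP Q : sorted ltn Q -> size Q <= m -> Q \in codes (last 0 Q).+1.
Proof.
move=> h1 h2; apply/flattenP; exists (tup (iota 0 (last 0 Q).+1) (size Q)).
  by apply: map_f; rewrite mem_iota.
apply: mem_tup => // x /(nthP 0) [i hi <-].
by rewrite mem_iota add0n ltnS /=; apply: sorted_nth_last.
Qed.

Lemma klev_block Q j : valid (KB Q j) ->
  base (last 0 Q) < klev (KB Q j) < klev (KR (last 0 Q)).
Proof.
case/and3P=> h1 h2 h3; have := codesP h1 h2; rewrite -index_mem /= => h; nia.
Qed.

Lemma klev_stage k : valid k -> base (stage k) <= klev k < base (stage k).+1.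
Proof.
case: k => [i _|Q j h|i _] /=; try lia.
by have := klev_block h; rewrite /=; lia.
Qed.

Lemma klev_inj k k' : valid k -> valid k' -> klev k = klev k' -> k = k'.
Proof.
move=> h h' e.
have es : stage k = stage k'.
  have := klev_stage h; have := klev_stage h'; rewrite e => a1 a2.
  case: (ltngtP (stage k) (stage k')) => // /base_le; lia.
case: k k' h h' e es => [i|Q j|i] [i'|Q' j'|i'] h h' e es.
- by rewrite (es : i = i').
- by have := klev_block h'; rewrite -e -(es : i = last 0 Q') ltnn.
- by move: e; rewrite (es : i = i') /=; move: (m.+1 * _) => X; lia.
- by have := klev_block h; rewrite e (es : last 0 Q = i') ltnn.
- case/and3P: h => h1 h2 h3; case/and3P: h' => h1' h2' h3'.
  have {}es : last 0 Q = last 0 Q' := es.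
  have {}e : base (last 0 Q) + 1 + m.+1 * index Q (codes (last 0 Q).+1) + j =
    base (last 0 Q') + 1 + m.+1 * index Q' (codes (last 0 Q').+1) + j' := e.
  rewrite es in e; have q1 := codesP h1 h2; have q2 := codesP h1' h2'; rewrite es in q1.
  have e' : m.+1 * index Q (codes (last 0 Q').+1) + j = m.+1 * index Q' (codes (last 0 Q').+1) + j'.
    by move: e; rewrite -!addnA => /addnI /addnI.
  have ej : j = j'.
    move/(congr1 (fun x => x %% m.+1)): e'.
    rewrite ![m.+1 * _]mulnC !modnMDl !modn_small //; lia.
  have ei : index Q (codes (last 0 Q').+1) = index Q' (codes (last 0 Q').+1).
    by apply/eqP; rewrite -(eqn_pmul2l (ltn0Sn m)) -(eqn_add2r j) e' ej.
  by rewrite ej -(nth_index [::] q1) ei nth_index.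
- by have := klev_block h; rewrite e (es : last 0 Q = i') ltnn andbF.
- by move: e; rewrite (es : i = i') /=; move: (m.+1 * _) => X; lia.
- by have := klev_block h'; rewrite -e -(es : i = last 0 Q') ltnn andbF.
- by rewrite (es : i = i').
Qed.

Lemma klevB Q j : klev (KB Q j) = klev (KB Q 0) + j.
Proof. by rewrite /= addn0. Qed.

Definition kd M : option kind :=
  if pselect (exists k, valid k /\ klev k = M) is left e then Some (projT1 (cid e)) else None.

Lemma kd_klev k : valid k -> kd (klev k) = Some k.
Proof.
move=> h; rewrite /kd; case: pselect => [e|[]]; last by exists k.
case: (cid e) => k' [h1 h2] /=; congr Some; exact: klev_inj.
Qed.

Lemma kd_some M k : kd M = Some k -> valid k /\ klev k = M.
Proof. by rewrite /kd; case: pselect => // e [<-]; case: (cid e). Qed.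

(** The word of [q] as a member of the block: blank before the block, then naming the first [n]
    members, so that it involves nothing outside [Q]. *)
Fixpoint bl Q n q : word :=
  if n is n'.+1 then
    Ws (bl Q n' q) (inr (if n' == 0 then W0 C (u (nth 0 Q 0)) else bl Q n' (nth 0 Q n'),
                         c (nth 0 Q n') q))
  else pad (klev (KB Q 0)) (W0 C (u q)).
(** The first member gets the word of length 0 instead of a blank word reaching up to the block:
    [plus f] fixes [W0], whereas the length of the blank word need not be a value of [pl f] for an
    envelope [f]. *)
Definition bv Q n := if n == 0 then W0 C (u (nth 0 Q 0)) else bl Q n (nth 0 Q n).

(** The mark [Some None] on level [base x] sets the line of [x] apart from the lines of later
    vertices, which show their 2-type over [x] there. *)
Definition ltr (g : nat -> word) x M : letter :=
  if M < base x then
    match kd M with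
    | None => inl None
    | Some (KM i) => inl (Some (Some (c i x)))
    | Some (KB Q j) => inr (bv Q j, c (nth 0 Q j) x)
    | Some (KR i) => inr (g i, c i x)
    end
  else if M == base x then inl (Some None) else inl None.
Definition gline g x N := iteri N (fun M t => Ws t (ltr g x M)) (W0 C (u x)).
(** A line names the words of all smaller vertices; the list makes this recursion structural, and
    [topE] removes the detour. *)
Fixpoint tops n := if n is n'.+1 then
    rcons (tops n') (gline (nth (W0 C u0) (tops n')) n' (base n').+1)
  else [::].
Definition top x := nth (W0 C u0) (tops x.+1) x.
Definition line x N := gline top x N.
Definition vert k := match k with KM _ => W0 C u0 | KB Q j => bv Q j | KR i => top i end.

Lemma lineS x N : line x N.+1 = Ws (line x N) (ltr top x N).
Proof. by []. Qed.

Lemma size_tops n : size (tops n) = n.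
Proof. by elim: n => [//|n IH]; rewrite /= size_rcons IH. Qed.

Lemma nth_tops n i : i < n -> nth (W0 C u0) (tops n) i = top i.
Proof.
elim: n => [//|n IH]; rewrite ltnS leq_eqVlt => /orP[/eqP->//|hi].
by rewrite /= nth_rcons size_tops hi IH.
Qed.

Lemma stage_lt k x : valid k -> klev k < base x -> stage k < x.
Proof.
move=> /klev_stage h1 h2; case: (ltnP (stage k) x) => // /base_le; lia.
Qed.

Lemma kap_stage k : valid k -> kap k <= stage k.
Proof. by case: k => //= Q j /and3P[h1 h2 h3]; exact: sorted_nth_last. Qed.

Lemma kap_lt k x : valid k -> klev k < base x -> kap k < x.
Proof. by move=> h1 h2; apply: leq_ltn_trans (kap_stage h1) (stage_lt h1 h2). Qed.

Lemma topE x : top x = line x (base x).+1.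
Proof.
have -> : top x = gline (nth (W0 C u0) (tops x)) x (base x).+1.
  by rewrite {1}/top -/(rcons _ _) nth_rcons size_tops ltnn eqxx.
rewrite /line /gline; elim: (base x).+1 => [//|n IH] /=; rewrite IH; congr Ws.
rewrite /ltr; case: ifP => // hn; case E: (kd n) => [[i|Q j|i]|] //.
have [h1 h2] := kd_some E.
by rewrite nth_tops //; apply: (stage_lt (k := KR i)) => //; rewrite h2.
Qed.

Lemma len_line x N : len (line x N) = N.
Proof. by elim: N => [//|N IH]; rewrite lineS /= IH. Qed.

Lemma root_line x N : root (line x N) = u x.
Proof. by elim: N. Qed.

Lemma lkp_line x N M : lkp (line x N) M = if M < N then Some (ltr top x M) else None.
Proof.
elim: N => [//|N IH]; rewrite lineS /= len_line IH ltnS.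
by case: ltngtP => [//|//|->].
Qed.

Lemma res_line x N M : M <= N -> res M (line x N) = line x M.
Proof.
elim: N => [|N IH]; first by rewrite leqn0 => /eqP ->.
rewrite leq_eqVlt lineS /= len_line => /orP[/eqP ->|h]; first by rewrite ltnSn.
by rewrite ltnNge -ltnS h /= IH.
Qed.

Lemma pref_line x N M : M <= N -> pref (line x M) (line x N).
Proof. by move=> h; rewrite /pref len_line res_line. Qed.

Lemma len_bl Q n q : len (bl Q n q) = klev (KB Q 0) + n.
Proof. by elim: n => [|n IH]; [rewrite addn0; apply: pad_len|rewrite addnS -IH]. Qed.

Lemma len_bv Q n : len (bv Q n) <= klev (KB Q n).
Proof. by rewrite /bv; case: eqP => // _; rewrite len_bl -klevB. Qed.

Lemma blS Q n q : bl Q n.+1 q = Ws (bl Q n q) (inr (bv Q n, c (nth 0 Q n) q)).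
Proof. by []. Qed.

Lemma wf_bl Q n q : wf (bl Q n q).
Proof.
elim: n q => [|n IH] q; first exact: pad_wf.
rewrite blS /= IH len_bl -klevB len_bv andbT /=.
by rewrite /bv; case: eqP.
Qed.

Lemma wf_bv Q n : wf (bv Q n).
Proof. by rewrite /bv; case: eqP => // _; exact: wf_bl. Qed.

Lemma root_bl Q n q : root (bl Q n q) = u q.
Proof. by elim: n => [|n IH] //; rewrite (pref_root (pad_pref _ _)). Qed.

Lemma root_bv Q n : root (bv Q n) = u (nth 0 Q n).
Proof. by rewrite /bv; case: eqP => [->//|_]; rewrite root_bl. Qed.

Lemma lkp_bl_name Q n q M s d : lkp (bl Q n q) M = Some (inr (s, d)) ->
  exists j, [/\ j < n, M = klev (KB Q j), s = bv Q j & d = c (nth 0 Q j) q].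
Proof.
elim: n => [|n IH]; first by move/pad_lkp.
rewrite blS [lkp _ _]/= len_bl -klevB; case: eqP => [-> [<- <-]|_ /IH [j [h1 h2 h3 h4]]].
  by exists n.
by exists j; split=> //; exact: ltnW.
Qed.

Lemma lkp_bl Q n q j : j < n -> lkp (bl Q n q) (klev (KB Q j)) = Some (inr (bv Q j, c (nth 0 Q j) q)).
Proof.
elim: n => [//|n IH]; rewrite ltnS leq_eqVlt blS [lkp _ _]/= len_bl -klevB => /orP[/eqP->|h].
  by rewrite eqxx.
have ne : klev (KB Q j) != klev (KB Q n) by rewrite (klevB Q n) klevB eqn_add2l neq_ltn h.
by rewrite (negbTE ne) IH.
Qed.

Lemma lkp_bv Q n j : j < n -> lkp (bv Q n) (klev (KB Q j)) = Some (inr (bv Q j, c (nth 0 Q j) (nth 0 Q n))).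
Proof. by rewrite {1}/bv; case: eqP => [->//|_]; exact: lkp_bl. Qed.

Lemma wf_top x : wf (top x).
Proof.
have [n] := ubnP x; elim: n x => [//|n IH] x; rewrite ltnS => hx.
rewrite topE; elim: (base x).+1 => [//|N IHN]; rewrite lineS /= IHN len_line /=.
rewrite /ltr; case: ifP => [hN|_]; last by case: ifP.
case E: (kd N) => [[i|Q j|i]|] //; have [h1 h2] := kd_some E.
  by rewrite wf_bv -h2 len_bv.
have hi : i < x by apply: (stage_lt (k := KR i)) => //; rewrite h2.
rewrite IH; last exact: leq_trans hi hx.
by rewrite topE len_line -h2 /=; lia.
Qed.

Lemma wf_line x N : wf (line x N).
Proof.
elim: N => [//|N IHN]; rewrite lineS /= IHN len_line /=.
rewrite /ltr; case: ifP => [hN|_]; last by case: ifP.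
case E: (kd N) => [[i|Q j|i]|] //; have [h1 h2] := kd_some E.
  by rewrite wf_bv -h2 len_bv.
by rewrite wf_top topE len_line -h2 /=; lia.
Qed.

Lemma lev_line x N : lev N (line x N).
Proof. by apply/levP; rewrite wf_line len_line. Qed.

Lemma line_name x N M s d : lkp (line x N) M = Some (inr (s, d)) ->
  exists k, [/\ named k, klev k = M, s = vert k, d = c (kap k) x & M < base x /\ M < N].
Proof.
rewrite lkp_line; case: ltnP => // hN; rewrite /ltr; case: ltnP => hM; last by case: ifP.
case E: (kd M) => [[i|Q j|i]|] //; have [h1 h2] := kd_some E => -[<- <-].
  by exists (KB Q j).
by exists (KR i).
Qed.

Lemma lkp_line_kind x N k : named k -> klev k < base x -> klev k < N ->
  lkp (line x N) (klev k) = Some (inr (vert k, c (kap k) x)).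
Proof.
move=> hk h1 h2; have hv : valid k by case: (k) hk.
by rewrite lkp_line h2 /ltr h1 kd_klev //; case: (k) hk.
Qed.

Lemma root_vert k : named k -> root (vert k) = u (kap k).
Proof. by case: k => //= [Q j _|i _]; [exact: root_bv|rewrite topE root_line]. Qed.

Lemma vert_name k M s d : named k -> lkp (vert k) M = Some (inr (s, d)) ->
  exists k', [/\ named k', klev k' = M, s = vert k', d = c (kap k') (kap k) &
    kap k' < kap k /\ (forall Q j, k = KB Q j -> exists j', k' = KB Q j')].
Proof.
case: k => [//|Q n|y] /= hk.
  rewrite /bv; case: eqP => // _ /lkp_bl_name [j [h1 h2 h3 h4]].
  case/and3P: hk => k1 k2 k3.
  exists (KB Q j); rewrite /= h3 k1 k2 h2 (ltn_trans h1 k3); split=> //; split.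
    exact: sorted_nth_lt.
  by move=> Q' j' [<- _]; exists j.
rewrite topE => /line_name [k [h1 h2 h3 h4 [h5 _]]]; exists k; split=> //; split=> //.
by apply: kap_lt; [case: (k) h1|rewrite h2].
Qed.

(* The vertices [kap (ks i)] and [xs r] realise the pattern in the structure that the lines code. *)
Lemma real_kinds pi xs N s M : 0 < pup pi -> real pi (fun r => line (xs r) N) s M ->
  exists ks : nat -> kind,
  [/\ forall i, i < plow pi ->
        [/\ named (ks i), klev (ks i) = M i, s i = vert (ks i), u (kap (ks i)) = pone pi i & M i < N],
      forall i j, i < j -> j < plow pi ->
        [/\ kap (ks i) < kap (ks j), c (kap (ks i)) (kap (ks j)) = ptwo pi i j &
            forall Q n, ks j = KB Q n -> exists n', ks i = KB Q n'],
      forall r, r < pup pi -> u (xs r) = pone pi (plow pi + r) &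
      forall i r, i < plow pi -> r < pup pi ->
        [/\ kap (ks i) < xs r, c (kap (ks i)) (xs r) = ptwo pi i (plow pi + r) & M i < base (xs r)]].
Proof.
move=> h0 [r1 r2 r3 r4].
have hk i : exists k, i < plow pi -> [/\ named k, klev k = M i, s i = vert k,
    ptwo pi i (plow pi + 0) = c (kap k) (xs 0) & M i < N].
  case: (ltnP i (plow pi)) => hi; last by exists (KM 0).
  by have [k [k1 k2 k3 k4 [_ k5]]] := line_name (r4 i 0 hi h0); exists k.
have [ks hks] := choice hk.
have nv k : named k -> valid k by case: k.
exists ks; split.
- move=> i hi; have [k1 k2 k3 k4 k5] := hks i hi; split=> //.
  by rewrite -r1 // k3 root_vert.
- move=> i j hij hj; have hi := ltn_trans hij hj.
  have [k1 k2 k3 k4 k5] := hks i hi; have [l1 l2 l3 l4 l5] := hks j hj.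
  have := r2 i j hij hj; rewrite l3 => /(vert_name l1) [k' [q1 q2 q3 q4 [q5 q6]]].
  have ek : k' = ks i by apply: klev_inj; rewrite ?nv // q2 k2.
  by rewrite -ek; split.
- by move=> r hr; rewrite -r3 // root_line.
- move=> i r hi hr; have [k1 k2 k3 k4 k5] := hks i hi.
  have [k' [q1 q2 q3 q4 [q5 _]]] := line_name (r4 i r hi hr).
  have ek : k' = ks i by apply: klev_inj; rewrite ?nv // q2 k2.
  rewrite -ek; split=> //; apply: kap_lt; [exact: nv|by rewrite q2].
Qed.

(* Whatever is realised is already realised inside a single block, because the block of
   the vertices involved precedes the level of the last of them. *)
Lemma real_block pi xs N s M : 0 < pup pi -> 0 < plow pi -> plow pi <= m ->
  real pi (fun r => line (xs r) N) s M ->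
  exists Q s' M', [/\ sorted ltn Q, size Q <= m, real pi (fun r => line (xs r) N) s' M' &
    forall i, i < plow pi -> M' i < N /\ exists2 j, j < size Q & M' i = klev (KB Q j)].
Proof.
move=> h0 ha hm hr; have [ks [k1 k2 k3 k4]] := real_kinds h0 hr.
have aP : (plow pi).-1 < plow pi by lia.
have [n1 e1 _ _ e2] := k1 _ aP.
case E: (ks (plow pi).-1) n1 e1 => [//|Q j|y] /= n1 e1.
  case/and3P: (n1) => q1 q2 q3; exists Q, s, M; split=> // i hi.
  have [n2 e3 _ _ e4] := k1 i hi; split=> //.
  case: (eqVneq i (plow pi).-1) => [ei|ne].
    by exists j => //; rewrite -e3 ei E.
  have hi' : i < (plow pi).-1 by lia.
  have [_ _ /(_ _ _ E) [j' ej]] := k2 _ _ hi' aP.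
  by exists j'; [move: n2; rewrite ej /= => /and3P[]|rewrite -e3 ej].
pose Q := mkseq (fun i => kap (ks i)) (plow pi).
have sQ : size Q = plow pi by rewrite size_mkseq.
have nQ i : i < plow pi -> nth 0 Q i = kap (ks i) by move=> hi; rewrite nth_mkseq.
have oQ : sorted ltn Q.
  apply/(sortedP 0) => i; rewrite sQ => hi; rewrite !nQ //; last exact: ltnW.
  by case: (k2 i i.+1 (ltnSn i) hi).
have lQ : last 0 Q = y by rewrite -nth_last sQ nQ // E.
have vQ i : i < plow pi -> valid (KB Q i) by move=> hi; rewrite /= oQ sQ hm hi.
have bQ i : i < plow pi -> klev (KB Q i) < M (plow pi).-1.
  by move=> /vQ /klev_block /andP[_]; rewrite lQ -e1.
exists Q, (bv Q), (fun i => klev (KB Q i)); split=> //; first by rewrite sQ.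
  split.
  - by move=> i hi; rewrite root_bv nQ //; case: (k1 i hi).
  - move=> i j hij hj; rewrite lkp_bv // !nQ //; last exact: ltn_trans hij hj.
    by case: (k2 i j hij hj) => _ ->.
  - by move=> r hr'; rewrite root_line k3.
  - move=> i r hi hr'; have [_ <- _] := k4 i r hi hr'.
    have [_ _ hb] := k4 _ r aP hr'.
    rewrite -nQ //; apply: (@lkp_line_kind _ _ (KB Q i)); first exact: vQ.
      exact: ltn_trans (bQ i hi) hb.
    exact: ltn_trans (bQ i hi) e2.
move=> i hi; split; first exact: ltn_trans (bQ i hi) e2.
by exists i; rewrite ?sQ.
Qed.

(** A letter naming the vertex [kap k] repeats a 2-type that was shown before, on level
    [base (kap k)]. So lines can part only on splitting levels, including the one on which one of
    them ends. *)
Lemma line_split x x' M : line x M = line x' M -> ltr top x M <> ltr top x' M ->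
  exists i, M = base i.
Proof.
wlog: x x' / x <= x' => [H h1 h2|].
  by case: (leqP x x') => h; [exact: H h h1 h2|apply: (H x' x) => //; [exact: ltnW|move=> e; apply: h2; exact: esym]].
rewrite leq_eqVlt => /orP[/eqP->//|hx] hl hn.
have agree N : N < M -> ltr top x N = ltr top x' N.
  by move=> hN; have := lkp_line x M N; rewrite hl lkp_line hN => -[].
have hb := base_lt hx.
have hMx : M <= base x.
  rewrite leqNgt; apply/negP => /agree; rewrite /ltr ltnn eqxx hb.
  by have /= -> := @kd_klev (KM x) erefl.
case: (eqVneq M (base x)) => [->|ne]; first by exists x.
have hM : M < base x by lia.
move: hn; rewrite /ltr hM (ltn_trans hM hb); case E: (kd M) => [[i|Q j|i]|] //.
- by have [_ /= <-] := kd_some E; exists i.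
- have [v /esym eM] := kd_some E.
  have hq : base (nth 0 Q j) < M.
    rewrite eM; apply: leq_ltn_trans (base_le (kap_stage v)) _.
    by have /andP[] := klev_block v.
  have := agree _ hq; rewrite /ltr (ltn_trans hq hM) (ltn_trans hq (ltn_trans hM hb)).
  by have /= -> := @kd_klev (KM (nth 0 Q j)) erefl => -[->].
- have [v /esym eM] := kd_some E.
  have hq : base i < M by rewrite eM /=; lia.
  have := agree _ hq; rewrite /ltr (ltn_trans hq hM) (ltn_trans hq (ltn_trans hM hb)).
  by have /= -> := @kd_klev (KM i) erefl => -[->].
Qed.

End Lines.

(** * Envelopes *)

HB.instance Definition _ (U C : Type) := gen_eqMixin (pattern U C).

Lemma size_flatten_le (T : eqType) (S : Type) (F : T -> seq S) b (s : seq T) :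
  (forall x, x \in s -> size (F x) <= b) -> size (flatten (map F s)) <= b * size s.
Proof.
elim: s => [//|x s IH] h /=; rewrite size_cat mulnS leq_add ?h ?mem_head //.
by apply: IH => y hy; apply: h; rewrite inE hy orbT.
Qed.

Section Envelope.
Variables (U C : finType) (u0 : U) (u : nat -> U) (c : nat -> nat -> C) (m : nat).
Variable Pats : seq (pattern U C).
Notation word := (word U C).
Implicit Types (t w z : word) (pi : pattern U C) (Q X : seq nat).
Local Hint Resolve pref_refl : core.
Let okp pi := pi \in Pats.
Hypothesis okp_pos : forall pi, okp pi -> 0 < pup pi.
Hypothesis okp_down : forall pi, okp pi -> 0 < plow pi -> okp (down pi).
Hypothesis okp_bound : forall pi, okp pi -> plow pi <= m /\ pup pi <= m.

Notation pmor := (pmor u0 okp).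
Notation mor := (mor u0 okp).
Notation aged := (aged okp).
Notation lv := (lv u0).
Notation pl := (pl u0).
Notation line := (line u0 u c m).
Notation line_letter := (ltr u c m (top u0 u c m)).
Notation top := (top u0 u c m).
Notation klev := (klev m).
Notation base := (base m).
Notation kd := (kd m).
Notation block_vert := (bv u c m).
Notation bl := (bl u c m).

(** The block found at the least length at which the pattern is realised serves all greater
    lengths. *)
Lemma block_choice pi (xs : seq nat) : okp pi -> exists Q,
  [/\ sorted ltn Q, size Q <= m & forall N, 0 < plow pi ->
    bad pi (fun r => line (nth 0 xs r) N) -> exists s M,
    real pi (fun r => line (nth 0 xs r) N) s M /\
    forall i, i < plow pi -> M i < N /\ exists2 j, j < size Q & M i = klev (KB Q j)].
Proof.
move=> ok; have h0 := okp_pos ok; have [hm _] := okp_bound ok.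
pose P N := `[< 0 < plow pi /\ bad pi (fun r => line (nth 0 xs r) N) >].
case: (EM (exists N, P N)) => [hex|hn]; last first.
  exists [::]; split=> // N h1 h2; case: hn; exists N; exact/asboolP.
have [n /asboolP [ha [s [M hr]]] hmin] : exists2 n, P n & forall n', P n' -> n <= n'.
  by case: (ex_minnP hex) => n h1 h2; exists n.
have [Q [s' [M' [q1 q2 q3 q4]]]] := real_block h0 ha hm hr.
exists Q; split=> // N h1 h2; exists s', M'.
have hN : n <= N by apply: hmin; exact/asboolP.
split.
  case: q3 => r1 r2 r3 r4; split=> // [r hr'|i r hi hr'].
    by rewrite root_line -r3 // root_line.
  exact: pref_lkp (pref_line _ _ _ _ _ hN) (r4 i r hi hr').
move=> i hi; have [k1 k2] := q4 i hi; split=> //; exact: leq_trans k1 hN.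
Qed.

Lemma split_choice x x' : exists d, (exists i, d = base i) /\
  forall M, line x M = line x' M -> line_letter x M <> line_letter x' M -> M = d.
Proof.
case: (EM (exists M, line x M = line x' M /\ line_letter x M <> line_letter x' M)) => [[M [h1 h2]]|hn].
  exists M; split; first exact: line_split h1 h2.
  suff H N N' : line x N = line x' N -> line_letter x N <> line_letter x' N ->
      line x N' = line x' N' -> line_letter x N' <> line_letter x' N' -> N' <= N.
    by move=> N h3 h4; apply/eqP; rewrite eqn_leq (H M N) ?(H N M).
  move=> _ k2 k3 _; rewrite leqNgt; apply/negP => hlt; apply: k2.
  by have := lkp_line u0 u c m x N' N; rewrite k3 lkp_line hlt => -[].
exists 0; split; first by exists 0.
by move=> M h1 h2; case: hn; exists M.
Qed.

(** Two levels per vertex, one splitting level per pair, at most [m] block levels for each pattern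
    and each tuple of upper nodes, and level 0. The base [n.+1] keeps the power monotone in the
    exponent when [n = 0]. *)
Definition env_size n := (n * 2 + (n * n + m * n.+1 ^ m * size Pats)).+1.

(** The kept levels contain all that is needed to rebuild the lines of [X] from them: blocks are
    kept whole, and the only other vertices named are in [X]. *)
Lemma env_levels X : exists Lv : seq nat,
  [/\ size Lv <= env_size (size X),
      0 \in Lv /\ (forall x, x \in X -> base x \in Lv /\ klev (KR x) \in Lv),
      forall M k, M \in Lv -> kd M = Some k -> match k with
        | KM _ => True
        | KB Q _ => forall j, j < size Q -> klev (KB Q j) \in Lv
        | KR y => y \in X
        end,
      forall x x' M, x \in X -> x' \in X -> line x M = line x' M -> line_letter x M <> line_letter x' M -> M \in Lv &
      forall pi xs N, okp pi -> 0 < plow pi -> (forall r, r < pup pi -> xs r \in X) ->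
        bad pi (fun r => line (xs r) N) -> exists s M,
        real pi (fun r => line (xs r) N) s M /\ forall i, i < plow pi -> M i < N /\ M i \in Lv].
Proof.
have hQ (q : pattern U C * seq nat) : exists Q, [/\ sorted ltn Q, size Q <= m & okp q.1 ->
    forall N, 0 < plow q.1 ->
    bad q.1 (fun r => line (nth 0 q.2 r) N) -> exists s M,
    real q.1 (fun r => line (nth 0 q.2 r) N) s M /\
    forall i, i < plow q.1 -> M i < N /\ exists2 j, j < size Q & M i = klev (KB Q j)].
  case: (boolP (okp q.1)) => ok; last by exists [::].
  by have [Q [q1 q2 q3]] := block_choice q.2 ok; exists Q.
have [Qf hQf] := choice hQ.
have [df hdf] := choice (fun q : nat * nat => split_choice q.1 q.2).
pose Lb := flatten [seq flatten [seq [seq klev (KB (Qf (pi, xs)) j) | j <- iota 0 (size (Qf (pi, xs)))]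
  | xs <- tup X (pup pi)] | pi <- Pats].
have LbP M : M \in Lb -> exists q j, M = klev (KB (Qf q) j) /\ j < size (Qf q) /\
    forall j', j' < size (Qf q) -> klev (KB (Qf q) j') \in Lb.
  case/flattenP => l /mapP[pi hpi ->] /flattenP[l' /mapP[xs hxs ->] /mapP[j]].
  rewrite mem_iota /= => hj ->; exists (pi, xs), j; split=> //; split=> // j' hj'.
  apply/flattenP; eexists; first by apply: map_f hpi.
  apply/flattenP; eexists; first by apply: map_f hxs.
  by apply: map_f; rewrite mem_iota.
pose Lv := 0 :: flatten [seq [:: base x; klev (KR x)] | x <- X] ++
  [seq df (x, x') | x <- X, x' <- X] ++ Lb.
have kd0 i : kd (base i) = Some (KM i) by exact: (@kd_klev m (KM i)).
exists Lv; split.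
- rewrite /= !size_cat size_allpairs /env_size ltnS !leq_add //.
    by rewrite mulnC; apply: size_flatten_le.
  apply: size_flatten_le => pi hpi.
  apply: (@leq_trans (m * size (tup X (pup pi)))).
    apply: size_flatten_le => xs _; rewrite size_map size_iota.
    by case: (hQf (pi, xs)).
  rewrite size_tup leq_mul2l; apply/orP; right.
  have [_ hp] := okp_bound hpi.
  apply: (@leq_trans ((size X).+1 ^ pup pi)); first by rewrite leq_exp2r ?okp_pos.
  exact: leq_pexp2l.
- split; first exact: mem_head.
  move=> x hx; have H l : l \in [:: base x; klev (KR x)] -> l \in Lv.
    move=> hl; rewrite inE mem_cat; apply/orP; right; apply/orP; left.
    by apply/flattenP; exists [:: base x; klev (KR x)] => //; apply: map_f.
  by split; apply: H; rewrite !inE eqxx ?orbT.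
- move=> M k; rewrite inE !mem_cat => /or4P[/eqP ->|/flattenP[l /mapP[x hx ->]]|/allpairsP[[x x'] [hx hx' ->]]|hM].
  + by have /= -> := kd0 0 => -[<-].
  + rewrite !inE => /orP[]/eqP->; first by rewrite kd0 => -[<-].
    by rewrite (@kd_klev m (KR x)) // => -[<-].
  + by have [[i ->] _] := hdf (x, x'); rewrite kd0 => -[<-].
  + have [q [j [-> [hj hall]]]] := LbP _ hM.
    have [q1 q2 _] := hQf q.
    rewrite kd_klev /= ?q1 ?q2 // => -[<-] j' hj'.
    by rewrite inE !mem_cat hall ?orbT.
- move=> x x' M hx hx' h1 h2; have [_ H] := hdf (x, x').
  rewrite (H M h1 h2) inE !mem_cat; apply/orP; right; apply/orP; right; apply/orP; left.
  exact: (allpairs_f (fun x x' => df (x, x'))).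
- move=> pi xs N ok ha hxs hb; pose xl := mkseq xs (pup pi).
  have nx r : r < pup pi -> nth 0 xl r = xs r by move=> hr; rewrite nth_mkseq.
  have [_ _ /(_ ok N ha) []] := hQf (pi, xl).
    by apply: eq_bad hb => r hr /=; rewrite nx.
  move=> s [M [[r1 r2 r3 r4] hM]]; exists s, M; split.
    by split=> // [r hr|i r hi hr]; rewrite -nx //; [exact: r3|exact: r4].
  move=> i hi; have [h1 [j hj e]] := hM i hi; split=> //; rewrite e.
  rewrite inE !mem_cat; apply/orP; right; apply/orP; right; apply/orP; right.
  apply/flattenP; eexists; first by apply: map_f ok.
  apply/flattenP; eexists.
    apply: map_f; apply: (mem_tup (s := xl)); first by rewrite size_mkseq.
    by move=> x /mapP[r]; rewrite mem_iota => hr ->; apply: hxs.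
  by apply: (map_f (fun j => klev (KB (Qf (pi, xl)) j))); rewrite mem_iota.
Qed.

Section Envelope_of.
Variables (X Lv : seq nat).
Hypothesis Lv0 : 0 \in Lv.
Hypothesis LvX : forall x, x \in X -> base x \in Lv /\ klev (KR x) \in Lv.
Hypothesis Lv_closed : forall M k, M \in Lv -> kd M = Some k -> match k with
  | KM _ => True
  | KB Q _ => forall j, j < size Q -> klev (KB Q j) \in Lv
  | KR y => y \in X
  end.
Hypothesis Lv_split : forall x x' M, x \in X -> x' \in X ->
  line x M = line x' M -> line_letter x M <> line_letter x' M -> M \in Lv.
Hypothesis Lv_bad : forall pi xs N, okp pi -> 0 < plow pi ->
  (forall r, r < pup pi -> xs r \in X) -> bad pi (fun r => line (xs r) N) ->
  exists s M, real pi (fun r => line (xs r) N) s M /\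
    forall i, i < plow pi -> M i < N /\ M i \in Lv.

Let lvs := sort leq (undup Lv).
Let k0 := size lvs.
Let ell i := nth 0 lvs i.
Let e i := if i is i'.+1 then (ell i').+1 else 0.

Let lvs_sorted : sorted ltn lvs.
Proof. by rewrite ltn_sorted_uniq_leq sort_uniq undup_uniq sort_sorted //; exact: leq_total. Qed.

Let mem_lvs M : (M \in lvs) = (M \in Lv).
Proof. by rewrite mem_sort mem_undup. Qed.

Let ell_lt i j : i < j -> j < k0 -> ell i < ell j.
Proof. exact: sorted_nth_lt. Qed.

Let ell_mem i : i < k0 -> ell i \in Lv.
Proof. by move=> hi; rewrite -mem_lvs mem_nth. Qed.

Let mem_ell M : M \in Lv -> exists2 i, i < k0 & M = ell i.
Proof. by rewrite -mem_lvs => /(nthP 0) [i hi <-]; exists i. Qed.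

Let ell0 : ell 0 = 0.
Proof.
have [[//|i] hi h0] := mem_ell Lv0.
by have := ell_lt (ltn0Sn i) hi; rewrite -h0.
Qed.

Let ell_inv i j : i < k0 -> j < k0 -> ell i < ell j -> i < j.
Proof.
move=> hi hj; case: (ltngtP i j) => // [h|->]; last by rewrite ltnn.
have := ell_lt h hi; lia.
Qed.

Let e_le i : i < k0 -> e i <= ell i.
Proof. by case: i => [//|i] hi; apply: ell_lt. Qed.

Let below M i : i < k0 -> M \in Lv -> M < ell i -> M < e i.
Proof.
move=> hi /mem_ell [j hj ->] h; have := ell_inv hj hi h.
case: i hi h => [//|i] hi _; rewrite ltnS /= leq_eqVlt => /orP[/eqP->|hji]; first exact: ltnSn.
by rewrite ltnS ltnW // ell_lt // ltnW.
Qed.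

Let ell_next i a : i < k0 -> ell i = a -> a.+1 \in Lv -> i.+1 < k0 /\ ell i.+1 = a.+1.
Proof.
move=> hi ha /mem_ell [j hj ej].
have hij : i < j by apply: ell_inv => //; rewrite -ej ha.
have hi1 : i.+1 < k0 by exact: leq_ltn_trans hij hj.
split=> //; have h1 := ell_lt (ltnSn i) hi1.
case: (ltngtP i.+1 j) => h2; [have := ell_lt h2 hj; lia|lia|by rewrite h2].
Qed.

(** Any line of [X] through [w] will do: by [Lv_split] two of them cannot part before the next kept
    level. *)
Let ext w N :=
  let P := fun x => line x (len w) == w in
  if has P X then line (nth 0 X (find P X)) N else pad N w.

Let extP w N : (exists x, [/\ x \in X, line x (len w) = w & ext w N = line x N]) \/
  ext w N = pad N w.
Proof.
rewrite /ext; case: ifP => h; last by right.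
left; eexists; split; last by []; first by rewrite mem_nth // -has_find.
by apply/eqP; exact: (nth_find 0 h).
Qed.

Let ext_pref w N : wf w -> len w <= N -> lev N (ext w N) /\ pref w (ext w N).
Proof.
move=> hw hN; have [[x [hx e1 ->]]|->] := extP w N.
  by split; [exact: lev_line|rewrite -{1}e1; exact: pref_line].
by split; [exact: pad_lev|exact: pad_pref].
Qed.

Let ext_id w : ext w (len w) = w.
Proof.
have [[x [_ e1 ->]]|->] := extP w (len w) => //.
by rewrite /pad subnn.
Qed.

Let Psi i w := if i < k0 then ext w (ell i) else w.
Let f := build Psi.

Let fE t : f t = Psi (len t) (plus f t).
Proof. by rewrite /f plus_build. Qed.

(** A realisation reaching a level from [e n] on forces every upper node onto a line of [X], since
    blanks name nothing. Then [Lv_bad] offers one on kept levels, hence below [e n], where [plus f]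
    creates nothing. *)
Let f_ok n : pmor n f /\ forall i, i < n -> i < k0 -> lv f i = ell i.
Proof.
elim: n => [|n [IH IHl]]; first by split=> i.
have pn : n <= k0 -> pl f n = e n.
  by case: n IH IHl => [//|n] IH IHl hn /=; rewrite IHl.
have hz t : lev n t -> lev (pl f n) (plus f t).
  by move=> /levP[w et]; have := plus_lev IH w; rewrite et leqnn; apply.
have pa := plus_aged okp_pos okp_down IH.
case: (ltnP n k0) => hn; last first.
  have fn t : lev n t -> f t = plus f t.
    by move=> /levP[w et]; rewrite fE /Psi et ltnNge hn.
  split; last first.
    move=> i; rewrite ltnS leq_eqVlt => /orP[/eqP->|]; [by rewrite ltnNge hn|exact: IHl].
  apply: (pmor_step (N := pl f n)) => // [t ht|].
    by rewrite fn //; split=> //; exact: hz.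
  by apply: eq_aged pa => t ht; rewrite fn.
have {}pn := pn (ltnW hn).
have fn t : lev n t -> f t = ext (plus f t) (ell n).
  by move=> /levP[w et]; rewrite fE /Psi et hn.
have lz t : lev n t -> wf (plus f t) /\ len (plus f t) = e n.
  by move=> /hz /levP; rewrite pn.
have hp t : lev n t -> lev (ell n) (f t) /\ pref (plus f t) (f t).
  move=> ht; have [w et] := lz t ht; rewrite fn //.
  by apply: ext_pref => //; rewrite et e_le.
have hP : pmor n.+1 f.
  apply: (pmor_step (N := ell n)) => //.
  apply: (@eq_aged _ _ _ n (fun t => ext (plus f t) (ell n))); first by move=> t /fn ->.
  move=> pi ts ok hts [s [M hr]]; have h0 := okp_pos ok.
  have cut s' M' : real pi ((fun t => ext (plus f t) (ell n)) \o ts) s' M' ->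
      (forall i, i < plow pi -> M' i < e n) -> bad pi ts.
    move=> hr' hM; apply: pa => //; exists s', M'; apply: real_cut hr' => [r hr1|i r hi hr1] /=.
      by rewrite -fn ?hts //; case: (hp _ (hts r hr1)).
    by have [_ ->] := lz _ (hts r hr1); exact: hM.
  case: (boolP [forall i : 'I_(plow pi), M i < e n]) => [/forallP hM|].
    by apply: (cut s M) => // i hi; exact: (hM (Ordinal hi)).
  rewrite negb_forall => /existsP[[i hi]] /=; rewrite -leqNgt => hM.
  have hx r : exists x, r < pup pi -> x \in X /\ ext (plus f (ts r)) (ell n) = line x (ell n).
    case: (ltnP r (pup pi)) => hr'; last by exists 0.
    have [w et] := lz _ (hts r hr').
    have [[x [hx _ ex]]|ex] := extP (plus f (ts r)) (ell n); first by exists x.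
    case: (hr) => _ _ _ /(_ i r hi hr') /=; rewrite ex => /pad_lkp /lkp_len.
    by rewrite et ltnNge hM.
  have [xs hxs] := choice hx.
  have eqx r : r < pup pi -> ext (plus f (ts r)) (ell n) = line (xs r) (ell n).
    by move=> hr'; case: (hxs r hr').
  have ha : 0 < plow pi by lia.
  have [|s' [M' [[r1 r2 r3 r4] hM']]] := @Lv_bad pi xs (ell n) ok ha (fun r hr' => (hxs r hr').1).
    by apply: (@eq_bad _ _ pi ((fun t => ext (plus f t) (ell n)) \o ts)) => //; exists s, M.
  apply: (cut s' M') => [|i' hi'].
    by split=> // [r hr'|i' r hi' hr'] /=; rewrite eqx //; [exact: r3|exact: r4].
  by have [k1 k2] := hM' i' hi'; apply: below.
split=> // i; rewrite ltnS leq_eqVlt => /orP[/eqP-> _|]; last exact: IHl.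
by rewrite lvE; have [/lev_len] := hp _ (zw_lev C u0 n).
Qed.

Let f_mor : mor f. Proof. by move=> n; case: (f_ok n). Qed.
Let f_lv i : i < k0 -> lv f i = ell i. Proof. by case: (f_ok i.+1) => _; apply. Qed.

Let fn t : len t < k0 -> f t = ext (plus f t) (ell (len t)).
Proof. by move=> ht; rewrite fE /Psi ht. Qed.

Let padS n w : len w <= n -> pad n.+1 w = Ws (pad n w) (inl None).
Proof. by move=> h; rewrite /pad subSn. Qed.

(** Every line carries a mark on level 0, so none runs through a blank word of positive length. That
    level 0 is kept prevents [f] from following a line at the very start. *)
Let f_zero i v : i < k0 -> f (pad i (W0 C v)) = pad (ell i) (W0 C v).
Proof.
elim: i => [|i IH] hi.
  by rewrite fn // ell0 (_ : pad 0 (W0 C v) = W0 C v) //.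
have lp n : len (pad n (W0 C v)) = n by apply: pad_len.
rewrite fn lp // padS //= IH ?(ltnW hi) //.
rewrite -padS //.
have [[x [hx e1 _]]|->] := extP (pad (ell i).+1 (W0 C v)) (ell i.+1).
  have := lkp_line u0 u c m x (ell i).+1 0; rewrite lp in e1; rewrite e1.
  have -> : lkp (pad (ell i).+1 (W0 C v)) 0 = Some (inl None).
    by rewrite /pad subn0; elim: (ell i) => [//|n IHn]; exact: IHn.
  rewrite ltn0Sn => -[]; rewrite /ltr; have /= -> := @kd_klev m (KM 0) erefl.
  by case: (posnP (base x)) => [->|_]; rewrite ?eqxx.
rewrite {1}/pad lp /pad !subn0 -iterD subnK //.
exact: ell_lt.
Qed.

Let ext_line x i : x \in X -> i < k0 -> ext (line x (e i)) (ell i) = line x (ell i).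
Proof.
move=> hx hi; have hP : line x (len (line x (e i))) = line x (e i) by rewrite len_line.
have [x' [hx' e1 ->]] : exists x', [/\ x' \in X, line x' (len (line x (e i))) = line x (e i) &
    ext (line x (e i)) (ell i) = line x' (ell i)].
  rewrite /ext; case: ifP => [h|/negP[]]; last by apply/hasP; exists x => //; apply/eqP.
  eexists; split; last by []; first by rewrite mem_nth // -has_find.
  by apply/eqP; exact: (nth_find 0 h).
rewrite len_line in e1.
suff H N : e i <= N -> N <= ell i -> line x' N = line x N by apply: H => //; exact: e_le.
elim: N => [|N IH]; first by rewrite leqn0 => /eqP e0; rewrite e0 in e1.
rewrite leq_eqVlt => /orP[/eqP <-//|]; rewrite ltnS => h1 h2.
have h3 := IH h1 (ltnW h2).
rewrite !lineS h3; congr Ws; apply: contrapT => hne.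
have := below hi (Lv_split hx' hx h3 hne) h2; lia.
Qed.

Let block_levels Q : sorted ltn Q -> size Q <= m ->
  (forall j, j < size Q -> klev (KB Q j) \in Lv) -> 0 < size Q ->
  exists i0, forall j, j < size Q -> i0 + j < k0 /\ ell (i0 + j) = klev (KB Q j).
Proof.
move=> q1 q2 hQ h0; have [i0 hi0 e0] := mem_ell (hQ 0 h0).
exists i0; elim=> [|j IH] hj; first by rewrite addn0.
have [h1 h2] := IH (ltnW hj); rewrite !addnS.
have E : klev (KB Q j.+1) = (klev (KB Q j)).+1 by rewrite (klevB m Q j.+1) (klevB m Q j) addnS.
by rewrite E; apply: ell_next => //; rewrite -E; exact: hQ.
Qed.

(** The blanks before the block come from [f_zero], and inside it the kept levels are consecutive,
    so [f] inserts nothing there. *)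
Let block_pre Q i0 n q : (forall j, j < size Q -> i0 + j < k0 /\ ell (i0 + j) = klev (KB Q j)) ->
  n < size Q -> exists t, [/\ lev (i0 + n) t, f t = bl Q n q & 0 < n -> plus f t = bl Q n q].
Proof.
move=> hQ; elim: n q => [|n IH] q hn.
  have [h1 h2] := hQ 0 hn; rewrite addn0 in h1 h2 *.
  exists (pad i0 (W0 C (u q))); split=> //; first exact: pad_lev.
  by rewrite f_zero // h2.
have hn' := ltnW hn; have [h1 h2] := hQ _ hn; have [h3 h4] := hQ _ hn'.
have [t [ht1 ht2 _]] := IH q hn'; have [w et] := levP _ _ ht1.
have [s [ws ls es]] : exists s, [/\ wf s, len s <= i0 + n & plus f s = block_vert Q n].
  case: (posnP n) => [->|hn0]; first by exists (W0 C (u (nth 0 Q 0))).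
  have [s [/levP[ws ls] _ hs]] := IH (nth 0 Q n) hn'; exists s.
  by rewrite ls leqnn hs // /bv; case: (n) hn0.
pose t1 := Ws t (inr (s, c (nth 0 Q n) q)).
have e1 : plus f t1 = bl Q n.+1 q by rewrite blS /t1 /= ht2 es.
have l1 : lev (i0 + n.+1) t1.
  by apply/levP; rewrite /t1 /= w ws et ls addnS.
exists t1; split=> //.
rewrite fn ?(lev_len l1) // e1 h2 -[RHS]ext_id; congr ext.
by rewrite len_bl -klevB.
Qed.

Let block_vert_pre Q j i : sorted ltn Q -> size Q <= m -> j < size Q ->
  (forall j, j < size Q -> klev (KB Q j) \in Lv) -> i < k0 -> ell i = klev (KB Q j) ->
  exists s, [/\ wf s, len s <= i & plus f s = block_vert Q j].
Proof.
move=> q1 q2 hj hL hi he.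
have [i0 hi0] := block_levels q1 q2 hL (leq_ltn_trans (leq0n j) hj).
have [h1 h2] := hi0 j hj.
have ei : i = i0 + j.
  case: (ltngtP i (i0 + j)) => // h; [have := ell_lt h h1|have := ell_lt h hi]; lia.
case: (posnP j) => [->|hj0]; first by exists (W0 C (u (nth 0 Q 0))).
have [s [/levP[ws ls] _ hs]] := block_pre (nth 0 Q j) hi0 hj; exists s.
by rewrite ls ei leqnn hs // /bv; case: (j) hj0.
Qed.

(** Strong induction on the level, because a letter may name [top y] with [y] in [X], a word that
    ends at an earlier kept level. *)
Let line_pre i x : i <= k0 -> x \in X -> exists t, lev i t /\ plus f t = line x (e i).
Proof.
have [n] := ubnP i; elim: n i x => [//|n IH] [|i] x; rewrite ltnS => hin hi hx.
  by exists (W0 C (u x)).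
have [t [/levP[w et] ht]] := IH i x hin (ltnW hi) hx.
have ft : f t = line x (ell i) by rewrite fn et // ht ext_line.
suff [l [hl el]] : exists l, (if l is inr (s, _) then wf s && (len s <= i) else true) /\
    lmap (plus f) l = line_letter x (ell i).
  exists (Ws t l); split; last by rewrite /= ft el.
  by apply/levP; rewrite /= w et; split=> //; case: l hl {el} => // -[s d].
rewrite /ltr; case: ltnP => hb; last by case: eqP => _; [exists (inl (Some None))|exists (inl None)].
case E: (kd (ell i)) => [[y|Q j|y]|]; [by exists (inl (Some (Some (c y x))))| | |by exists (inl None)].
- have [/and3P[q1 q2 q3] qe] := kd_some E; have hL := Lv_closed (ell_mem hi) E.
  have [s [ws ls es]] := block_vert_pre q1 q2 q3 hL hi (esym qe).
  by exists (inr (s, c (nth 0 Q j) x)); rewrite /= es ws ls.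
- have [_ qe] := kd_some E; have hy := Lv_closed (ell_mem hi) E.
  have [hy1 _] := LvX hy; have [j hj ej] := mem_ell hy1.
  have hlt : base y < klev (KR y) by rewrite /=; lia.
  have hji : j < i by apply: (ell_inv hj hi); rewrite -ej -qe.
  have [s [/levP[ws ls] es]] := IH j.+1 y (leq_ltn_trans hji hin) hj hy.
  by exists (inr (s, c y x)); rewrite ws ls hji; split=> //; rewrite /= es topE ej.
Qed.

Lemma envelope_of : exists f, mor f /\ forall x, x \in X -> exists s M,
  [/\ wf s, len s <= M, M < size Lv, plus f s = top x & lv f M = klev (KR x)].
Proof.
exists f; split=> // x hx; have [h1 h2] := LvX hx.
have [i hi ei] := mem_ell h1; have [M hM eM] := mem_ell h2.
have [s [/levP[ws ls] es]] := line_pre hi hx.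
exists s, M; split=> //.
- rewrite ls; apply: (ell_inv hi hM); rewrite -ei -eM /=; lia.
- by apply: leq_trans hM _; rewrite /k0 size_sort size_undup.
- by rewrite es topE ei.
- by rewrite f_lv.
Qed.

End Envelope_of.

Theorem envelope X : exists f, mor f /\ forall x, x \in X -> exists s M,
  [/\ wf s, len s <= M, M < env_size (size X), plus f s = top x & lv f M = klev (KR x)].
Proof.
have [Lv [h1 [h2 h3] h4 h5 h6]] := env_levels X.
have [f [hf hx]] := envelope_of h2 h3 h4 h5 h6.
exists f; split=> // x /hx [s [M [a1 a2 a3 a4 a5]]]; exists s, M; split=> //.
exact: leq_trans a3 h1.
Qed.

End Envelope.

(** * The coded structure *)

Section Types.
Variables (Sym : finType) (ar : Sym -> nat).
Hypothesis Har : forall s, ar s = 1 \/ ar s = 2.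
Notation str := (structure ar).
Notation U := {set Sym}.
Notation C := ({set {s : Sym | ar s == 2}} * {set {s : Sym | ar s == 2}})%type.

Definition type1 (A : str) x : U := [set s | `[< Defs.rel A s (nseq (ar s) x) >]].
Definition type2 (A : str) x y : C :=
  ([set s | `[< Defs.rel A (val s) [:: x; y] >]], [set s | `[< Defs.rel A (val s) [:: y; x] >]]).

Lemma type1_eq (A B : str) x y : type1 A x = type1 B y -> forall s,
  Defs.rel A s (nseq (ar s) x) <-> Defs.rel B s (nseq (ar s) y).
Proof.
by move=> /setP h s; apply: asbool_eq_equiv; have := h s; rewrite !inE.
Qed.

Lemma type2_eq (A B : str) x y x' y' : type2 A x y = type2 B x' y' -> forall s, ar s = 2 ->
  (Defs.rel A s [:: x; y] <-> Defs.rel B s [:: x'; y']) /\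
  (Defs.rel A s [:: y; x] <-> Defs.rel B s [:: y'; x']).
Proof.
move=> [/setP h1 /setP h2] s /eqP e; pose s' : {s : Sym | ar s == 2} := Sub s e.
by split; apply: asbool_eq_equiv; [have := h1 s'|have := h2 s']; rewrite !inE.
Qed.

Lemma emb_of_types (A B : str) f : (forall x, in_dom A x -> in_dom B (f x)) ->
  (forall x y, in_dom A x -> in_dom A y -> f x = f y -> x = y) ->
  (forall x, in_dom A x -> type1 A x = type1 B (f x)) ->
  (forall x y, in_dom A x -> in_dom A y -> x < y -> type2 A x y = type2 B (f x) (f y)) ->
  is_emb A B f.
Proof.
move=> hd hi h1 h2; split=> //; split=> // s t st /allP dt.
case: (Har s) => e.
  case: t st dt => [|x [|y t]]; rewrite e // => _ dt.
  by have := type1_eq (h1 x (dt x (mem_head _ _))) s; rewrite e.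
case: t st dt => [|x [|y [|z t]]]; rewrite e // => _ dt.
have dx : in_dom A x by apply: dt; rewrite mem_head.
have dy : in_dom A y by apply: dt; rewrite !inE eqxx orbT.
case: (ltngtP x y) => [h|h|<-] /=.
- by case: (type2_eq (h2 x y dx dy h) e).
- by case: (type2_eq (h2 y x dy dx h) e).
- by have := type1_eq (h1 x dx) s; rewrite e.
Qed.

Lemma emb_type1 (A B : str) f x : is_emb A B f -> in_dom A x -> type1 A x = type1 B (f x).
Proof.
move=> [_ [_ h]] hx; apply/setP => s; rewrite !inE; apply: asbool_equiv_eq.
by rewrite -map_nseq; apply: h; [rewrite size_nseq|apply/allP => y /nseqP[->]].
Qed.

Lemma emb_type2 (A B : str) f x y : is_emb A B f -> in_dom A x -> in_dom A y ->
  type2 A x y = type2 B (f x) (f y).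
Proof.
move=> [_ [_ h]] hx hy; congr pair; apply/setP => s; rewrite !inE; apply: asbool_equiv_eq;
  by apply: h; rewrite /= ?hx ?hy // (eqP (valP s)).
Qed.

Lemma emb_comp (A B D : str) f g : is_emb A B f -> is_emb B D g -> is_emb A D (g \o f).
Proof.
move=> [f1 [f2 f3]] [g1 [g2 g3]]; split; first by move=> x /f1 /g1.
split=> [x y hx hy /(g2 _ _ (f1 _ hx) (f1 _ hy)) /f2|s t st dt]; first exact.
rewrite map_comp; apply: iff_trans (f3 s t st dt) _; apply: g3; rewrite ?size_map //.
by rewrite all_map; apply/allP => x /(allP dt) /f1.
Qed.

Section Free.
Variables (u : nat -> U) (c : nat -> nat -> C).

Definition str_rel (s : Sym) (t : seq nat) : Prop := size t = ar s /\
  match t with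
  | [:: x] => s \in u x
  | [:: x; y] =>
    if x == y then s \in u x else s \in val @: (if x < y then (c x y).1 else (c y x).2)
  | _ => False
  end.

Lemma str_rel_wf s t : str_rel s t -> size t = ar s /\ all (in_card None) t.
Proof. by case=> e _; split=> //; apply/allP. Qed.
Definition mkstr : str := Structure str_rel_wf.

Lemma type1_mkstr x : type1 mkstr x = u x.
Proof.
apply/setP => s; rewrite inE; apply/asboolP/idP; rewrite /= /str_rel.
  by case: (Har s) => -> /= [_]; rewrite ?eqxx.
by case: (Har s) => -> h /=; rewrite ?eqxx.
Qed.

Lemma type2_mkstr x y : x < y -> type2 mkstr x y = c x y.
Proof.
move=> h; have [h1 h2] : (x == y = false) /\ (y == x = false) by lia.
have h3 : (y < x) = false by lia.
have e (s' : {s : Sym | ar s == 2}) : 2 = ar (val s') by rewrite (eqP (valP s')).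
rewrite /type2 [RHS]surjective_pairing; congr pair; apply/setP => s; rewrite inE;
  apply/asboolP/idP; rewrite /= /str_rel ?h1 ?h2 ?h ?h3 (mem_imset _ _ val_inj);
  [by case|by move=> hs; split; first exact: e|by case|by move=> hs; split; first exact: e].
Qed.

Lemma mkstr_pt s t x : Defs.rel mkstr s t -> x \in t ->
  u x != set0 \/ exists y z, [/\ y < z, c y z != (set0, set0) & x = y \/ x = z].
Proof.
case=> _; case: t => [|y [|z [|//]]] //.
  by move=> h; rewrite inE => /eqP ->; left; apply/set0Pn; exists s.
have nz i j : s \in val @: (c i j).1 \/ s \in val @: (c i j).2 -> c i j != (set0, set0).
  by case: (c i j) => a b h; apply/eqP => -[ea eb]; case: h; rewrite /= ?ea ?eb imset0 inE.
case: (ltngtP y z) => [h|h|<-] hs; rewrite !inE.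
- by move=> hx; right; exists y, z; split=> //; [apply: nz; left|case/orP: hx => /eqP; auto].
- by move=> hx; right; exists z, y; split=> //; [apply: nz; right|case/orP: hx => /eqP; auto].
- by rewrite orbb => /eqP->; left; apply/set0Pn; exists s.
Qed.

(** The point where irreducibility enters: a pair inside a tuple has a nonempty 2-type, so it is not
    a default pair. *)
Lemma mkstr_pair s t x y : x < y -> Defs.rel mkstr s t -> x \in t -> y \in t ->
  c x y != (set0, set0).
Proof.
move=> hxy [_]; case: t => [|a [|b [|//]]] //.
  by move=> _; rewrite !inE => /eqP h1 /eqP h2; lia.
have nz i j : s \in val @: (c i j).1 \/ s \in val @: (c i j).2 -> c i j != (set0, set0).
  by case: (c i j) => a' b' h; apply/eqP => -[ea eb]; case: h; rewrite /= ?ea ?eb imset0 inE.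
case: (ltngtP a b) => [h|h|<-] hs; rewrite !inE => /orP[]/eqP h1 /orP[]/eqP h2; subst; try lia.
- by apply: nz; left.
- by apply: nz; right.
Qed.

End Free.

Definition fcard (F : str) := odflt 0 (Defs.card F).
(** All cuts of [F] into a lower initial segment and a nonempty rest; [down] only shifts the cut. *)
Definition pats_of (F : str) : seq (pattern U C) :=
  [seq Pattern a (fcard F - a) (type1 F) (type2 F) | a <- iota 0 (fcard F)].

Lemma pats_ofP F pi : pi \in pats_of F ->
  exists2 a, a < fcard F & pi = Pattern a (fcard F - a) (type1 F) (type2 F).
Proof. by case/mapP=> a; rewrite mem_iota => /= h ->; exists a. Qed.

Lemma pats_of_down F pi : pi \in pats_of F -> 0 < plow pi -> down pi \in pats_of F.
Proof.
case/pats_ofP=> [[|a] ha -> //= _]; apply/mapP; exists a; first by rewrite mem_iota; lia.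
by rewrite /down /= (_ : (fcard F - a.+1).+1 = fcard F - a) //; lia.
Qed.

Lemma mem_pats (Fam : seq str) pi : pi \in flatten (map pats_of Fam) <->
  exists F, InL F Fam /\ pi \in pats_of F.
Proof.
elim: Fam => [|F Fam IH] /=; first by split=> // -[F []].
rewrite mem_cat; split=> [/orP[h|/IH [G [h1 h2]]]|[G [[<-|h1] h2]]].
- by exists F; split; [left|].
- by exists G; split; [right|].
- by rewrite h2.
- by apply/orP; right; apply/IH; exists G.
Qed.

Lemma fcard_bound (Fam : seq str) F : InL F Fam -> fcard F <= sumn (map fcard Fam).
Proof. by elim: Fam => [//|G Fam IH] /= [->|/IH]; lia. Qed.

End Types.

(** * Numbering the coded vertices *)

Section Codes.
Variables (U C : finType).
Notation word := (word U C).

Definition vok (v : word * nat) := wf v.1 && (len v.1 <= v.2).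
(** Vertices are numbered level by level, so a vertex named by another one gets the smaller
    number. *)
Definition code (v : word * nat) : nat :=
  \sum_(j < v.2) size (lews U C j) + index v.1 (lews U C v.2).

Lemma code_lt v v' : vok v -> v.2 < v'.2 -> code v < code v'.
Proof.
case: v v' => s M [s' M'] /=; rewrite /vok -mem_lews -index_mem /code /= => h.
elim: M' s' => [//|M' IH] s'; rewrite ltnS leq_eqVlt => /orP[/eqP <-|/(IH s')].
  by rewrite big_ord_recr -addnA ltn_add2l ltn_addr.
rewrite big_ord_recr -addnA => /leq_trans; apply; rewrite leq_add2l.
exact: leq_trans (index_size _ _) (leq_addr _ _).
Qed.

Lemma code_inj v v' : vok v -> vok v' -> code v = code v' -> v = v'.
Proof.
move=> h h' e; have eM : v.2 = v'.2.
  by case: (ltngtP v.2 v'.2) => // hl; [have := code_lt h hl|have := code_lt h' hl]; rewrite e ltnn.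
case: v v' h h' e eM => s M [s' M'] /= h h' e eM; rewrite -eM in e h' *.
move: e; rewrite /code /= => /addnI e; congr pair.
move: h h'; rewrite /vok /= -!mem_lews => h h'.
by rewrite -(nth_index s h) e nth_index.
Qed.

(** Numbers coding nothing and pairs without a name receive the default types; hence any other type
    can be traced back to words. *)
Lemma coded_types (P : word * nat -> Prop) (u0 : U) (c0 : C) : (forall v, P v -> vok v) ->
  exists (u : nat -> U) (c : nat -> nat -> C),
  [/\ forall v, P v -> u (code v) = root v.1,
      forall v v' d, P v -> P v' -> lkp v'.1 v.2 = Some (inr (v.1, d)) ->
        c (code v) (code v') = d,
      forall x, u x != u0 -> exists2 v, P v & code v = x &
      forall x y, c x y != c0 -> exists v v', [/\ P v, P v', code v = x, code v' = y &
        lkp v'.1 v.2 = Some (inr (v.1, c x y))]].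
Proof.
move=> hP.
have /choice [u hu] : forall x, exists w : U, (forall v, P v -> code v = x -> w = root v.1) /\
    (w != u0 -> exists2 v, P v & code v = x).
  move=> x; case: (EM (exists2 v, P v & code v = x)) => [[v h e]|hn].
    by exists (root v.1); split=> [v' h' e'|_]; [rewrite (code_inj (hP _ h) (hP _ h')) ?e|exists v].
  by exists u0; split=> [v h e|]; [case: hn; exists v|rewrite eqxx].
have /choice [c hc] : forall q : nat * nat, exists c : C,
    (forall v v' d, P v -> P v' -> code v = q.1 -> code v' = q.2 ->
       lkp v'.1 v.2 = Some (inr (v.1, d)) -> c = d) /\
    (c != c0 -> exists v v', [/\ P v, P v', code v = q.1, code v' = q.2 &
        lkp v'.1 v.2 = Some (inr (v.1, c))]).
  move=> q.
  case: (EM (exists v v' d, [/\ P v, P v', code v = q.1, code v' = q.2 &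
        lkp v'.1 v.2 = Some (inr (v.1, d))])) => [[v [v' [d [h h' e e' hl]]]]|hn].
    exists d; split=> [w w' d' k k' f f'|_]; last by exists v, v'.
    rewrite -(code_inj (hP _ h) (hP _ k)) ?e // -(code_inj (hP _ h') (hP _ k')) ?e' //.
    by rewrite hl => -[].
  by exists c0; split=> [v v' d *|]; [case: hn; exists v, v', d|rewrite eqxx].
exists u, (fun x y => c (x, y)); split=> [v h|v v' d h h' hl|x|x y].
- exact: (hu _).1 h erefl.
- exact: (hc (code v, code v')).1 h h' erefl erefl hl.
- exact: (hu x).2.
- exact: (hc (x, y)).2.
Qed.

End Codes.

(** * The coded structure inside K, and the bound on the degrees *)

Section Main.
Variables (Sym : finType) (ar : Sym -> nat).
Hypothesis Har : forall s, ar s = 1 \/ ar s = 2.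
Notation str := (structure ar).
Notation U := {set Sym}.
Notation C := ({set {s : Sym | ar s == 2}} * {set {s : Sym | ar s == 2}})%type.
Notation word := (word U C).
Variable Fam : seq str.
Hypothesis HFam : forall F, InL F Fam -> finite_str F /\ irreducible F.
Variable K : str.
Hypothesis HK : KF_universal Fam K.

Definition free (A : str) := forall F, InL F Fam -> ~ ord_embeds F A.

Lemma ord_embeds_id (A : str) : ord_embeds A A.
Proof. by exists id; split=> //; split=> //; split=> // s t; rewrite map_id. Qed.

Lemma ord_embeds_trans (A B D : str) : ord_embeds A B -> ord_embeds B D -> ord_embeds A D.
Proof.
move=> [f [f1 f2]] [g [g1 g2]]; exists (g \o f); split; first exact: emb_comp f1 g1.
by move=> i j hi hj hij; apply: g2; [exact: f1.1|exact: f1.1|exact: f2].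
Qed.

Lemma K_free : free K.
Proof.
move=> F hF he; have [fF _] := HFam hF.
have /HK.1 [_ /(_ F hF)] : in_OAge K F by [].
by apply; exact: ord_embeds_id.
Qed.

Lemma free_embeds (A : str) : free A -> ord_embeds A K.
Proof.
move=> hA; apply: HK.2 => B [fB hB]; split=> // F hF hFB.
by apply: (hA F hF); exact: ord_embeds_trans hFB hB.
Qed.

(** Testing the last vertex of a copy is enough, because its word names all the others. *)
Definition legal (s : word) := forall F n, InL F Fam -> Defs.card F = Some n.+1 ->
  ~ bad (Pattern n 1 (type1 F) (type2 F)) (fun=> s).
Definition vert_ok (v : word * nat) := vok v /\ legal v.1.

(** In a copy of an irreducible [F] every pair has a nonempty type, so the vertices are coded ones
    naming one another, and the word of the last would not be legal. *)
Lemma coded_structure : exists2 A : str, [/\ Defs.card A = None,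
    forall v, vert_ok v -> type1 A (code v) = root v.1 &
    forall v v' d, vert_ok v -> vert_ok v' -> lkp v'.1 v.2 = Some (inr (v.1, d)) ->
      type2 A (code v) (code v') = d] & ord_embeds A K.
Proof.
have [u [c [h1 h2 h3 h4]]] := @coded_types _ _ vert_ok (set0 : U) ((set0, set0) : C) (fun v h => h.1).
exists (mkstr u c).
  split=> [//|v hv|v v' d hv hv' hl]; first by rewrite type1_mkstr // h1.
  rewrite type2_mkstr //; first exact: h2 hl.
  apply: code_lt hv.1 _; case/andP: hv'.1 => _; exact: leq_trans (lkp_len hl).
apply: free_embeds => F hF [g [ge go]]; have [[n en] irr] := HFam hF.
have dF i : in_dom F i = (i < n) by rewrite /in_dom en.
have named i j : i < j -> j < n -> exists v v',
    [/\ vert_ok v, vert_ok v', code v = g i, code v' = g j &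
        lkp v'.1 v.2 = Some (inr (v.1, c (g i) (g j)))].
  move=> hij hj; have hi := ltn_trans hij hj.
  have [s [t [hr [ti tj]]]] : exists s t, Defs.rel F s t /\ i \in t /\ j \in t.
    by apply: irr; rewrite dF.
  apply: h4; apply: (@mkstr_pair _ ar u c s (map g t)); rewrite ?map_f //.
    by apply: go; rewrite ?dF.
  have [ht1 ht2] := rel_wf hr.
  exact/(ge.2.2 _ _ ht1 ht2).
have vtx i : exists v, i < n -> vert_ok v /\ code v = g i.
  case: (ltnP i n) => hi; last by exists (W0 C set0, 0).
  have [s [t [hr [ti _]]]] : exists s t, Defs.rel F s t /\ i \in t /\ i \in t.
    by apply: irr; rewrite dF.
  have [ht1 ht2] := rel_wf hr.
  have := @mkstr_pt _ ar u c s (map g t) (g i) _ (map_f g ti).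
  case; first exact/(ge.2.2 _ _ ht1 ht2).
    by move=> /h3 [v v1 v2]; exists v.
  move=> [y [z [hyz /h4 [v [v' [v1 v2 v3 v4 _]]] [e|e]]]]; [exists v|exists v'];
    by rewrite e.
have [V hV] := choice vtx.
(* An empty [F] has no last vertex, but it would embed into [K]. *)
case: n => [|n] in en dF named vtx V hV *.
  apply: (K_free hF); exists id; split=> [|i j]; last by rewrite dF.
  split=> [x|]; first by rewrite dF.
  split=> [x y|s t st]; first by rewrite dF.
  case: t st => [|x t]; last by move=> _ /=; rewrite dF.
  by case: (Har s) => ->.
have hn : n < n.+1 by [].
apply: (hV n hn).1.2 hF en _.
have lk i j : i < j -> j < n.+1 -> lkp (V j).1 (V i).2 = Some (inr ((V i).1, type2 F i j)).
  move=> hij hj; have hi := ltn_trans hij hj.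
  have [v [v' [v1 v2 v3 v4 v5]]] := named i j hij hj.
  have [w1 w2] := hV i hi; have [w3 w4] := hV j hj.
  have ei : v = V i by apply: code_inj; [exact: v1.1|exact: w1.1|rewrite w2].
  have ej : v' = V j by apply: code_inj; [exact: v2.1|exact: w3.1|rewrite w4].
  rewrite -ei -ej v5 (emb_type2 ge) ?dF // type2_mkstr //.
  by apply: go; rewrite ?dF.
have rt i : i < n.+1 -> root (V i).1 = type1 F i.
  move=> hi; have [w1 w2] := hV i hi.
  by rewrite (emb_type1 ge) ?dF // type1_mkstr // -w2 h1.
exists (fun i => (V i).1), (fun i => (V i).2); split=> /=.
- by move=> i hi; apply: rt; exact: ltnW.
- by move=> i j hij hj; apply: lk => //; exact: ltnW.
- by case=> // _; rewrite addn0; exact: rt.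
- by move=> i [|//] hi _; rewrite addn0; apply: lk.
Qed.

Let Pats : seq (pattern U C) := flatten (map (@pats_of _ ar) Fam).
Let okp pi := pi \in Pats.
Let m := sumn (map (@fcard _ ar) Fam).

Let okp_pos pi : okp pi -> 0 < pup pi.
Proof. by move=> /mem_pats [F [_ /pats_ofP [a ha ->]]] /=; lia. Qed.

Let okp_down pi : okp pi -> 0 < plow pi -> okp (down pi).
Proof.
move=> /mem_pats [F [h1 h2]] h3; apply/mem_pats; exists F; split=> //.
exact: pats_of_down.
Qed.

Let okp_bound pi : okp pi -> plow pi <= m /\ pup pi <= m.
Proof.
move=> /mem_pats [F [/fcard_bound h /pats_ofP [a ha ->]]] /=; rewrite /m; lia.
Qed.

Let okp_vert F n : InL F Fam -> Defs.card F = Some n.+1 ->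
  okp (Pattern n 1 (type1 F) (type2 F)).
Proof.
move=> hF e; apply/mem_pats; exists F; split=> //; apply/mapP; exists n.
  by rewrite /fcard e mem_iota /=; lia.
by rewrite /fcard e /= subSnn.
Qed.

Let top := top (set0 : U) (type1 K) (type2 K) m.
Let klev := klev m.
Let base := base m.
Let mor := mor (set0 : U) okp.
Let lv (h : word -> word) := lv (set0 : U) h.

(** A realisation in the word of [x] projects by [kap] to a copy of [F] in [K]; members of blocks
    have the types of the vertices they copy. *)
Let top_legal x : in_dom K x -> legal (top x).
Proof.
move=> dx F n hF en; rewrite /top topE => -[s [M hr]].
have [//|ks [k1 k2 k3 k4]] := real_kinds _ hr.
have dF i : in_dom F i = (i < n.+1) by rewrite /in_dom en.
pose g i := if i < n then kap (ks i) else x.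
have gx i : i < n -> kap (ks i) < x by move=> hi; case: (k4 i 0 hi isT).
have g_lt i j : i < j -> j < n.+1 -> g i < g j.
  rewrite /g ltnS => hij; rewrite leq_eqVlt => /orP[/eqP ej|hj].
    by rewrite ej ltnn in hij *; rewrite hij gx.
  by rewrite hj (ltn_trans hij hj); case: (k2 i j hij hj).
apply: (K_free hF); exists g; split; last by move=> i j; rewrite !dF => _ hj hij; exact: g_lt.
apply: emb_of_types => //.
- move=> i _; rewrite /g; case: ltnP => // hi; move: dx; rewrite /in_dom.
  by case: (Defs.card K) => //= N; apply: ltn_trans; exact: gx.
- move=> i j; rewrite !dF => hi hj e; case: (ltngtP i j) => // hij.
    by have := g_lt i j hij hj; rewrite e ltnn.
  by have := g_lt j i hij hi; rewrite e ltnn.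
- move=> i; rewrite dF ltnS leq_eqVlt /g => /orP[/eqP->|hi].
    by rewrite ltnn; have := k3 0 isT; rewrite addn0 => ->.
  by rewrite hi; case: (k1 i hi).
- move=> i j _; rewrite dF ltnS leq_eqVlt /g => /orP[/eqP->|hj] hij.
    by rewrite ltnn hij; have [_ ->] := k4 i 0 hij isT; rewrite addn0.
  by rewrite hj (ltn_trans hij hj); case: (k2 i j hij hj) => _ ->.
Qed.

Let legal_plus h s : mor h -> wf s -> legal s -> legal (plus h s).
Proof.
move=> mh ws hs F n hF en hb; apply: (hs F n hF en).
apply: (plus_aged okp_pos okp_down (mh (len s)) (okp_vert hF en)) hb.
by move=> r _; apply/levP.
Qed.

(** The level of [x] lies above the end of its word and below [base y] for every later [y]; so the
    word of [y] names [x] with the 2-type it has in [K], and [h] preserves this. *)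
Let self_emb h A iota : mor h -> is_emb A K iota -> 
    Defs.card A = None ->
    (forall v, vert_ok v -> type1 A (code v) = root v.1) ->
    (forall v v' d, vert_ok v -> vert_ok v' -> lkp v'.1 v.2 = Some (inr (v.1, d)) ->
      type2 A (code v) (code v') = d) ->
  is_emb K K (fun x => iota (code (plus h (top x), lv h (klev (KR x))))).
Proof.
move=> mh hi eA a1 a2.
pose w x := (plus h (top x), lv h (klev (KR x))).
have wt x : wf (top x) by exact: wf_top.
have lt x : len (top x) = (base x).+1 by rewrite /top topE len_line.
have bk x : base x < klev (KR x) by rewrite /klev /base /=; lia.
have wv x : in_dom K x -> vert_ok (w x).
  move=> dx; split; last exact: legal_plus (top_legal dx).
  have /levP[w1 w2] := plus_lev (mh _) (wt x) (leqnn _).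
  by rewrite /vok /= w1 w2 lt /=; apply: (lv_lt (mh (klev (KR x)).+1)).
have kb x y : x < y -> klev (KR x) < base y.
  move=> hxy; have /andP[_ h1] := @klev_stage m (KR x) isT.
  exact: leq_trans h1 (base_le m hxy).
have lk x y : x < y -> lkp (w y).1 (w x).2 = Some (inr ((w x).1, type2 K x y)).
  move=> /kb hxy; rewrite /= (lkp_plus (mh (len (top y)))) // ?lt ?ltnS ?(ltnW hxy) //.
  by rewrite {1}/top topE (@lkp_line_kind _ _ _ _ _ _ _ _ (KR x)) //; exact: ltnW.
have cd_lt x y : in_dom K x -> in_dom K y -> x < y -> code (w x) < code (w y).
  move=> dx dy hxy; apply: code_lt; first by case: (wv x dx).
  have [/andP[_ h1] _] := wv y dy; exact: leq_trans (lkp_len (lk x y hxy)) h1.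
apply: (@emb_comp _ _ _ _ _ (fun x => code (w x)) iota _ hi).
apply: emb_of_types => //.
- by move=> x _; rewrite /in_dom eA.
- move=> x y dx dy e; case: (ltngtP x y) => // hxy.
    by have := cd_lt x y dx dy hxy; rewrite e ltnn.
  by have := cd_lt y x dy dx hxy; rewrite e ltnn.
- move=> x dx; rewrite a1; last exact: wv.
  by rewrite /= (root_plus (mh (len (top x)))) // /top topE root_line.
- move=> x y dx dy hxy; rewrite (a2 _ _ (type2 K x y)) //; [exact: wv|exact: wv|exact: lk].
Qed.

Theorem big_ramsey_degrees (X : seq nat) : exists n : nat, forall (k : nat) (chi : seq nat -> 'I_k),
  exists F : nat -> nat, is_emb K K F /\ exists S : {set 'I_k}, #|S| <= n /\
    (forall e, size e = size X -> chi (map F e) \in S).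
Proof.
have [A [eA a1 a2] [iota [hi _]]] := coded_structure.
pose b := env_size m Pats (size X).
pose good (p : word * nat) := vok p && (p.2 < b).
pose vs : seq (word * nat) := [seq (s, M) | M <- index_iota 0 b, s <- lews U C M].
have vsP p : good p -> p \in vs.
  case: p => s M /andP[h1 h2]; apply/allpairsPdep; exists M, s; split=> //.
    by rewrite mem_index_iota.
  by rewrite mem_lews.
pose Ys := tup vs (size X).
exists (size Ys) => k chi.
(* The filter makes the colour depend on [f] below level [b] only, for any list [Y]. *)
pose chiY (Y : seq (word * nat)) (f : word -> word) :=
  chi [seq iota (code (plus f p.1, lv f p.2)) | p <- Y & good p].
have [Y f f' e|h [mh hc]] := @ramsey_seq _ _ (set0 : U) okp okp_pos okp_down b _ _ chiY Ys.
  rewrite /chiY; congr chi; apply/eq_in_map => -[s M]; rewrite mem_filter => /andP[/andP[/andP[w1 w2] w3] _].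
  congr (iota (code (_, _))); first by apply: (plus_ext e w1); exact: leq_trans w2 (ltnW w3).
  by rewrite /lv lvE e //; [exact: pad_wf|rewrite pad_len].
exists (fun x => iota (code (plus h (top x), lv h (klev (KR x))))).
split; first exact: (self_emb mh hi eA a1 a2).
exists [set chiY (nth [::] Ys j) h | j : 'I_(size Ys)]; split.
  by apply: leq_trans (leq_imset_card _ _) _; rewrite card_ord.
move=> e se.
have [f [mf hf]] := envelope (set0 : U) (type1 K) (type2 K) okp_pos okp_down okp_bound e.
have /choice [V hV] : forall x, exists v : word * nat, x \in e ->
    [/\ good v, plus f v.1 = top x & lv f v.2 = klev (KR x)].
  move=> x; case: (boolP (x \in e)) => [/hf [s [M [h1 h2 h3 h4 h5]]]|_]; last by exists (top x, 0).
  by exists (s, M) => _; split=> //; rewrite /good /vok /= h1 h2 /b -se.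
pose Y := map V e.
have gY : all good Y by apply/allP => v /mapP[x hx ->]; case: (hV x hx).
have YY : Y \in Ys.
  by apply: mem_tup; [rewrite size_map|move=> v /(allP gY) /vsP].
have jY : index Y Ys < size Ys by rewrite index_mem.
apply/imsetP; exists (Ordinal jY) => //=.
(* Below level [b] both [f] and [id] are morphisms, so they get the same colour after [h]: for [f]
   it is the colour of the given copy, for [id] one of the listed values. *)
have := hc [::] (index Y Ys) f id jY (mf b) (@mor_id _ _ _ _ b).
rewrite nth_index // => <-; rewrite /chiY (all_filterP gY) -map_comp; congr chi.
apply/eq_in_map => x hx /=; have [/andP[/andP[w1 w2] w3] h1 h2] := hV x hx.
congr (iota (code (_, _))); first by rewrite -h1 -plus_comp.
rewrite -[LHS]/(lv h (klev (KR x))) -h2; exact: esym (lv_comp (mf _) (ltnSn _) (ltnSn _) (mh _)).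
Qed.

End Main.

Theorem mainTheorem16 (Sym : finType) (ar : Sym -> nat)
  (Har : forall s, ar s = 1 \/ ar s = 2)
  (Fam : seq (structure ar))
  (HFam : forall F, InL F Fam -> finite_str F /\ irreducible F)
  (K : structure ar) (HK : KF_universal Fam K) :
  forall X : seq nat, uniq X -> all (in_dom K) X ->
  exists n : nat, forall (k : nat) (chi : seq nat -> 'I_k),
    exists F : nat -> nat, is_emb K K F /\
      exists S : {set 'I_k}, #|S| <= n /\
        (forall e, sub_emb K X e -> chi (map F e) \in S).
Proof.
move=> X _ _; have [n hn] := big_ramsey_degrees Har HFam HK X; exists n => k chi.
have [F [hF [S [hS hc]]]] := hn k chi; exists F; split=> //; exists S; split=> // e [se _].
exact: hc.
Qed.
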